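(* If $f\in W^{1,\infty}(\mathbb{R}^n)$, then $$\nabla^\alpha_w f\rightharpoonup\nabla_w f\quad\text{in }L^\infty(\mathbb{R}^n;\mathbb{R}^n)\text{ as }\alpha\to1^-$$ and $$\|\nabla_w f\|_{L^\infty(\mathbb{R}^n;\,\mathbb{R}^n)}\le\liminf_{\alpha\to1^-}\|\nabla^\alpha_w f\|_{L^\infty(\mathbb{R}^n;\,\mathbb{R}^n)}.$$
   Context: Here $n\in\mathbb{N}$, $n\ge 1$, and $\nabla_w f$ is the weak gradient of $f$. For $\alpha\in(0,1)$ let $\mu_{n,\alpha}:=2^\alpha\pi^{-n/2}\,\Gamma\big(\tfrac{n+\alpha+1}{2}\big)/\Gamma\big(\tfrac{1-\alpha}{2}\big)$, and for $\varphi\in C^\infty_c(\mathbb{R}^n;\mathbb{R}^n)$ let $$\mathrm{div}^\alpha\varphi(x):=\mu_{n,\alpha}\int_{\mathbb{R}^n}\frac{(y-x)\cdot(\varphi(y)-\varphi(x))}{|y-x|^{n+\alpha+1}}\,dy,\qquad x\in\mathbb{R}^n,$$ which belongs to $L^q(\mathbb{R}^n)$ for all $q\in[1,+\infty]$. For $f\in L^\infty(\mathbb{R}^n)$, the weak fractional $\alpha$-gradient $\nabla^\alpha_w f\in L^1_{\rm loc}(\mathbb{R}^n;\mathbb{R}^n)$ is the (unique, if it exists) function such that $\int_{\mathbb{R}^n} f\,\mathrm{div}^\alpha\varphi\,dx=-\int_{\mathbb{R}^n}\nabla^\alpha_w f\cdot\varphi\,dx$ for all $\varphi\in C^\infty_c(\mathbb{R}^n;\mathbb{R}^n)$.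 For $f\in W^{1,\infty}(\mathbb{R}^n)$ and every $\alpha\in(0,1)$, $\nabla^\alpha_w f$ exists and belongs to $L^\infty(\mathbb{R}^n;\mathbb{R}^n)$. The symbol $g_\alpha\rightharpoonup g$ in $L^\infty(\mathbb{R}^n;\mathbb{R}^n)$ denotes weak*-convergence: $\int g_\alpha\cdot\varphi\,dx\to\int g\cdot\varphi\,dx$ for all $\varphi\in L^1(\mathbb{R}^n;\mathbb{R}^n)$. *)

(* Defs.v *)
From HB Require Import structures.
From mathcomp Require Import all_boot all_order all_algebra.
From mathcomp Require Import all_classical all_reals all_analysis.

Set Implicit Arguments.
Unset Strict Implicit.
Unset Printing Implicit Defensive.

Import Order.TTheory GRing.Theory Num.Theory.
Import numFieldNormedType.Exports.

Local Open Scope classical_set_scope.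
Local Open Scope ring_scope.

(* R^n is 'rV[R]_n. The topology of 'rV[R]_n comes from the sup norm `|x| of the
   library; the Euclidean norm is [enorm] below. *)

Definition measure_rV_display : measure_display.
Proof. exact: default_measure_display. Qed.

Definition coord_rV (R : realType) (n : nat) (i : 'I_n) (x : 'rV[R]_n) : R :=
  x 0 i.

Section measurable_rV.
Variables (R : realType) (n : nat).

Let coors : 'I_n -> 'rV[R]_n -> R := @coord_rV R n.

Let rV_set0 : g_sigma_preimage coors set0.
Proof. exact: sigma_algebra0. Qed.

Let rV_setC A : g_sigma_preimage coors A -> g_sigma_preimage coors (~` A).
Proof. exact: sigma_algebraC. Qed.

Let rV_bigcup (F : (set _)^nat) : (forall i, g_sigma_preimage coors (F i)) ->
  g_sigma_preimage coors (\bigcup_i (F i)).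
Proof. exact: sigma_algebra_bigcup. Qed.

(* The product sigma-algebra, i.e. the Borel sets of R^n. *)
HB.instance Definition _ := @isMeasurable.Build measure_rV_display
  'rV[R]_n (g_sigma_preimage coors) rV_set0 rV_setC rV_bigcup.

End measurable_rV.

Lemma measurable_coord_rV (R : realType) (n : nat) (i : 'I_n) :
  measurable_fun setT (@coord_rV R n i).
Proof.
move=> _ Y mY; rewrite setTI; apply: sub_sigma_algebra => /=.
rewrite -bigcup_seq/=; exists i => /=; first by rewrite mem_index_enum.
by exists Y => //; rewrite setTI.
Qed.

Lemma measurable_fun_rVP d (T : measurableType d) (R : realType) (n : nat)
    (f : T -> 'rV[R]_n) :
  measurable_fun setT f <->
  forall i, measurable_fun setT (fun x => f x 0 i).
Proof.
split=> [mf i|mf].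
  have := measurableT_comp (@measurable_coord_rV R n i) mf.
  exact.
move=> _ A mA; rewrite setTI.
suff : g_sigma_preimage (fun i : 'I_n => @coord_rV R n i \o f) `<=` measurable.
  apply; rewrite (g_sigma_preimage_comp (@coord_rV R n) f).
  by exists A => //; rewrite setTI.
apply: smallest_sub; first exact: sigma_algebra_measurable.
rewrite -bigcup_seq => B [i _ [C mC <-]].
exact: mf.
Qed.

Definition cons_rV (R : realType) (n : nat) (p : R * 'rV[R]_n) : 'rV[R]_n.+1 :=
  row_mx (p.1%:M : 'rV_1) p.2.

Definition behead_rV (R : realType) (n : nat) (x : 'rV[R]_n.+1) :
  R * 'rV[R]_n := (x 0 0, rsubmx (x : 'rV_(1 + n))).

Lemma cons_rV0 (R : realType) (n : nat) (p : R * 'rV[R]_n) :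
  cons_rV p 0 0 = p.1.
Proof.
have -> : 0 = lshift n (0 : 'I_1) :> 'I_(1 + n) by exact/val_inj.
by apply: etrans (row_mxEl _ _ _ _) _; rewrite mxE eqxx mulr1n.
Qed.

Lemma cons_rVS (R : realType) (n : nat) (p : R * 'rV[R]_n) (i : 'I_n) :
  cons_rV p 0 (lift 0 i) = p.2 0 i.
Proof.
have -> : lift 0 i = rshift 1 i :> 'I_(1 + n) by exact/val_inj.
exact: row_mxEr.
Qed.

Lemma measurable_cons_rV (R : realType) (n : nat) :
  measurable_fun [set: measurableTypeR R * 'rV[R]_n] (@cons_rV R n).
Proof.
apply/measurable_fun_rVP => i.
case: (unliftP 0 i) => [j|] ->.
  under eq_fun do rewrite cons_rVS.
  exact: (measurableT_comp (@measurable_coord_rV R n j) measurable_snd).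
under eq_fun do rewrite cons_rV0.
exact: measurable_fst.
Qed.

Lemma measurable_behead_rV (R : realType) (n : nat) :
  measurable_fun [set: 'rV[R]_n.+1]
    (@behead_rV R n : _ -> measurableTypeR R * 'rV[R]_n).
Proof.
apply/measurable_fun_pairP; split; first exact: measurable_coord_rV.
apply/measurable_fun_rVP => i /=.
under eq_fun do rewrite mxE.
exact: measurable_coord_rV.
Qed.

Lemma cons_rVK (R : realType) (n : nat) :
  cancel (@cons_rV R n) (@behead_rV R n).
Proof.
move=> p; rewrite [RHS]surjective_pairing /behead_rV cons_rV0.
by rewrite /cons_rV row_mxKr.
Qed.

Lemma sigma_finite_product_measure1 d1 d2 (T1 : measurableType d1)
    (T2 : measurableType d2) (R : realType)
    (m1 : {sigma_finite_measure set T1 -> \bar R})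
    (m2 : {sigma_finite_measure set T2 -> \bar R}) :
  sigma_finite setT (m1 \x m2)%E.
Proof.
have /sigma_finiteP[F [TF ndF Foo]] := sigma_finiteT m1.
have /sigma_finiteP[G [TG ndG Goo]] := sigma_finiteT m2.
exists (fun n => F n `*` G n).
  rewrite -setXTT TF TG predeqE => -[x y]; split=> [[/= [n _ Fnx] [k _ Gky]]|].
    exists (maxn n k) => //; split.
    - by move: x Fnx; exact/subsetPset/ndF/leq_maxl.
    - by move: y Gky; exact/subsetPset/ndG/leq_maxr.
  by move=> [n _ []/= ? ?]; split; exists n.
move=> k; have [? ?] := Foo k; have [? ?] := Goo k.
split; first exact: measurableX.
by rewrite product_measure1E// lte_mul_pinfty// ge0_fin_numE.
Qed.

(* Lebesgue measure on R^n, as the n-fold product of the one-dimensional one. *)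
Section lebesgue_rV_step.
Variables (R : realType) (n : nat).
Variable mu : {sigma_finite_measure set 'rV[R]_n -> \bar R}.

Definition lebesgue_rV_cons : set 'rV[R]_n.+1 -> \bar R :=
  pushforward (@lebesgue_measure R \x mu)%E (@cons_rV R n).

Let lebesgue_rV_cons0 : lebesgue_rV_cons set0 = 0%E.
Proof. by rewrite /lebesgue_rV_cons /pushforward preimage_set0 measure0. Qed.

Let lebesgue_rV_cons_ge0 A : (0 <= lebesgue_rV_cons A)%E.
Proof. by rewrite /lebesgue_rV_cons /pushforward; exact: measure_ge0. Qed.

Let lebesgue_rV_cons_sigma_additive : semi_sigma_additive lebesgue_rV_cons.
Proof.
have mc := @measurable_cons_rV R n.
move=> F mF tF mUF; rewrite /lebesgue_rV_cons /pushforward preimage_bigcup.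
apply: measure_semi_sigma_additive.
- by move=> k; rewrite -[X in measurable X]setTI; exact: mc.
- apply/trivIsetP => /= i j _ _ ij; rewrite -preimage_setI.
  by move/trivIsetP : tF => /(_ _ _ _ _ ij) ->//; rewrite preimage_set0.
- by rewrite -preimage_bigcup -[X in measurable X]setTI; exact: mc.
Qed.

HB.instance Definition _ := isMeasure.Build _ _ _ lebesgue_rV_cons
  lebesgue_rV_cons0 lebesgue_rV_cons_ge0 lebesgue_rV_cons_sigma_additive.

Let lebesgue_rV_cons_sigma_finite : sigma_finite setT lebesgue_rV_cons.
Proof.
have [F FT Foo] := sigma_finite_product_measure1 (@lebesgue_measure R) mu.
exists (fun k => @behead_rV R n @^-1` F k).
  by rewrite -preimage_bigcup -FT preimage_setT.
move=> k; have [mFk Fkoo] := Foo k; split.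
  by rewrite -[X in measurable X]setTI; exact: measurable_behead_rV.
rewrite /lebesgue_rV_cons /pushforward -comp_preimage.
by rewrite (_ : _ \o _ = id) ?preimage_id//; apply/funext => x; exact: cons_rVK.
Qed.

HB.instance Definition _ := Measure_isSigmaFinite.Build _ _ _ lebesgue_rV_cons
  lebesgue_rV_cons_sigma_finite.

End lebesgue_rV_step.

Fixpoint lebesgue_rV (R : realType) (n : nat) :
    {sigma_finite_measure set 'rV[R]_n -> \bar R} :=
  if n is m.+1 then lebesgue_rV_cons (lebesgue_rV R m)
  else \d_(0 : 'rV[R]_0).

Lemma lebesgue_rV_box (R : realType) (n : nat) (A : 'I_n -> set R) :
  (forall i, measurable (A i)) ->
  lebesgue_rV R n [set x : 'rV[R]_n | forall i, A i (x 0 i)] =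
  (\prod_(i < n) @lebesgue_measure R (A i))%E.
Proof.
elim: n A => [|n IH] A mA.
  by rewrite big_ord0 /= diracE mem_set// => -[].
rewrite big_ord_recl -IH; last by move=> i; exact: mA.
rewrite -product_measure1E; first last.
- rewrite (_ : (fun x => _) = \bigcap_(i in [set: 'I_n])
      (@coord_rV R n i @^-1` A (lift 0 i))); last first.
    by apply/seteqP; split => [x Ax i _|x Ax i]; [exact: Ax|exact: Ax i I].
  apply: fin_bigcap_measurable => // i _.
  by rewrite -[X in measurable X]setTI; exact: measurable_coord_rV.
- exact: mA.
rewrite /= /lebesgue_rV_cons /pushforward; congr (product_measure1 _ _ _).
apply/seteqP; split => [[a x] /= Ax|[a x] /= [Aa Ax] i].
  split=> [|i]; first by have := Ax 0; rewrite cons_rV0.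
  by have := Ax (lift 0 i); rewrite cons_rVS.
by case: (unliftP 0 i) => [j|] ->; rewrite ?cons_rVS ?cons_rV0//; exact: Ax.
Qed.

Section euclidean.
Variables (R : realType) (n : nat).
Implicit Types u v : 'rV[R]_n.

Definition dotr u v : R := \sum_(i < n) u 0 i * v 0 i.

Definition enorm u : R := Num.sqrt (dotr u u).

End euclidean.

Section Lebesgue_spaces.
Variables (R : realType) (n : nat).
Local Notation mu := (lebesgue_rV R n).
Implicit Types g : 'rV[R]_n -> 'rV[R]_n.

(* The norm of L^p(R^n; R^n), with |g(x)| the Euclidean norm. *)
Definition vLnorm (p : \bar R) g : \bar R :=
  Lnorm mu p (fun x => (enorm (g x))%:E).

(* g is (a representative of) an element of L^p(R^n; R^n). *)
Definition vLfun (p : \bar R) g : Prop :=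
  measurable_fun setT g /\ (vLnorm p g < +oo)%E.

(* g is (a representative of) an element of L^1_loc(R^n; R^n). *)
Definition vL1loc g : Prop :=
  measurable_fun setT g /\
  forall K : set 'rV[R]_n, compact K ->
    (\int[mu]_(x in K) (enorm (g x))%:E < +oo)%E.

(* Weak* convergence in L^infty(R^n; R^n), the dual of L^1(R^n; R^n). *)
Definition weak_star_cvg (I : Type) (F : set_system I)
    (g_ : I -> 'rV[R]_n -> 'rV[R]_n) g : Prop :=
  [/\ \forall i \near F, vLfun +oo%E (g_ i),
      vLfun +oo%E g &
      forall psi : 'rV[R]_n -> 'rV[R]_n, vLfun 1%E psi ->
        (\int[mu]_x dotr (g_ i x) (psi x)) @[i --> F] -->
          \int[mu]_x dotr (g x) (psi x)].

End Lebesgue_spaces.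

Section test_functions.
Variables (R : realType) (n : nat).

Definition partial (V : normedModType R) (i : 'I_n) (phi : 'rV[R]_n -> V) :
  'rV[R]_n -> V := 'D_(delta_mx 0 i) phi.

(* 'D_v phi is a junk value where phi is not derivable, hence the derivability
   requirement on every iterated partial derivative. *)
Definition smooth (V : normedModType R) (phi : 'rV[R]_n -> V) : Prop :=
  forall s : seq 'I_n,
    continuous (foldr (@partial V) phi s) /\
    forall i x, derivable (foldr (@partial V) phi s) x (delta_mx 0 i).

(* C^infty_c(R^n; R^n) *)
Definition test_field (phi : 'rV[R]_n -> 'rV[R]_n) : Prop :=
  smooth phi /\ compact (closure [set x | phi x != 0]).

Definition divergence (phi : 'rV[R]_n -> 'rV[R]_n) (x : 'rV[R]_n) : R :=
  \sum_(i < n) partial i phi x 0 i.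

End test_functions.

Definition Gamma (R : realType) (s : R) : R :=
  \int[@lebesgue_measure R]_(t in `]0, +oo[) (t `^ (s - 1) * expR (- t)).

Definition frac_cst (R : realType) (n : nat) (a : R) : R :=
  2 `^ a * pi `^ (- (n%:R / 2)) *
  Gamma ((n%:R + a + 1) / 2) / Gamma ((1 - a) / 2).

Section gradients.
Variables (R : realType) (n : nat).
Local Notation mu := (lebesgue_rV R n).
Implicit Types (f : 'rV[R]_n -> R) (g phi : 'rV[R]_n -> 'rV[R]_n).

(* The integrand is 0 at y = x, where its numerator vanishes. *)
Definition frac_divergence (a : R) phi (x : 'rV[R]_n) : R :=
  frac_cst n a *
  \int[mu]_y (dotr (y - x) (phi y - phi x) /
              enorm (y - x) `^ (n%:R + a + 1)).

Definition is_weak_gradient f g : Prop :=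
  vL1loc g /\
  forall phi, test_field phi ->
    \int[mu]_x (f x * divergence phi x) = - \int[mu]_x dotr (g x) (phi x).

Definition is_weak_frac_gradient (a : R) f g : Prop :=
  vL1loc g /\
  forall phi, test_field phi ->
    \int[mu]_x (f x * frac_divergence a phi x) =
      - \int[mu]_x dotr (g x) (phi x).

(* Weak gradients are unique up to a.e. equality: we choose a representative;
   the value is 0 when there is none. *)
Definition weak_gradient f : 'rV[R]_n -> 'rV[R]_n :=
  xget (fun=> 0) [set g | is_weak_gradient f g].

Definition weak_frac_gradient (a : R) f : 'rV[R]_n -> 'rV[R]_n :=
  xget (fun=> 0) [set g | is_weak_frac_gradient a f g].

(* f is in W^{1,infty}(R^n) *)
Definition W1infty f : Prop :=
  f \in Lfun mu +oo%E /\
  exists g, is_weak_gradient f g /\ vLfun +oo%E g.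

End gradients.

(* Main.v *)
(* After modification on a null set, [f] and its weak gradient are bounded everywhere. Testing
   the weak gradient against translated product bump functions gives
   [f x - f (x - z)] = integral of [z . g (x - t z)] over [t] in [0, 1] for almost every [x],
   so [f] is essentially Lipschitz and the fractional gradient is the absolutely convergent
   integral of [(f x - f (x - z)) K_a(z)] with [K_a(z) = mu_{n,a} z / |z|^(n + a + 1)].

   Subordination writes [K_a] as a superposition of Gaussians [z * exp(- s |z|^2)] times
   a constant that vanishes like [1 - a]. Gaussian moments then show that pairing [K_a] with
   a bounded function [F(z) = G . z + O(|z|^2)] tends to [G] as [a] tends to [1]: the
   scales [s] below any fixed level contribute [O(1 - a)], and the large ones concentrate at
   [z = 0]. They also bound the fractional gradients uniformly in [a]. Against a product bump,
   [F] is the pairing of the increments of [f], with [G] the pairing of its weak gradient;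
   density of bumps in [L^1] and the uniform bound give weak* convergence.
   The liminf inequality is duality, tested on the weak gradient cut off to the part of
   a cube where it is large. *)
Require Import Defs.
From HB Require Import structures.
From mathcomp Require Import all_boot all_order all_algebra.
From mathcomp Require Import all_classical all_reals all_analysis.
From mathcomp Require Import measurable_realfun ess_sup_inf ring lra.
Set Implicit Arguments.
Unset Strict Implicit.
Unset Printing Implicit Defensive.

Import Order.TTheory GRing.Theory Num.Theory.
Import numFieldNormedType.Exports.

Local Open Scope classical_set_scope.
Local Open Scope ring_scope.

(** * Boxes in R^n *)

(** The measure is a product, so the integrals that come cheaply are those of functions that split
    over the coordinates. The kernel does not split but a Gaussian does: this is what subordination
    is for, and it replaces polar coordinates and the separation of a near and a far region. The
    factor [Gamma ((n + a + 1) / 2)] of [frac_cst] is exactly the one that subordination produces,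
    so it cancels. What is left of the singularity is one factor [2 / (1 - a)], against which
    [1 / Gamma ((1 - a) / 2)] is of order [(1 - a) / 2]; the powers of [pi] cancel with the Gaussian
    mass, and [2 ^ a], halved by the second moment, gives the limit [1].

    Test functions are products of one-variable bumps because their partial derivatives are again
    products, which meets the demand of [smooth] on all iterated derivatives.

    [Rintegral] sends infinite values to [0], so each exchange of integrals needs absolute
    integrability. It is obtained from bounds valid at every point, which is why functions bounded
    almost everywhere are truncated by [clamp]. *)

Section boxes.
Context {R : realType} {n : nat}.
Implicit Types (a b x : 'rV[R]_n).

Definition obox a b : set 'rV[R]_n :=
  [set x | forall i, `]a 0 i, b 0 i[%classic (x 0 i)].

Definition cube (k : R) : set 'rV[R]_n := obox (const_mx (- k)) (const_mx k).

(** A pi-system generating the Borel sets. Uniqueness of measures and the Dynkin argument of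
    [indic_ind] both run on it. *)
Definition oboxes : set (set 'rV[R]_n) := range (fun p => obox p.1 p.2).

Lemma cubeP k x : cube k x <-> forall i, `|x 0 i| < k.
Proof.
by split=> H i; have := H i; rewrite /= !mxE in_itv/= ltr_norml.
Qed.

Lemma oboxI a b a' b' : obox a b `&` obox a' b' =
  obox (\row_i Num.max (a 0 i) (a' 0 i)) (\row_i Num.min (b 0 i) (b' 0 i)).
Proof.
apply/seteqP; split => [x [H H'] i|x H].
  have := H i; have := H' i; rewrite /= !mxE !in_itv/= gt_max lt_min.
  by move=> /andP[-> ->] /andP[-> ->].
by split => i; have := H i; rewrite /= !mxE !in_itv/= gt_max lt_min;
  move=> /andP[/andP[? ?] /andP[? ?]]; apply/andP.
Qed.

Lemma oboxes_setI : setI_closed oboxes.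
Proof.
move=> _ _ [[a b] _ <-] [[a' b'] _ <-] /=; rewrite oboxI.
by eexists (_, _).
Qed.

Lemma bigcup_cube : \bigcup_k cube k%:R = setT.
Proof.
rewrite -subTset => x _.
have [M HM] : exists M : nat, forall i, `|x 0 i| < M%:R.
  exists (Num.truncn (\sum_i `|x 0 i|)).+1 => i.
  apply: le_lt_trans (truncnS_gt _); rewrite (bigD1 i)//= lerDl.
  exact: sumr_ge0.
by exists M => //; apply/cubeP.
Qed.

Lemma obox_preimage a b :
  obox a b = \bigcap_(i in [set: 'I_n])
    (@coord_rV R n i @^-1` `]a 0 i, b 0 i[%classic).
Proof.
by apply/seteqP; split => [x H i _|x H i]; [exact: H|exact: (H i I)].
Qed.

Lemma measurable_obox a b : measurable (obox a b).
Proof.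
rewrite obox_preimage; apply: fin_bigcap_measurable => // i _.
by rewrite -[X in measurable X]setTI; exact: measurable_coord_rV.
Qed.

Lemma measurable_cube k : measurable (cube k).
Proof. exact: measurable_obox. Qed.

(** A slab [a < x 0 i < b] is the union over [k] of the boxes with side []a, b[] in direction [i]
    and sides []-k, k[] in the others, so the boxes generate all coordinate preimages. *)
Lemma measurable_rV_oboxes :
  @measurable _ 'rV[R]_n = <<s oboxes >>.
Proof.
apply/seteqP; split; last first.
  apply: smallest_sub; first exact: sigma_algebra_measurable.
  by move=> _ [[a b] _ <-]; exact: measurable_obox.
apply: smallest_sub; first exact: smallest_sigma_algebra.
rewrite -bigcup_seq => B [i _ [C mC <-]].
pose S := g_sigma_algebraType oboxes.
suff : measurable_fun [set: S] (fun x : S => (x : 'rV[R]_n) 0 i).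
  by move=> /(_ measurableT _ mC).
apply: (measurability _ (RGenOpens.measurableE R)) => _ [_ [a [b ->]] <-].
rewrite setTI.
rewrite (_ : _ @^-1` _ =
  \bigcup_k (obox (\row_j if j == i then a else - k%:R)
                  (\row_j if j == i then b else k%:R) : set S)).
  apply: bigcup_measurable => k _; apply: sub_sigma_algebra.
  by eexists (_, _).
apply/seteqP; split => [x /= xab|x [k _] /(_ i)]; last first.
  by rewrite /= !mxE eqxx.
have : setT x by [].
rewrite -bigcup_cube => -[k _ /cubeP kx].
exists k => // j; rewrite /= !mxE; case: eqP => [->//|_].
by have := kx j; rewrite in_itv/= ltr_norml.
Qed.

(** The boxes are stable under intersection and the cubes exhaust the space, so agreement on boxes
    propagates to the generated sigma-algebra. *)
Lemma measure_rV_unique (m1 m2 : {measure set 'rV[R]_n -> \bar R}) :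
  (forall a b, m1 (obox a b) = m2 (obox a b)) ->
  (forall k : nat, (m1 (cube k%:R) < +oo)%E) ->
  forall A, measurable A -> m1 A = m2 A.
Proof.
move=> m12 moo.
apply: (measure_unique oboxes (fun k => cube k%:R)) => //.
- exact: measurable_rV_oboxes.
- exact: oboxes_setI.
- by move=> k; eexists (_, _).
- exact: bigcup_cube.
- by move=> _ [[a b] _ <-]; exact: m12.
Qed.

Lemma lebesgue_obox a b : lebesgue_rV R n (obox a b) =
  (\prod_(i < n) (@lebesgue_measure R `]a 0%R i, b 0%R i[%classic))%E.
Proof. by rewrite -(@lebesgue_rV_box R n (fun i => `]a 0 i, b 0 i[%classic)). Qed.

Lemma lebesgue_obox_lty a b : (lebesgue_rV R n (obox a b) < +oo)%E.
Proof.
rewrite lebesgue_obox.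
suff /andP[_ ->] : (0 <= \prod_(i < n)
  (@lebesgue_measure R `]a 0%R i, b 0%R i[%classic) < +oo)%E by [].
elim/big_ind : _ => [|x y /andP[x0 xoo] /andP[y0 yoo]|i _].
- by rewrite lee_fin ler01 ltry.
- by rewrite mule_ge0//= lte_mul_pinfty// ge0_fin_numE.
- by rewrite measure_ge0/= lebesgue_measure_itv/=; case: ifP; rewrite ltry.
Qed.

(** Balls of the sup norm are boxes, so rational endpoints can be inserted one coordinate at a time.
    There are countably many rational boxes, whence the measurability of open sets. *)
Lemma open_rat_obox (O : set 'rV[R]_n) x : open O -> O x ->
  exists p : 'rV[rat]_n * 'rV[rat]_n,
    obox (map_mx ratr p.1) (map_mx ratr p.2) x /\
    obox (map_mx ratr p.1) (map_mx ratr p.2) `<=` O.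
Proof.
rewrite openE => /(_ x) /[apply]; rewrite /interior/= -nbhs_ballE => -[e /= e0 xeO].
have qP i : exists q : rat * rat,
    [/\ x 0 i - e < ratr q.1, ratr q.1 < x 0 i, x 0 i < ratr q.2 &
    (ratr q.2 < x 0 i + e)%R].
  have [//|q1] := @rat_in_itvoo R (x 0 i - e) (x 0 i).
    by rewrite ltrBlDr ltrDl.
  rewrite in_itv/= => /andP[? ?].
  have [//|q2] := @rat_in_itvoo R (x 0 i) (x 0 i + e).
    by rewrite ltrDl.
  by rewrite in_itv/= => /andP[? ?]; exists (q1, q2).
have [q Hq] := choice qP.
exists (\row_i (q i).1, \row_i (q i).2); split => /= [i|y yq].
  by rewrite /= !mxE in_itv/=; case: (Hq i) => _ -> -> _.
apply: xeO; split => // i0 i; rewrite ord1 /ball/=.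
have := yq i; rewrite /= !mxE in_itv/= => /andP[? ?].
have [? ? ? ?] := Hq i; rewrite ltr_norml; apply/andP; split; lra.
Qed.

Lemma open_measurable_rV (O : set 'rV[R]_n) : open O -> measurable O.
Proof.
move=> oO.
rewrite (_ : O = \bigcup_(p : 'rV[rat]_n * 'rV[rat]_n)
   (if `[< obox (map_mx ratr p.1) (map_mx ratr p.2) `<=` O >]
    then obox (map_mx ratr p.1) (map_mx ratr p.2) else set0)).
  apply: countable_bigcupT_measurable; first exact: countableP.
  by move=> p; case: ifP => // _; exact: measurable_obox.
apply/seteqP; split => [x Ox|x [p _]]; last first.
  by case: ifP => // /asboolP; exact.
have [p [xp pO]] := open_rat_obox oO Ox.
by exists p => //; case: ifP => // /asboolP.
Qed.

Lemma continuous_measurable_rV (f : 'rV[R]_n -> R) :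
  continuous f -> measurable_fun setT f.
Proof.
move=> /continuousP cf; apply: (measurability _ (RGenOpens.measurableE R)).
move=> _ [_ [a [b ->] <-]]; rewrite setTI; apply: open_measurable_rV.
exact/cf/interval_open.
Qed.

Lemma compact_measurable_rV (K : set 'rV[R]_n) : compact K -> measurable K.
Proof.
move=> cK; rewrite -(setCK K); apply: measurableC; apply: open_measurable_rV.
apply: closed_openC; apply: compact_closed => //; exact: norm_hausdorff.
Qed.

Lemma normr_coord_le (x : 'rV[R]_n) i : `|x 0 i| <= `|x|.
Proof.
rewrite [leRHS]/Num.norm /= mx_normrE; apply/bigmax_geP; right => /=.
by exists (0, i).
Qed.

Lemma compact_sub_cube (K : set 'rV[R]_n) : compact K ->
  exists k : nat, K `<=` cube k%:R.
Proof.
move=> /compact_bounded [M [_ HM]].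
exists (Num.truncn (M + 1)).+1 => x Kx; apply/cubeP => i.
apply: le_lt_trans (truncnS_gt _); apply: le_trans (normr_coord_le _ _) _.
by apply: (HM _ _ x Kx); rewrite ltrDl.
Qed.

Lemma cube_sub_compact k : exists2 K : set 'rV[R]_n, compact K & cube k `<=` K.
Proof.
exists [set v : 'rV[R]_n | forall i, `[- k, k]%classic (v 0 i)].
  by apply: (@rV_compact R n (fun=> `[- k, k]%classic)) => i; exact: segment_compact.
move=> x /cubeP H i; have := H i; rewrite /= in_itv/= => /ltW.
by rewrite ler_norml.
Qed.

End boxes.

(** * Fubini and translation invariance *)

Section product_Rintegral.
Context d1 d2 (T1 : measurableType d1) (T2 : measurableType d2) (R : realType).
Variable m1 : {sigma_finite_measure set T1 -> \bar R}.
Variable m2 : {sigma_finite_measure set T2 -> \bar R}.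
Variable h : T1 * T2 -> R.
Hypothesis ih : (m1 \x m2)%E.-integrable setT (EFin \o h).

(** The inner real integral is the [fine] of the extended one; the two agree where the latter is
    finite, which integrability guarantees for almost every slice. *)
Lemma Rintegral12_prod :
  \int[m1]_x (\int[m2]_y h (x, y)) = \int[(m1 \x m2)%E]_z h z.
Proof.
rewrite /Rintegral -(integral12_prod_meas1 ih); congr fine.
have mF := measurable_fubini_F ih.
apply: ae_eq_integral => //.
  apply/measurable_EFinP; apply: measurableT_comp => //; exact: mF.
have := ae_integrable1 ih; apply: filterS => x ix _.
by rewrite fineK//; exact: integrable_fin_num ix.
Qed.

Lemma Rintegral21_prod :
  \int[m2]_y (\int[m1]_x h (x, y)) = \int[(m1 \x m2)%E]_z h z.
Proof.
rewrite /Rintegral -(integral21_prod_meas1 ih); congr fine.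
have mF := measurable_fubini_G ih.
apply: ae_eq_integral => //.
  apply/measurable_EFinP; apply: measurableT_comp => //; exact: mF.
have := ae_integrable2 ih; apply: filterS => x ix _.
by rewrite fineK//; exact: integrable_fin_num ix.
Qed.

Lemma Rintegral_fubini :
  \int[m1]_x (\int[m2]_y h (x, y)) = \int[m2]_y (\int[m1]_x h (x, y)).
Proof. by rewrite Rintegral12_prod Rintegral21_prod. Qed.

End product_Rintegral.

Section partial_Rintegral.
Context d1 d2 (T1 : measurableType d1) (T2 : measurableType d2) (R : realType).
Variable m1 : {sigma_finite_measure set T1 -> \bar R}.
Variable m2 : {sigma_finite_measure set T2 -> \bar R}.
Variable h : T1 * T2 -> R.

(** Integrability is not assumed: Tonelli gives measurability for the positive and negative parts
    separately, and [fine] is measurable. *)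
Lemma measurable_Rintegral1 : measurable_fun setT h ->
  measurable_fun setT (fun x => \int[m2]_y h (x, y)).
Proof.
move=> mh; have mh' : measurable_fun setT (EFin \o h) by exact/measurable_EFinP.
apply: (measurableT_comp (@fine_measurable R setT measurableT)) => /=.
have -> : (fun x => \int[m2]_y (h (x, y))%:E)%E =
    (fun x => fubini_F m2 (EFin \o h)^\+ x - fubini_F m2 (EFin \o h)^\- x)%E.
  apply/funext => x; rewrite integralE /fubini_F.
  by congr (_ - _)%E; apply: eq_integral => y _; rewrite ?funeposE ?funenegE.
apply: emeasurable_funB; apply: measurable_fun_fubini_tonelli_F => //.
- exact: measurable_funepos.
- exact: measurable_funeneg.
Qed.

Hypothesis ih : (m1 \x m2)%E.-integrable setT (EFin \o h).

(** Passing to [fine] can only decrease the absolute value, since infinite values become [0]. *)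
Lemma integrable_Rintegral1 :
  m1.-integrable setT (EFin \o (fun x => \int[m2]_y h (x, y))).
Proof.
have iF := integrable_fubini_F ih.
apply: le_integrable iF => //; last first.
  move=> x _; rewrite /fubini_F /Rintegral /=.
  by case: (\int[_]_y _)%E => [r| |]//=; rewrite ?normr0 ?leey.
apply/measurable_EFinP; apply: measurable_Rintegral1.
by apply/measurable_EFinP; exact: measurable_int ih.
Qed.

Lemma integrable_Rintegral2 :
  m2.-integrable setT (EFin \o (fun y => \int[m1]_x h (x, y))).
Proof.
have mh := measurable_int _ ih.
have mG : measurable_fun setT (fun y => \int[m1]_x h (x, y)).
  exact: (measurableT_comp (@fine_measurable R setT measurableT) (measurable_fubini_G ih)).
apply/integrableP; split; first exact/measurable_EFinP.
apply: le_lt_trans ((integrable21ltyP m1 m2 mh).1 ih).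
have mh' : measurable_fun setT (abse \o (EFin \o h)) by exact: measurableT_comp.
apply: ge0_le_integral => //.
- by apply: measurableT_comp => //; exact/measurable_EFinP.
- exact: (measurable_fun_fubini_tonelli_G (m1 := m1) _ mh' (fun=> abse_ge0 _)).
- move=> y _; rewrite /= /Rintegral.
  apply: (@le_trans _ _ (`|\int[m1]_x (h (x, y))%:E|)%E).
    by case: (\int[_]_x _)%E => [r| |]//=; rewrite ?normr0 ?leey.
  apply: le_abse_integral => //; exact: measurableT_comp mh _.
Qed.

End partial_Rintegral.

Section product_tensor.
Context d1 d2 (T1 : measurableType d1) (T2 : measurableType d2) (R : realType).
Variable m1 : {sigma_finite_measure set T1 -> \bar R}.
Variable m2 : {sigma_finite_measure set T2 -> \bar R}.
Variables (u : T1 -> R) (w : T2 -> R).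
Hypothesis iu : m1.-integrable setT (EFin \o u).
Hypothesis iw : m2.-integrable setT (EFin \o w).

Lemma integrable_tensor :
  (m1 \x m2)%E.-integrable setT (EFin \o (fun z => u z.1 * w z.2)).
Proof.
have mu := measurable_int _ iu; have mw := measurable_int _ iw.
have /measurable_EFinP mu' := mu; have /measurable_EFinP mw' := mw.
apply/integrable12ltyP.
  apply/measurable_EFinP; apply: measurable_funM.
    exact: measurableT_comp mu' measurable_fst.
  exact: measurableT_comp mw' measurable_snd.
under eq_integral => x _.
  under eq_integral do rewrite /= normrM EFinM.
  rewrite ge0_integralZl//; last exact/measurable_EFinP/measurableT_comp.
  over.
have /integrableP[_ iwoo] := iw; have /integrableP[_ iuoo] := iu.
have fw : (\int[m2]_y `|(w y)%:E|)%E \is a fin_num.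
  by rewrite ge0_fin_numE//; exact: integral_ge0.
rewrite /= -(fineK fw) ge0_integralZr//=; last first.
- by rewrite lee_fin fine_ge0//; exact: integral_ge0.
- exact/measurable_EFinP/measurableT_comp.
by rewrite lte_mul_pinfty ?integral_ge0//= ?ge0_fin_numE ?integral_ge0 // fineK.
Qed.

Lemma Rintegral_tensor :
  \int[(m1 \x m2)%E]_z (u z.1 * w z.2) = (\int[m1]_x u x) * (\int[m2]_y w y).
Proof.
rewrite -(Rintegral12_prod integrable_tensor)/= -RintegralZr//.
by apply: eq_Rintegral => x _; rewrite RintegralZl.
Qed.

End product_tensor.

Section rV_measurability.
Context {R : realType} {n : nat} d (T : measurableType d).
Implicit Types u v : T -> 'rV[R]_n.

Lemma measurable_rV_coord u i :
  measurable_fun setT u -> measurable_fun setT (fun x => u x 0 i).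
Proof. by move/measurable_fun_rVP. Qed.

Lemma measurable_rVD u v : measurable_fun setT u -> measurable_fun setT v ->
  measurable_fun setT (fun x => u x + v x).
Proof.
move=> mu mv; apply/measurable_fun_rVP => i.
under eq_fun do rewrite mxE.
by apply: measurable_funD; exact: measurable_rV_coord.
Qed.

Lemma measurable_rVB u v : measurable_fun setT u -> measurable_fun setT v ->
  measurable_fun setT (fun x => u x - v x).
Proof.
move=> mu mv; apply/measurable_fun_rVP => i.
under eq_fun do rewrite !mxE.
by apply: measurable_funB; exact: measurable_rV_coord.
Qed.

Lemma measurable_rVZ (c : T -> R) u : measurable_fun setT c ->
  measurable_fun setT u -> measurable_fun setT (fun x => c x *: u x).
Proof.
move=> mu mv; apply/measurable_fun_rVP => i.
under eq_fun do rewrite !mxE.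
by apply: measurable_funM => //; exact: measurable_rV_coord.
Qed.

Lemma measurable_dotr u v : measurable_fun setT u -> measurable_fun setT v ->
  measurable_fun setT (fun x => dotr (u x) (v x)).
Proof.
move=> mu mv; rewrite /dotr; apply: measurable_sum => i.
by apply: measurable_funM; exact: measurable_rV_coord.
Qed.

Lemma measurable_enorm u : measurable_fun setT u ->
  measurable_fun setT (fun x => enorm (u x)).
Proof.
move=> mu; have ms : measurable_fun [set: R] Num.sqrt.
  by apply: continuous_measurable_fun; exact: sqrt_continuous.
exact: measurableT_comp ms (measurable_dotr mu mu).
Qed.

End rV_measurability.

Section rV_integral.
Context {R : realType}.

(** A translation maps a box to a box with sides of the same length, and measures that agree on
    boxes are equal. *)
Lemma lebesgue_rV_translation n (v : 'rV[R]_n) A : measurable A ->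
  pushforward (lebesgue_rV R n) (+%R^~ v) A = lebesgue_rV R n A.
Proof.
have mv : measurable_fun setT ((+%R^~ v) : 'rV[R]_n -> 'rV[R]_n).
  exact: measurable_rVD.
have pE a b : (+%R^~ v) @^-1` (obox a b) = obox (a - v) (b - v) :> set 'rV[R]_n.
  by apply/seteqP; split=> x H i; have := H i;
    rewrite /= !mxE !in_itv/= ltrBlDr ltrBrDr.
move=> mA.
apply: (@measure_rV_unique R n (pushforward (lebesgue_rV R n) (+%R^~ v))
  (lebesgue_rV R n)) => //.
- move=> a b /=; rewrite /pushforward pE !lebesgue_obox.
  apply: eq_bigr => i _; rewrite !lebesgue_measure_itv/= !mxE !lte_fin ltrD2r.
  by case: ifP => // _; rewrite -!EFinB; congr EFin; ring.
- by move=> k /=; rewrite /pushforward /cube pE; exact: lebesgue_obox_lty.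
Qed.

Lemma ge0_integral_translation n (v : 'rV[R]_n) (h : 'rV[R]_n -> \bar R) :
  measurable_fun setT h -> (forall x, (0 <= h x)%E) ->
  (\int[lebesgue_rV R n]_x h (x + v)%R = \int[lebesgue_rV R n]_x h x)%E.
Proof.
move=> mh h0.
have mv : measurable_fun setT ((+%R^~ v) : 'rV[R]_n -> 'rV[R]_n).
  exact: measurable_rVD.
have := @ge0_integral_pushforward _ _ _ _ _ _ mv (lebesgue_rV R n) setT h measurableT.
rewrite preimage_setT => <- //.
by apply: eq_measure_integral => A mA _ /=; exact: lebesgue_rV_translation.
Qed.

Lemma integral_translation n (v : 'rV[R]_n) (h : 'rV[R]_n -> \bar R) :
  measurable_fun setT h ->
  (\int[lebesgue_rV R n]_x h (x + v)%R = \int[lebesgue_rV R n]_x h x)%E.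
Proof.
move=> mh; rewrite [LHS]integralE [RHS]integralE.
rewrite -(@ge0_integral_translation n v (h^\+)%E)//; last exact: measurable_funepos.
rewrite -(@ge0_integral_translation n v (h^\-)%E)//; last exact: measurable_funeneg.
by rewrite -[X in (X^\+)%E]/(h \o +%R^~ v) -[X in (X^\-)%E]/(h \o +%R^~ v)
  funepos_comp funeneg_comp.
Qed.

Lemma Rintegral_translation n (v : 'rV[R]_n) (h : 'rV[R]_n -> R) :
  measurable_fun setT h ->
  \int[lebesgue_rV R n]_x h (x + v) = \int[lebesgue_rV R n]_x h x.
Proof.
move=> mh; rewrite /Rintegral; congr fine.
by rewrite (@integral_translation n v (EFin \o h))//; exact/measurable_EFinP.
Qed.

Lemma integrable_translation n (v : 'rV[R]_n) (h : 'rV[R]_n -> \bar R) :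
  (lebesgue_rV R n).-integrable setT h ->
  (lebesgue_rV R n).-integrable setT (fun x => h (x + v)).
Proof.
move=> /integrableP[mh hoo]; apply/integrableP; split.
  by apply: measurableT_comp => //; exact: measurable_rVD.
by rewrite (@ge0_integral_translation n v (abse \o h))//=; exact: measurableT_comp.
Qed.

Lemma ge0_integral_rV_cons n (g : 'rV[R]_n.+1 -> \bar R) :
  measurable_fun setT g -> (forall x, 0 <= g x)%E ->
  (\int[lebesgue_rV R n.+1]_x g x =
   \int[@lebesgue_measure R \x lebesgue_rV R n]_z (g \o @cons_rV R n) z)%E.
Proof.
move=> mg g0.
have := @ge0_integral_pushforward _ _ _ _ _ _ (@measurable_cons_rV R n)
  (@lebesgue_measure R \x lebesgue_rV R n)%E setT g measurableT.
by rewrite preimage_setT => <-.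
Qed.

Lemma integral_rV_cons n (g : 'rV[R]_n.+1 -> \bar R) :
  measurable_fun setT g ->
  (\int[lebesgue_rV R n.+1]_x g x =
   \int[@lebesgue_measure R \x lebesgue_rV R n]_z (g \o @cons_rV R n) z)%E.
Proof.
move=> mg; rewrite integralE [RHS]integralE (funepos_comp g (@cons_rV R n)) (funeneg_comp g (@cons_rV R n)).
rewrite (ge0_integral_rV_cons (measurable_funepos mg) (funepos_ge0 g)).
by rewrite (ge0_integral_rV_cons (measurable_funeneg mg) (funeneg_ge0 g)).
Qed.

(** This reduces Gaussian moments on [R^n] to moments on the line. In dimension [0] the measure is a
    Dirac mass and both sides are the empty product. *)
Lemma integral_prod_coord n (h : 'I_n -> R -> R) :
  (forall i, (@lebesgue_measure R).-integrable setT (EFin \o h i)) ->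
  (lebesgue_rV R n).-integrable setT (EFin \o (fun x : 'rV[R]_n => \prod_i h i (x 0 i))) /\
  \int[lebesgue_rV R n]_x (\prod_i h i (x 0 i)) =
    \prod_i \int[@lebesgue_measure R]_t h i t.
Proof.
elim: n h => [|n IH] h ih.
  have E : (fun x : 'rV[R]_0 => \prod_i h i (x 0 i)) = cst 1.
    by apply/funext => x; rewrite big_ord0.
  rewrite E big_ord0; split; last first.
    by rewrite /Rintegral/= integral_dirac//= indicE in_setT mul1r.
  apply/integrableP; split.
    by apply/measurable_EFinP; exact: measurable_cst.
  by rewrite /= integral_dirac//= diracT mul1e ltry.
have [iw Ew] := IH (fun i => h (lift 0 i)) (fun i => ih _).
pose w := fun y : 'rV[R]_n => \prod_i h (lift 0 i) (y 0 i).
have E : (fun x : 'rV[R]_n.+1 => \prod_i h i (x 0 i)) \o @cons_rV R n =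
    (fun z => h 0 z.1 * w z.2).
  apply/funext => z /=; rewrite big_ord_recl cons_rV0; congr (_ * _).
  by apply: eq_bigr => i _; rewrite cons_rVS.
have it := integrable_tensor (ih 0) iw.
have mh : measurable_fun setT (EFin \o (fun x : 'rV[R]_n.+1 => \prod_i h i (x 0 i))).
  apply/measurable_EFinP; apply: measurable_prod => i _.
  have /measurable_EFinP mi := measurable_int _ (ih i).
  by apply: measurableT_comp mi _; exact: measurable_coord_rV.
split.
  apply/integrableP; split => //; rewrite ge0_integral_rV_cons//; last exact: measurableT_comp.
  have /integrableP[_] := it; rewrite -E; exact.
transitivity (\int[(@lebesgue_measure R \x lebesgue_rV R n)%E]_z (h 0 z.1 * w z.2)).
  rewrite /Rintegral integral_rV_cons//; congr fine.
  by apply: eq_integral => z _; have /(congr1 (@^~ z)) /= -> := E.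
by rewrite Rintegral_tensor// big_ord_recl Ew.
Qed.

End rV_integral.

(** * Product bump functions *)

Section smooth_line.
Context {R : realType}.
Implicit Types (b c : R -> R) (k : nat).

(** One-variable smoothness with explicit derivatives. Each order carries its own witnesses; [CooP]
    shows that they are compatible. *)
Fixpoint Ck k b : Prop := if k is k'.+1 then
  exists b' : R -> R, (forall t, is_derive t (1 : R) b (b' t)) /\ Ck k' b'
  else True.

Definition Coo b := forall k, Ck k b.

Lemma CkS k b : Ck k.+1 b -> Ck k b.
Proof. by elim: k b => // k IH b [b' [db /IH cb']]; exists b'. Qed.

(** Derivatives are unique, so the witnesses attached to the different orders all coincide with
    ['D_1 b], which therefore lies in every class. *)
Lemma CooP b : Coo b ->
  exists b' : R -> R, (forall t, is_derive t (1 : R) b (b' t)) /\ Coo b'.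
Proof.
move=> cb; exists ('D_1 b); split=> [t|k].
  by have [b' [db _]] := cb 1%N; apply: derivableP; have [] := db t.
have [b' [db cb']] := cb k.+1.
by have -> : 'D_1 b = b' by apply/funext => t; have [] := db t.
Qed.

Lemma Ck_cst k (r : R) : Ck k (cst r).
Proof.
elim: k r => // k IH r; exists (cst 0); split => // t.
exact: is_derive_cst.
Qed.

Lemma CkD k b c : Ck k b -> Ck k c -> Ck k (b + c).
Proof.
elim: k b c => // k IH b c [b' [db cb]] [c' [dc cc]].
by exists (b' + c'); split; [move=> t; exact: is_deriveD|exact: IH].
Qed.

Lemma CkM k b c : Ck k b -> Ck k c -> Ck k (b * c).
Proof.
elim: k b c => // k IH b c kb kc.
have [b' [db cb]] := kb; have [c' [dc cc]] := kc.
exists (b * c' + c * b'); split => [t|].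
  by apply: is_derive_eq; rewrite /=.
by apply: CkD; apply: IH => //; exact: CkS.
Qed.

Lemma is_derive_affine (b b' : R -> R) (u v t : R) :
  is_derive (u * t + v) (1 : R) b (b' (u * t + v)) ->
  is_derive t (1 : R) (fun t => b (u * t + v)) (u * b' (u * t + v)).
Proof.
move=> db.
have da : is_derive t (1 : R) (fun t => u * t + v) u.
  have H : is_derive t (1 : R) (u \*: id + cst v) (u *: 1 + 0).
    by apply: is_deriveD.
  by apply: is_derive_eq H _; rewrite addr0 [_ *: _]mulr1.
by have := @is_derive1_comp R b (fun t => u * t + v) t _ _ db da; rewrite mulrC; exact.
Qed.

Lemma Ck_affine k b u v : Ck k b -> Ck k (fun t => b (u * t + v)).
Proof.
elim: k b => // k IH b [b' [db cb]].
exists (cst u * (fun t => b' (u * t + v))); split => [t|].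
  exact: is_derive_affine.
by apply: CkM; [exact: Ck_cst|exact: IH].
Qed.

Lemma CooM b c : Coo b -> Coo c -> Coo (b * c).
Proof. by move=> B C k; exact: CkM. Qed.
Lemma Coo_affine b u v : Coo b -> Coo (fun t => b (u * t + v)).
Proof. by move=> B k; exact: Ck_affine. Qed.

Lemma Coo_continuous b : Coo b -> continuous b.
Proof.
move=> /(_ 1%N)[b' [db _]] t; have [dbt _] := db t.
exact/differentiable_continuous/derivable1_diffP.
Qed.

(** Termwise from [u ^ k <= k ^ k * expR u], which is [u / k <= expR (u / k)] raised to the power
    [k]. *)
Lemma horner_le_expR (p : {poly R}) :
  exists2 C, 0 <= C & forall u, 0 <= u -> `|p.[u]| <= C * expR u.
Proof.
have powE k (u : R) : 0 <= u -> u ^+ k <= k%:R ^+ k * expR u.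
  case: k => [|k] u0; first by rewrite !expr0 mul1r -expR0 ler_expR.
  rewrite -ler_pdivrMl ?exprn_gt0// -exprVn -exprMn.
  have -> : expR u = expR (k.+1%:R^-1 * u) ^+ k.+1.
    by rewrite -expRM_natl mulrA divff ?mul1r.
  apply: lerXn2r; rewrite ?nnegrE ?mulr_ge0 ?expR_ge0//.
  by apply: le_trans (expR_ge1Dx _); rewrite lerDr.
exists (\sum_(i < size p) `|p`_i| * i%:R ^+ i).
  by apply: sumr_ge0 => i _; rewrite mulr_ge0// exprn_ge0.
move=> u u0; rewrite horner_coef (le_trans (ler_norm_sum _ _ _))//.
rewrite mulr_suml; apply: ler_sum => i _.
by rewrite normrM -mulrA ler_wpM2l// ger0_norm ?exprn_ge0// powE.
Qed.

(* This family is closed under differentiation and its members are [O(t^2)] at [0], hence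
   smooth. *)
Definition flat (p : {poly R}) (t : R) : R :=
  if 0 < t then p.[t^-1] * expR (- t^-1) else 0.

Definition theta : R -> R := flat 1.

(** The polynomial bound is applied at [t^-1] to ['X^2 * p]; the additional factor ['X^2] pays for
    [t ^+ 2]. *)
Lemma flat_le (p : {poly R}) :
  exists2 C, 0 <= C & forall t, `|flat p t| <= C * t ^+ 2.
Proof.
have [C C0 HC] := horner_le_expR ('X^2 * p); exists C => // t.
rewrite /flat; case: ifPn => [t0|_]; last by rewrite normr0 mulr_ge0// sqr_ge0.
have := HC t^-1; rewrite invr_ge0 => /(_ (ltW t0)).
rewrite hornerM hornerXn normrM normrX normfV (gtr0_norm t0).
rewrite normrM [X in _ -> _ * X <= _]ger0_norm ?expR_ge0//.
rewrite exprVn mulrC ler_pdivrMr ?exprn_gt0// => H.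
by rewrite expRN ler_pdivrMr ?expR_gt0// mulrAC.
Qed.

(** With [s = t^-1] one has [ds/dt = - s^2], so the derivative of [p(s) exp(-s)] is
    [s^2 (p(s) - p'(s)) exp(-s)]. At [0] the difference quotient is [O(t)] by [flat_le]. *)
Lemma is_derive_flat (p : {poly R}) (t : R) :
  is_derive t (1 : R) (flat p) (flat ('X^2 * (p - p^`())) t).
Proof.
have [t0|t0|<-] := ltgtP 0 t.
- apply: (@near_eq_is_derive R R R (fun t => p.[t^-1] * expR (- t^-1)) (flat p) t 1).
    near=> s; rewrite /flat ifT//; near: s; exact: lt_nbhsr.
  have di : is_derive t (1 : R) GRing.inv (- t ^- 2).
    have tn0 : (id t : R) != 0 by rewrite gt_eqF.
    by apply: (is_derive_eq (is_deriveV tn0 (is_derive_id t 1))); rewrite [_ *: _]mulr1.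
  have dp : is_derive t (1 : R) (fun t => p.[t^-1]) (- t ^- 2 * p^`().[t^-1]).
    by have := @is_derive1_comp R (horner p) GRing.inv t _ _ (is_derive_poly p t^-1) di; rewrite mulrC; exact.
  have de : is_derive t (1 : R) (fun t => expR (- t^-1)) (t ^- 2 * expR (- t^-1)).
    have di' : is_derive t (1 : R) (fun t => - t^-1) (t ^- 2).
      by have := is_deriveN di; rewrite opprK.
    by have := @is_derive1_comp R expR (fun t => - t^-1) t _ _ (is_derive_expR (- t^-1)) di'; rewrite mulrC; exact.
  apply: (is_derive_eq (is_deriveM dp de)).
  rewrite /flat t0 /= !hornerE /= -exprVn.
  by rewrite /GRing.scale/=; ring.
- apply: (@near_eq_is_derive R R R (cst 0) (flat p) t 1).
    near=> s; rewrite /flat ifF//; apply/negbTE; rewrite -leNgt ltW//.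
    near: s; exact: lt_nbhsl.
  by apply: is_derive_eq; rewrite /flat ltNge (ltW t0).
- have [C C0 HC] := flat_le p.
  have F0 q : flat q 0 = 0 by rewrite /flat ltxx.
  rewrite F0.
  have : (fun h => h^-1 *: ((flat p \o shift 0) (h *: 1) - flat p 0)) @ 0^' --> (0 : R).
    apply/cvgrPdist_le => e e0; near=> h.
    have h0 : h != 0 by near: h; exact: nbhs_dnbhs_neq.
    rewrite sub0r normrN /= F0 subr0 addr0 [_ *: 1]mulr1 normrM normfV.
    rewrite ler_pdivrMl ?normr_gt0// (le_trans (HC _))//.
    rewrite -real_normK ?num_real// expr2 mulrA [leRHS]mulrC ler_wpM2r//.
    have : `|h| <= (C + 1)^-1 * e.
      near: h; apply: dnbhs0_le; rewrite mulr_gt0// invr_gt0; lra.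
    rewrite ler_pdivlMl; last lra.
    by apply: le_trans; rewrite mulrDl lerDl mul1r.
  by move=> H; apply: DeriveDef; [apply/cvg_ex; exists 0|exact: cvg_lim H].
Unshelve. all: by end_near. Qed.

Lemma Coo_flat (p : {poly R}) : Coo (flat p).
Proof.
move=> k; elim: k p => // k IH p.
by eexists; split; [move=> t; exact: is_derive_flat|exact: IH].
Qed.

Lemma thetaE t : theta t = if 0 < t then expR (- t^-1) else 0.
Proof. by rewrite /theta /flat; case: ifP => // _; rewrite hornerC mul1r. Qed.

Lemma theta01 t : 0 <= theta t <= 1.
Proof.
rewrite thetaE; case: ifPn => [t0|_]; last by rewrite lexx ler01.
by rewrite expR_ge0 -expR0 ler_expR oppr_le0 invr_ge0 ltW.
Qed.

(* [sbump a b k] increases to the indicator of [`]a, b[] as [k] goes to infinity. *)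
Definition sbump (a b : R) (k : nat) (t : R) : R :=
  theta (k%:R * (t - a)) * theta (k%:R * (b - t)).

Lemma Coo_sbump (a b : R) k : Coo (sbump a b k).
Proof.
have -> : sbump a b k = (fun t => theta (k%:R * t + - (k%:R * a))) *
    (fun t => theta (- k%:R * t + k%:R * b)).
  by apply/funext => t; rewrite mulrfctE /sbump; congr (theta _ * theta _); ring.
by apply: CooM; apply: Coo_affine; exact: Coo_flat.
Qed.

Lemma sbump01 (a b : R) k t : 0 <= sbump a b k t <= 1.
Proof.
have /andP[? ?] := theta01 (k%:R * (t - a)).
have /andP[? ?] := theta01 (k%:R * (b - t)).
by rewrite /sbump mulr_ge0//= mulr_ile1.
Qed.

Lemma sbump_out (a b : R) k t : t \notin `]a, b[ -> sbump a b k t = 0.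
Proof.
rewrite in_itv/= negb_and -!leNgt /sbump !thetaE => /orP[ta|bt].
  by rewrite ifF ?mul0r//; apply/negbTE; rewrite -leNgt mulr_ge0_le0// subr_le0.
by rewrite [X in _ * X]ifF ?mulr0//; apply/negbTE; rewrite -leNgt mulr_ge0_le0// subr_le0.
Qed.

(** Inside the open interval both arguments of [theta] tend to infinity, where [theta] tends to [1];
    outside, every term is [0]. *)
Lemma cvg_sbump (a b t : R) :
  sbump a b k t @[k --> \oo] --> (\1_(`]a, b[%classic) t : R).
Proof.
rewrite indicE; have [|tab] := boolP (t \in `]a, b[%classic); last first.
  rewrite (_ : (fun k => _) = cst 0); first exact: cvg_cst.
  apply/funext => k /=; apply: sbump_out; apply: contra tab.
  by move=> ?; apply/mem_set.
rewrite inE /= in_itv /= => /andP[at_ tb].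
have th (u : R) : 0 < u -> theta (k%:R * u) @[k --> \oo] --> (1 : R).
  move=> u0.
  (* At [k = 0] the argument of [theta] is [0], where the exponential formula fails; the shift by
     one discards this index. *)
  have : expR (- (k.+1%:R * u)^-1) @[k --> \oo] --> expR (- (0 * u^-1)).
    apply: continuous_cvg; first exact: continuous_expR.
    apply: cvgN; under eq_fun do rewrite invfM.
    by apply: cvgMl; exact: cvg_harmonic.
  rewrite mul0r oppr0 expR0 => H; rewrite -(cvg_shiftS _ _).
  apply: cvg_trans H; apply: near_eq_cvg; apply: nearW => k.
  by rewrite /= thetaE mulr_gt0.
by rewrite -[X in _ --> X]mulr1; apply: cvgM; apply: th; rewrite subr_gt0.
Qed.

End smooth_line.

(** * Directional derivatives of product functions *)

Section directional.
Context {R : realType}.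

(** Restricting to a line turns directional derivatives into derivatives of one real variable, for
    which product and chain rules are at hand. *)
Lemma is_derive_lineP (V W : normedModType R) (f : V -> W) (x v : V) (d : W) :
  is_derive (0 : R) 1 (fun h : R => f (h *: v + x)) d <-> is_derive x v f d.
Proof.
have E : (fun h : R => h^-1 *: (((fun h : R => f (h *: v + x)) \o shift 0) (h *: 1)
      - f (0 *: v + x))) =
    (fun h : R => h^-1 *: ((f \o shift x) (h *: v) - f x)).
  by apply/funext => h /=; rewrite addr0 scale0r add0r [_ *: 1]mulr1.
split=> -[d1 d2]; apply: DeriveDef.
- by move: d1; rewrite /derivable E.
- by move: d2; rewrite /derive E.
- by rewrite /derivable E.
- by move: d2; rewrite /derive E.
Qed.

Lemma is_derive_line (V W : normedModType R) (f : V -> W) (x v : V) (t : R) (d : W) :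
  is_derive (x + t *: v) v f d -> is_derive t 1 (fun t : R => f (x + t *: v)) d.
Proof.
move=> /is_derive_lineP H; apply/is_derive_lineP.
rewrite (_ : (fun h => _) = (fun h : R => f (h *: v + (x + t *: v))))//.
apply/funext => h; congr f; rewrite [_ *: 1]mulr1 scalerDl.
by rewrite addrCA.
Qed.

Lemma is_derive_prod (I : eqType) (r : seq I) (c c' : I -> R -> R) (t : R) :
  uniq r -> (forall i, is_derive t (1 : R) (c i) (c' i t)) ->
  is_derive t (1 : R) (fun t => \prod_(i <- r) c i t)
    (\sum_(j <- r) c' j t * \prod_(i <- r | i != j) c i t).
Proof.
elim: r => [|a r IH] /=.
  move=> _ _; rewrite big_nil (_ : (fun t => _) = cst 1).
    exact: is_derive_cst.
  by apply/funext => s; rewrite big_nil.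
move=> /andP[ar ur] dc.
have H := is_deriveM (dc a) (IH ur dc).
have -> : (fun t => \prod_(i <- a :: r) c i t) =
    c a * (fun t => \prod_(i <- r) c i t).
  by apply/funext => s; rewrite big_cons.
apply: (is_derive_eq H).
rewrite big_cons big_cons eqxx /= addrC; congr (_ + _).
  rewrite [LHS]mulrC; congr (_ * _) => /=; rewrite [LHS]big_seq [RHS]big_seq_cond.
  apply: eq_bigl => i; rewrite andbC; case: eqP => //= ->.
  by rewrite (negbTE ar).
rewrite [LHS]mulr_sumr [LHS]big_seq [RHS]big_seq; apply: eq_bigr => j jr.
rewrite big_cons.
have -> : a != j by apply: contraNneq ar => ->.
by rewrite mulrCA.
Qed.

End directional.

Section tensor_bumps.
Context {R : realType} {n : nat}.
Implicit Types (b : 'I_n -> R -> R) (x v : 'rV[R]_n).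

Definition tens b x : R := \prod_i b i (x 0 i).

(** Differentiating a product function in direction [j] replaces its [j]-th factor, so the class of
    product functions is stable under partial derivatives. *)
Definition upd b (j : 'I_n) (c : R -> R) : 'I_n -> R -> R :=
  fun i => if i == j then c else b i.

Lemma tens_upd b j c x :
  tens (upd b j c) x = c (x 0 j) * \prod_(i | i != j) b i (x 0 i).
Proof.
rewrite /tens (bigD1 j)//= /upd eqxx; congr (_ * _).
by apply: eq_bigr => i /negbTE ->.
Qed.

Lemma is_derive_tens b b' x v :
  (forall i t, is_derive t (1 : R) (b i) (b' i t)) ->
  is_derive x v (tens b) (\sum_j v 0 j * tens (upd b j (b' j)) x).
Proof.
move=> db; apply/is_derive_lineP.
have H := @is_derive_prod R _ (index_enum 'I_n)
  (fun i t => b i (v 0 i * t + x 0 i)) (fun i t => v 0 i * b' i (v 0 i * t + x 0 i)) 0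
  (index_enum_uniq _) (fun i => is_derive_affine (db i _)).
rewrite (_ : (fun h => _) = (fun t => \prod_i b i (v 0 i * t + x 0 i))).
  apply: (is_derive_eq H); apply: eq_bigr => j _.
  rewrite tens_upd mulr0 add0r mulrA; congr (_ * _).
  by apply: eq_bigr => i _; rewrite mulr0 add0r.
by apply/funext => t; apply: eq_bigr => i _; rewrite !mxE mulrC.
Qed.

Lemma tens_delta_derive b b' x i :
  (forall i t, is_derive t (1 : R) (b i) (b' i t)) ->
  is_derive x (delta_mx 0 i) (tens b) (tens (upd b i (b' i)) x).
Proof.
move=> db; apply: (is_derive_eq (is_derive_tens x (delta_mx 0 i) db)).
rewrite (bigD1 i)//= mxE !eqxx mul1r big1 ?addr0// => j ji.
by rewrite mxE eqxx (negbTE ji) mul0r.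
Qed.

Lemma continuous_tens b : (forall i, continuous (b i)) -> continuous (tens b).
Proof.
move=> cb.
suff H r : continuous (fun y : 'rV[R]_n => \prod_(i <- r) b i (y 0 i)) by exact: H.
elim: r => [|a r IH] x.
  rewrite (_ : (fun y : 'rV[R]_n => _) = cst 1); first exact: cst_continuous.
  by apply/funext => y; rewrite big_nil.
rewrite (_ : (fun y : 'rV[R]_n => _) = (fun y => b a (y 0 a)) *
    (fun y => \prod_(i <- r) b i (y 0 i))).
  apply: continuousM; last exact: IH.
  by apply: continuous_comp; [exact: coord_continuous|exact: cb].
by apply/funext => y; rewrite big_cons.
Qed.

(** Fields with a single nonzero component suffice to test a vector identity one component at a
    time. *)
Definition tensv b (l : 'I_n) x : 'rV[R]_n := tens b x *: delta_mx 0 l.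

Lemma dotr_tensv (u : 'rV[R]_n) b l x : dotr u (tensv b l x) = u 0 l * tens b x.
Proof.
rewrite /dotr (bigD1 l)//= big1 ?addr0 => [|i il].
  by rewrite /tensv mxE mxE !eqxx mulr1.
by rewrite /tensv mxE mxE eqxx (negbTE il) !mulr0.
Qed.

Lemma Coo_upd b i c : (forall i, Coo (b i)) -> Coo c ->
  forall j, Coo (upd b i c j).
Proof. by move=> cb cc j; rewrite /upd; case: ifP. Qed.

Lemma Coo_derive b : (forall i, Coo (b i)) ->
  exists b', (forall i t, is_derive t (1 : R) (b i) (b' i t)) /\
    (forall i, Coo (b' i)).
Proof.
move=> cb; have /choice[b' Hb'] := fun i => CooP (cb i).
by exists b'; split=> i; have [] := Hb' i.
Qed.

Lemma is_derive_tensv b b' l x i :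
  (forall i t, is_derive t (1 : R) (b i) (b' i t)) ->
  is_derive x (delta_mx 0 i) (tensv b l) (tensv (upd b i (b' i)) l x).
Proof.
move=> db.
have H k : is_derive x (delta_mx 0 i) (fun y => tensv b l y 0 k)
    (tensv (upd b i (b' i)) l x 0 k).
  have -> : (fun y => tensv b l y 0 k) = (delta_mx 0 l : 'rV[R]_n) 0 k \*: tens b.
    by apply/funext => y; rewrite /tensv mxE mulrC.
  have -> : tensv (upd b i (b' i)) l x 0 k =
      (delta_mx 0 l : 'rV[R]_n) 0 k *: tens (upd b i (b' i)) x.
    by rewrite /tensv mxE mulrC.
  by apply: is_deriveZ; exact: tens_delta_derive.
have D : derivable (tensv b l) x (delta_mx 0 i).
  by apply/derivable_mxP => j k; rewrite (ord1 j); have [] := H k.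
apply: DeriveDef => //; rewrite derive_mx//; apply/rowP => k.
by rewrite mxE; have [] := H k.
Qed.

(** By induction on the list of directions, every iterated partial derivative is again a [tensv]
    with smooth factors. *)
Lemma smooth_tensv b l : (forall i, Coo (b i)) -> smooth (tensv b l).
Proof.
move=> cb s.
have [b' [cb' ->]] : exists b', (forall i, Coo (b' i)) /\
    foldr (@partial R n _) (tensv b l) s = tensv b' l.
  elim: s => [|i s [b' [cb' E]]]; first by exists b.
  have [b'' [db'' cb'']] := Coo_derive cb'.
  exists (upd b' i (b'' i)); split; first exact: Coo_upd.
  by rewrite /= E; apply/funext => x; have [] := is_derive_tensv l x i db''.
have [b'' [db'' cb'']] := Coo_derive cb'.
split=> [x|i x]; last by have [] := is_derive_tensv l x i db''.
have H : continuous (tens b').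
  by apply: continuous_tens => i; exact: Coo_continuous.
by have Hx := H x; exact: (cvgZr_tmp Hx).
Qed.

Definition cbump b : Prop := (forall i, Coo (b i)) /\
  exists M : R, forall i t, t \notin `]- M, M[ -> b i t = 0.

Lemma tens_out b M x : (forall i t, t \notin `]- M, M[ -> b i t = 0) ->
  ~ cube M x -> tens b x = 0.
Proof.
move=> bM; move=> /cubeP/existsNP[i]; move/negP; rewrite -leNgt => xi.
rewrite /tens (bigD1 i)//= bM ?mul0r// in_itv/= -ltr_norml.
by rewrite -leNgt.
Qed.

Lemma compact_closure_sub (K A : set 'rV[R]_n) :
  compact K -> A `<=` K -> compact (closure A).
Proof.
move=> cK AK; apply: (subclosed_compact _ cK); first exact: closed_closure.
have /closure_id -> : closed K.
  by apply: compact_closed => //; exact: norm_hausdorff.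
exact: closure_subset.
Qed.

Lemma test_field_tensv b l : cbump b -> test_field (tensv b l).
Proof.
move=> [cb [M bM]]; split; first exact: smooth_tensv.
have [K cK MK] := @cube_sub_compact R n M.
apply: (compact_closure_sub cK) => x /= nz; apply: MK; apply: contrapT => xM.
by move: nz; rewrite /tensv (tens_out bM xM) scale0r eqxx.
Qed.

Lemma cbump_measurable b : cbump b -> measurable_fun setT (tens b).
Proof.
move=> [cb _]; apply: continuous_measurable_rV; apply: continuous_tens => i.
exact: Coo_continuous.
Qed.

Lemma continuous_supp_bounded (c : R -> R) M : continuous c ->
  (forall t, t \notin `]- M, M[ -> c t = 0) -> exists2 B, 0 <= B & forall t, `|c t| <= B.
Proof.
move=> cc cM.
have : bounded_set (c @` `[- M, M]).
  apply: compact_bounded; apply: continuous_compact; last exact: segment_compact.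
  exact: continuous_subspaceT.
move=> [B [_ HB]]; exists (`|B| + 1) => [|t]; first by rewrite addr_ge0.
have [tM|tM] := boolP (t \in `]- M, M[); last by rewrite cM// normr0 addr_ge0.
apply: HB; first by rewrite (le_lt_trans (ler_norm _))// ltrDl.
by exists t => //; apply: subset_itv_oo_cc; exact: tM.
Qed.

Lemma cbump_bounded b : cbump b -> exists2 B, 0 <= B & forall x, `|tens b x| <= B.
Proof.
move=> [cb [M bM]].
have /choice[B HB] : forall i, exists B, forall t, `|b i t| <= B.
  move=> i; have [B _ HB] := continuous_supp_bounded (Coo_continuous (cb i)) (bM i).
  by exists B.
have B0 i : 0 <= B i by exact: le_trans (normr_ge0 (b i 0)) (HB i 0).
exists (\prod_i B i) => [|x]; first exact: prodr_ge0.
by rewrite /tens normr_prod; apply: ler_prod => i _; rewrite normr_ge0 HB.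
Qed.

Lemma cbump_upd b b' i : cbump b ->
  (forall i t, is_derive t (1 : R) (b i) (b' i t)) ->
  cbump (upd b i (b' i)).
Proof.
move=> [cb [M bM]] db; split.
  apply: Coo_upd => //; have [c [dc cc]] := CooP (cb i).
  suff -> : b' i = c by [].
  by apply/funext => t; have [_ <-] := db i t; have [_ <-] := dc t.
(* The derivative vanishes where [b i] is zero in a whole neighbourhood, hence only strictly beyond
   [M]; the larger radius provides this margin. *)
exists (`|M| + 1) => j t; rewrite in_itv/= -ltr_norml -leNgt => Mt.
have tM : M < `|t| by rewrite (lt_le_trans _ Mt)// (le_lt_trans (ler_norm _))// ltrDl.
rewrite /upd; case: eqP => [_|_]; last first.
  by apply: bM; rewrite in_itv/= -ltr_norml -leNgt ltW.
have [_ <-] := db i t.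
rewrite (@near_eq_derive _ _ _ _ (cst 0)) ?derive_cst//.
near=> s; apply: bM; rewrite in_itv/= -ltr_norml -leNgt ltW//.
near: s.
have H : `|s| @[s --> t] --> `|t| by exact: norm_continuous.
exact: (cvgr_gt _ H _ tM).
Unshelve. all: by end_near. Qed.

Lemma cbump_bump (a c : 'rV[R]_n) k :
  cbump (fun i => sbump (a 0 i) (c 0 i) k).
Proof.
split=> [i|]; first exact: Coo_sbump.
exists (\sum_i (`|a 0 i| + `|c 0 i|)) => i t.
rewrite in_itv/= -ltr_norml -leNgt => H; apply: sbump_out.
rewrite in_itv/= negb_and -!leNgt.
have : `|a 0 i| + `|c 0 i| <= `|t|.
  apply: le_trans H; rewrite (bigD1 i)//= lerDl.
  by apply: sumr_ge0 => j _; exact: addr_ge0.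
have := ler_norm (a 0 i); have := ler_norm (c 0 i); have := ler_norm (- a 0 i).
rewrite normrN; have := normr_ge0 (a 0 i); have := normr_ge0 (c 0 i).
case: (ger0P t) => t0.
  by move=> *; apply/orP; right; lra.
by move=> *; apply/orP; left; lra.
Qed.

Lemma tens_bump01 (a c : 'rV[R]_n) k x :
  0 <= tens (fun i => sbump (a 0 i) (c 0 i) k) x <= 1.
Proof.
rewrite /tens; apply/andP; split.
  by apply: prodr_ge0 => i _; have /andP[] := sbump01 (a 0 i) (c 0 i) k (x 0 i).
by apply: prodr_ile1 => i _; exact: sbump01.
Qed.

Lemma cvg_tens_bump (a c : 'rV[R]_n) x :
  tens (fun i => sbump (a 0 i) (c 0 i) k) x @[k --> \oo] --> (\1_(obox a c) x : R).
Proof.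
have -> : \1_(obox a c) x = \prod_i (\1_(`]a 0 i, c 0 i[%classic) (x 0 i) : R).
  rewrite indicE; have [xa|xa] := boolP (x \in obox a c).
    rewrite big1// => i _; rewrite indicE mem_set//.
    by move: xa => /set_mem; exact.
  move: xa; rewrite notin_setE => /existsNP[i xi].
  by rewrite (bigD1 i)//= indicE memNset// mul0r.
rewrite /tens; elim: (index_enum _) => [|i r IH].
  rewrite big_nil (_ : (fun y => _) = cst 1); first exact: cvg_cst.
  by apply/funext => y; rewrite big_nil.
under eq_fun do rewrite big_cons.
by rewrite big_cons; apply: cvgM => //; exact: cvg_sbump.
Qed.

End tensor_bumps.

(** * Density of product bump functions *)

Section real_integrals.
Context d (T : measurableType d) (R : realType).
Variable mu : {measure set T -> \bar R}.
Implicit Types f g : T -> R.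

Lemma integrable_le f g : measurable_fun setT f -> (forall x, `|f x| <= g x) ->
  mu.-integrable setT (EFin \o g) -> mu.-integrable setT (EFin \o f).
Proof.
move=> mf fg; apply: le_integrable => //; first exact/measurable_EFinP.
by move=> x _ /=; rewrite lee_fin (le_trans (fg x))// ler_norm.
Qed.

Lemma integrableRZ a f : mu.-integrable setT (EFin \o f) ->
  mu.-integrable setT (EFin \o (fun x => a * f x)).
Proof. by move=> fi; exact: (integrableZl measurableT a fi). Qed.

Lemma integrableRD f g : mu.-integrable setT (EFin \o f) ->
  mu.-integrable setT (EFin \o g) ->
  mu.-integrable setT (EFin \o (fun x => f x + g x)).
Proof. by move=> fi gi; exact: (integrableD measurableT fi gi). Qed.

Lemma integrableRB f g : mu.-integrable setT (EFin \o f) ->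
  mu.-integrable setT (EFin \o g) ->
  mu.-integrable setT (EFin \o (fun x => f x - g x)).
Proof. by move=> fi gi; exact: (integrableB measurableT fi gi). Qed.

Lemma integrable_indicT (A : set T) : measurable A -> (mu A < +oo)%E ->
  mu.-integrable setT (EFin \o (\1_A : T -> R)).
Proof.
move=> mA muA; apply/integrableP; split.
  by apply/measurable_EFinP; exact: measurable_indic.
rewrite (eq_integral (fun x => (\1_A x)%:E)) ?integral_indic ?setIT//.
by move=> x _ /=; rewrite ger0_norm.
Qed.

Lemma integrable_restrictP f (A : set T) : measurable A ->
  mu.-integrable A (EFin \o f) <->
  mu.-integrable setT (EFin \o (fun x => f x * \1_A x)).
Proof.
move=> mA.
have := integrable_restrict mu mA measurableT (EFin \o f).
by rewrite setTI restrict_EFin patch_indic.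
Qed.

Lemma Rintegral_lincomb (I : Type) (r : seq I) (c : I -> R) (h : I -> T -> R) :
  (forall i, mu.-integrable setT (EFin \o h i)) ->
  mu.-integrable setT (EFin \o (fun x => \sum_(i <- r) c i * h i x)) /\
  \int[mu]_x (\sum_(i <- r) c i * h i x) = \sum_(i <- r) c i * \int[mu]_x h i x.
Proof.
move=> ih; elim: r => [|i r [IH1 IH2]].
  rewrite big_nil (_ : (fun x => _) = cst 0); last by apply/funext => x; rewrite big_nil.
  by split; [exact: integrable0|rewrite Rintegral_cst// mul0r].
rewrite (_ : (fun x => _) = (fun x => c i * h i x + \sum_(i <- r) c i * h i x)); last first.
  by apply/funext => x; rewrite big_cons.
have ici := integrableRZ (c i) (ih i).
split; first exact: integrableRD.
by rewrite RintegralD// IH2 big_cons RintegralZl.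
Qed.

Lemma integrable_bounded_mul (q h : T -> R) (K : R) : measurable_fun setT q ->
  (forall x, `|q x| <= K) -> mu.-integrable setT (EFin \o h) ->
  mu.-integrable setT (EFin \o (fun x => q x * h x)).
Proof.
move=> mq qK ih; apply: integrable_le (integrableRZ K (integrable_norm ih)).
  by apply: measurable_funM => //; have /measurable_EFinP := measurable_int _ ih.
by move=> x; rewrite normrM ler_wpM2r.
Qed.

Lemma Rintegral_bounded_mul (q h : T -> R) (K : R) : measurable_fun setT q ->
  (forall x, `|q x| <= K) -> mu.-integrable setT (EFin \o h) ->
  `|\int[mu]_x (q x * h x)| <= K * \int[mu]_x `|h x|.
Proof.
move=> mq qK ih; have iqh := integrable_bounded_mul mq qK ih.
apply: le_trans (le_normr_Rintegral measurableT iqh) _.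
rewrite -RintegralZl//; last exact: integrable_norm ih.
apply: le_Rintegral => //; first exact: integrable_norm iqh.
  exact: integrableRZ (integrable_norm ih).
by move=> x _; rewrite normrM ler_wpM2r.
Qed.

Lemma dominated_cvgR (f_ : nat -> T -> R) f g :
  (forall k, measurable_fun setT (f_ k)) ->
  (forall x, f_ k x @[k --> \oo] --> f x) ->
  mu.-integrable setT (EFin \o g) ->
  (forall k x, `|f_ k x| <= g x) ->
  [/\ mu.-integrable setT (EFin \o f),
    (\int[mu]_x `|f_ k x - f x|%:E @[k --> \oo] --> 0)%E &
    \int[mu]_x f_ k x @[k --> \oo] --> \int[mu]_x f x].
Proof.
move=> mf ff ig fg.
have mlim : measurable_fun setT f.
  by apply: (measurable_fun_cvg mf) => x _; exact: ff.
have [] := @dominated_convergence _ _ _ mu setT measurableT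
  (fun k => EFin \o f_ k) (EFin \o f) (EFin \o g).
- by move=> k; exact/measurable_EFinP.
- exact/measurable_EFinP.
- apply: aeW => x _; apply: cvg_EFin; last exact: ff.
  exact: nearW.
- by [].
- by apply: aeW => x k _ /=; rewrite lee_fin.
move=> fi f0 fI; split => //.
rewrite /Rintegral; apply: fine_cvg.
by rewrite fineK//; exact: integrable_fin_num fi.
Qed.

Lemma ae_eq_Rintegral f g : measurable_fun setT f -> measurable_fun setT g ->
  {ae mu, forall x, f x = g x} -> \int[mu]_x f x = \int[mu]_x g x.
Proof.
move=> mf mg fg; rewrite /Rintegral; congr fine.
apply: ae_eq_integral => //; [exact/measurable_EFinP..|].
by apply: filterS fg => x -> .
Qed.

End real_integrals.

Section density.
Context {R : realType} {n : nat}.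
Local Notation mu := (lebesgue_rV R n).
Implicit Types (P : ('rV[R]_n -> R) -> Prop) (f h : 'rV[R]_n -> R).

Lemma measure_cube_lty k : (mu (cube k) < +oo)%E.
Proof. exact: lebesgue_obox_lty. Qed.

Lemma integrable_cube k : mu.-integrable setT (EFin \o (\1_(cube k) : 'rV[R]_n -> R)).
Proof. by apply: integrable_indicT; [exact: measurable_cube|exact: measure_cube_lty]. Qed.

(** A Dynkin argument: box indicators are dominated limits of product bumps, complements are
    differences, and countable disjoint unions are limits of finite sums. The cube supplies an
    integrable majorant throughout. Both the fundamental lemma and the density result rest on it. *)
Lemma indic_ind P (k : R) :
  (forall b, cbump b -> P (tens b)) ->
  (forall a f g, P f -> P g -> P (fun x => a * f x + g x)) ->
  (forall (f_ : nat -> 'rV[R]_n -> R) f,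
    (forall N, measurable_fun setT (f_ N)) ->
    (forall N x, `|f_ N x| <= \1_(cube k) x) ->
    (forall x, f_ N x @[N --> \oo] --> f x) ->
    (forall N, P (f_ N)) -> P f) ->
  forall A, measurable A -> P (\1_(A `&` cube k)).
Proof.
move=> Pb Pl Pc.
have P0 : P (cst 0).
  have [c Hc] : exists c : 'I_n -> R -> R, cbump c.
    by eexists; exact: (cbump_bump 0 0 0).
  have := Pl (-1) _ _ (Pb c Hc) (Pb c Hc); congr P.
  by apply/funext => x; rewrite mulN1r addNr.
have PD f g : P f -> P g -> P (fun x => f x + g x).
  move=> Pf Pg; have := Pl 1 _ _ Pf Pg; congr P.
  by apply/funext => x; rewrite mul1r.
have PB f g : P f -> P g -> P (fun x => f x - g x).
  move=> Pf Pg; have := Pl (-1) _ _ Pg Pf; congr P.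
  by apply/funext => x; rewrite mulN1r addrC.
have indic_le (A B : set 'rV[R]_n) x : A `<=` B -> \1_A x <= \1_B x :> R.
  move=> AB; rewrite !indicE ler_nat; case: (boolP (x \in A)) => // /set_mem /AB.
  by move/mem_set => ->.
have Pbox a c : P (\1_(obox a c `&` cube k)).
  rewrite oboxI; set a' := \row_i _; set c' := \row_i _.
  have sub : obox a' c' `<=` cube k by rewrite -oboxI; exact: subIsetr.
  apply: (Pc (fun N => tens (fun i => sbump (a' 0 i) (c' 0 i) N))).
  - by move=> N; apply: cbump_measurable; exact: cbump_bump.
  - move=> N x; have /andP[t0 t1] := tens_bump01 a' c' N x.
    rewrite ger0_norm//; apply: le_trans (indic_le _ _ x sub).
    rewrite indicE; have [//|] := boolP (x \in obox a' c').
    rewrite notin_setE => /existsNP[i /negP xi].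
    by rewrite /tens (bigD1 i)//= sbump_out ?mul0r.
  - move=> x; exact: cvg_tens_bump.
  - by move=> N; apply: Pb; exact: cbump_bump.
have PT : P (\1_(cube k)).
  by rewrite -[X in \1_X]setIid; exact: Pbox.
move=> A mA; have : <<s oboxes >> A by rewrite -measurable_rV_oboxes.
move: A {mA}; apply: (@dynkin_induction _ _ oboxes
  (fun A => P (\1_(A `&` cube k))) measurable_rV_oboxes oboxes_setI).
- by rewrite setTI.
- by move=> _ [[a c] _ <-]; exact: Pbox.
- move=> S mS PS; have := PB _ _ PT PS; congr P; apply/funext => x.
  rewrite !indicE !in_setI in_setC.
  by case: (x \in S); case: (x \in cube k); rewrite /= ?subrr ?subr0.
- move=> F mF tF PF.
  apply: (Pc (fun N => \1_((\big[setU/set0]_(i < N) F i) `&` cube k))).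
  + move=> N; apply: measurable_indic; apply: measurableI => //; last exact: measurable_cube.
    by apply: bigsetU_measurable => i _; exact: mF.
  + move=> N x; rewrite ger0_norm; last by rewrite indicE.
    by apply: indic_le; exact: subIsetr.
  + move=> x; have [[i _ Fx]|Fx] := pselect ((\bigcup_i F i) x).
      apply: cvg_near_cst; exists i.+1 => // N /= iN; rewrite !indicE !in_setI.
      have -> : x \in \big[setU/set0]_(i < N) F i.
        by apply/mem_set; rewrite -bigcup_mkord; exists i.
      by have -> : x \in \bigcup_k F k by apply/mem_set; exists i.
    apply: cvg_near_cst; apply: nearW => N; rewrite !indicE !in_setI.
    have -> : (x \in \bigcup_k F k) = false by apply: memNset.
    have -> // : (x \in \big[setU/set0]_(i < N) F i) = false.
    apply: memNset; apply: contra_not Fx; rewrite -bigcup_mkord => -[j _ Fj].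
    by exists j.
  + elim=> [|N IH].
      have := P0; congr P; apply/funext => x.
      by rewrite big_ord0 set0I indic0.
    have := PD _ _ IH (PF N); congr P; apply/funext => x.
    rewrite big_ord_recr/= !indicE !in_setI in_setU.
    have [xF|] := boolP (x \in F N); last by rewrite andFb addr0 orbF.
    have -> : (x \in \big[setU/set0]_(i < N) F i) = false.
      apply: memNset; rewrite -bigcup_mkord => -[j /= jN Fj].
      have /trivIsetP/(_ j N I I) := tF; rewrite (ltn_eqF jN) => /(_ isT).
      by move=> /seteqP[/(_ x) H _]; apply: H; split => //; exact: set_mem xF.
    by rewrite /= add0r.
Qed.

(** [indic_ind] extends the vanishing of the integral from bumps to all Borel subsets of a cube, and
    a function whose integrals over all of these vanish is null there. *)
Lemma fundamental_lemma h : measurable_fun setT h ->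
  (forall k : nat, mu.-integrable (cube k%:R) (EFin \o h)) ->
  (forall b, cbump b -> \int[mu]_x (h x * tens b x) = 0) ->
  {ae mu, forall x, h x = 0}.
Proof.
move=> mh ih h0.
have hQ k : {ae mu, forall x, cube k%:R x -> h x = 0}.
  (* Integrability travels with the identity, because linearity of [Rintegral] fails without it. *)
  pose P f := mu.-integrable setT (EFin \o (fun x => h x * f x)) /\
    \int[mu]_x (h x * f x) = 0.
  have PA A : measurable A -> P (\1_(A `&` cube k%:R)).
    apply: indic_ind => {A}.
    - move=> b cb; split; last exact: h0.
      have [B B0 HB] := cbump_bounded cb.
      have [_ [M bM]] := cb.
      have iB := (integrable_restrictP mu h (measurable_cube (Num.truncn M).+1%:R)).1 (ih _).
      have := integrableRZ B (integrable_norm iB).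
      apply: (@integrable_le _ _ _ _ _ (fun x => B * `|h x * \1_(cube (Num.truncn M).+1%:R) x|)).
        by apply: measurable_funM => //; exact: cbump_measurable.
      move=> x; rewrite normrM indicE.
      have [xM|xM] := boolP (x \in cube _).
        by rewrite mulr1 mulrC ler_wpM2r.
      rewrite (tens_out bM) ?normr0 ?mulr0 ?mulr_ge0//.
      move: xM; rewrite notin_setE; apply: contra_not => /cubeP xM.
      by apply/cubeP => i; apply: lt_trans (xM i) _; exact: truncnS_gt.
    - move=> a f g [fi f0] [gi g0].
      have E : (fun x => h x * (a * f x + g x)) =
          (fun x => a * (h x * f x) + h x * g x).
        by apply/funext => x; ring.
      have ai := integrableRZ a fi.
      split; rewrite E.
        exact: integrableRD ai gi.
      by rewrite RintegralD// RintegralZl// f0 g0 mulr0 addr0.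
    - move=> f_ f mf fQ ff Pf.
      have iQ := integrable_norm
        ((integrable_restrictP mu h (measurable_cube k%:R)).1 (ih _)).
      have [] := @dominated_cvgR _ _ _ mu (fun N x => h x * f_ N x)
        (fun x => h x * f x) _ _ _ iQ.
      + by move=> N; exact: measurable_funM.
      + by move=> x; apply: cvgM; [exact: cvg_cst|exact: ff].
      + move=> N x /=; rewrite !normrM ler_wpM2l// (le_trans (fQ N x))//.
        exact: ler_norm.
      + move=> fi _ fc; split => //; apply: cvg_unique fc _ => //.
        rewrite (_ : (fun N => _) = cst 0); first exact: cvg_cst.
        by apply/funext => N; have [] := Pf N.
  have H : ae_eq mu (cube k%:R) (EFin \o h) (cst 0%E).
    apply: integral_ae_eq => //; first exact: measurable_cube.
    move=> E EQ mE; rewrite integral0.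
    have [iE E0] := PA E mE.
    have fE := integrable_fin_num measurableT iE.
    rewrite integral_mkcond restrict_EFin patch_indic.
    rewrite (setIidl EQ) in E0 fE.
    by rewrite -[RHS]/(0%:E) -E0 /Rintegral fineK.
  by apply: filterS H => x H Qx; have [] := H Qx.
have : {ae mu, forall x, forall k : nat, cube k%:R x -> h x = 0}.
  exact: ae_foralln.
apply: filterS => x H.
have : [set: 'rV[R]_n] x by [].
by rewrite -bigcup_cube => -[k _ /H].
Qed.

End density.

(** * Density of product bumps in [L^1] *)

Section L1_density.
Context {R : realType} {n : nat}.
Local Notation mu := (lebesgue_rV R n).
Implicit Types f g : 'rV[R]_n -> R.

Lemma cbump_integrable (b : 'I_n -> R -> R) : cbump b ->
  mu.-integrable setT (EFin \o tens b).
Proof.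
move=> cb; have [B B0 HB] := cbump_bounded cb; have [_ [M bM]] := cb.
apply: (@integrable_le _ _ _ _ _ (fun x => B * \1_(cube M) x)).
- exact: cbump_measurable.
- move=> x; rewrite indicE; have [xM|xM] := boolP (x \in cube M).
    by rewrite mulr1.
  by rewrite (tens_out bM) ?normr0 ?mulr0//; rewrite notin_setE in xM.
- apply: integrableRZ; apply: integrable_indicT.
    exact: measurable_cube.
  exact: measure_cube_lty.
Qed.

Import HBSimple.

(** The chain is: Borel subsets of cubes by [indic_ind], simple functions cut to cubes by linearity,
    then simple functions and all integrable functions by two successive [L^1] limits. [Pseq]
    converts approximation within every [e] into closure under such limits. *)
Lemma L1_density (P : ('rV[R]_n -> R) -> Prop) :
  (forall b, cbump b -> P (tens b)) ->
  (forall a f g, mu.-integrable setT (EFin \o f) ->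
    mu.-integrable setT (EFin \o g) -> P f -> P g -> P (fun x => a * f x + g x)) ->
  (forall f, mu.-integrable setT (EFin \o f) ->
    (forall e, 0 < e -> exists g, [/\ mu.-integrable setT (EFin \o g), P g &
      (\int[mu]_x `|f x - g x|%:E <= e%:E)%E]) -> P f) ->
  forall f, mu.-integrable setT (EFin \o f) -> P f.
Proof.
move=> Pb Pl Pc.
pose P' f := mu.-integrable setT (EFin \o f) /\ P f.
have Pl' a f g : P' f -> P' g -> P' (fun x => a * f x + g x).
  by move=> [fi Pf] [gi Pg]; split; [apply/integrableRD => //; exact/integrableRZ|exact: Pl].
have Pseq (f_ : nat -> 'rV[R]_n -> R) f :
    (forall N, mu.-integrable setT (EFin \o f_ N)) ->
    mu.-integrable setT (EFin \o f) ->
    (\int[mu]_x `|f_ k x - f x|%:E @[k --> \oo] --> 0)%E ->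
    (forall N, P (f_ N)) -> P f.
  move=> fi_ fi f0 Pf; apply: Pc => // e e0.
  have /fine_cvgP[_ /cvgrPdist_le/(_ _ e0)] := f0.
  move=> [N _ /(_ N (leqnn N))] /= H; exists (f_ N); split => //.
  have iB := integrable_norm (integrableRB (fi_ N) fi).
  rewrite -lee_fin in H; apply: le_trans H.
  rewrite sub0r normrN ger0_norm; last first.
    by apply: fine_ge0; apply: integral_ge0 => x _; rewrite lee_fin.
  rewrite fineK; last exact: integrable_fin_num iB.
  by under eq_integral do rewrite distrC.
have P'A (k : R) A : measurable A -> P' (\1_(A `&` cube k)).
  apply: indic_ind => //.
    by move=> b cb; split; [exact: cbump_integrable|exact: Pb].
  move=> f_ f mf fQ ff Pf.
  have iQ : mu.-integrable setT (EFin \o (\1_(cube k) : _ -> R)).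
    apply: integrable_indicT; first exact: measurable_cube.
    exact: measure_cube_lty.
  have [fi f0 _] := dominated_cvgR mf ff iQ fQ.
  split => //; apply: Pseq f0 _ => //; by move=> N; have [] := Pf N.
(* The level set of the value [0] may have infinite measure; cutting to a cube makes each term of
   the decomposition integrable. *)
have P'sf (g : {sfun 'rV[R]_n >-> R}) (k : R) : P' (fun x => g x * \1_(cube k) x).
  have -> : (fun x => g x * \1_(cube k) x) =
      (fun x => \sum_(y <- finmap.enum_fset (fset_set (range g)))
         y * \1_((g @^-1` [set y]) `&` cube k) x).
    apply/funext => x; rewrite fimfunE fsbig_finite//= mulr_suml.
    by apply: eq_bigr => y _; rewrite indicI -mulrA.
  elim: (finmap.enum_fset _) => [|y s IH].
    have := Pl' (-1) _ _ (P'A k set0 measurable0) (P'A k set0 measurable0).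
    congr P'; apply/funext => x.
    by rewrite big_nil set0I indic0 mulr0 addr0.
  have my : measurable (g @^-1` [set y]) by exact: measurable_sfunP.
  have := Pl' y _ _ (P'A k _ my) IH; congr P'; apply/funext => x.
  by rewrite big_cons.
move=> f fi.
have [g_ [ig _ g0]] := approximation_sfun_integrable measurableT fi.
apply: (Pseq g_) => //; first last.
- move=> N; apply: (Pseq (fun k x => g_ N x * \1_(cube k%:R) x)).
  + by move=> k; have [] := P'sf (g_ N) k%:R.
  + exact: ig.
  + have [||||//] := @dominated_cvgR _ _ _ mu (fun k x => g_ N x * \1_(cube k%:R) x)
      (g_ N) (fun x => `|g_ N x|).
    * move=> k; apply: measurable_funM => //.
      by apply: measurable_indic; exact: measurable_cube.
    * move=> x; have : [set: 'rV[R]_n] x by [].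
      rewrite -bigcup_cube => -[k _ /cubeP kx].
      apply: cvg_near_cst; exists k => // j /= kj.
      rewrite indicE mem_set ?mulr1//; apply/cubeP => i.
      by apply: lt_le_trans (kx i) _; rewrite ler_nat.
    * exact: integrable_norm (ig N).
    * move=> k x; rewrite normrM -[leRHS]mulr1 ler_wpM2l// indicE.
      by case: (x \in _); rewrite ?normr1 ?normr0.
  + by move=> k; have [] := P'sf (g_ N) k%:R.
- apply: cvg_trans g0; apply: near_eq_cvg; apply: nearW => k.
  by apply: eq_integral => x _; rewrite /= distrC.
Qed.

End L1_density.

(** * Gaussian and Gamma integrals *)

Section line_integrals.
Context {R : realType}.
Local Notation lam := (@lebesgue_measure R).

Lemma is_derive_continuous (F f : R -> R) :
  (forall t, is_derive t (1 : R) F (f t)) -> continuous F.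
Proof.
by move=> dF t; have [dFt _] := dF t; exact/differentiable_continuous/derivable1_diffP.
Qed.

Lemma FTC2_line (F f : R -> R) a b : a <= b ->
  (forall t, is_derive t (1 : R) F (f t)) -> continuous f ->
  (\int[lam]_(x in `[a, b]) (f x)%:E = (F b - F a)%:E)%E.
Proof.
rewrite le_eqVlt => /predU1P[<- _ _|ab dF cf].
  by rewrite set_itv1 integral_set1 subrr.
have cF := is_derive_continuous dF.
rewrite (@continuous_FTC2 _ _ F)//.
- exact: continuous_subspaceT.
- split.
  + by move=> x _; have [] := dF x.
  + exact/cvg_at_right_filter/cF.
  + exact/cvg_at_left_filter/cF.
- by move=> x _; rewrite derive1E; have [_ ->] := dF x.
Qed.

Lemma cvg_itvN (h : R -> R) x :
  h x * \1_(`[(- N%:R), N%:R]%classic) x @[N --> \oo] --> h x.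
Proof.
apply: cvg_near_cst; exists (Num.truncn `|x|).+1 => // N /= xN.
rewrite indicE mem_set ?mulr1//= in_itv/= -ler_norml ltW//.
by apply: lt_le_trans (truncnS_gt _) _; rewrite ler_nat.
Qed.

(** The fundamental theorem on [[-N, N]] followed by dominated convergence. It serves to integrate
    by parts against Gaussians. *)
Lemma Rintegral_derive (F f : R -> R) (l : R) :
  (forall t, is_derive t (1 : R) F (f t)) -> continuous f ->
  lam.-integrable setT (EFin \o f) ->
  F N%:R - F (- N%:R) @[N --> \oo] --> l ->
  \int[lam]_x f x = l.
Proof.
move=> dF cf fi Fl.
have [N|||N x|_ _ H] := @dominated_cvgR _ _ R lam
  (fun N x => f x * \1_(`[(- N%:R), N%:R]%classic) x) f (fun x => `|f x|).
- apply: measurable_funM; first exact: continuous_measurable_fun.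
  by apply: measurable_indic; exact: measurable_itv.
- exact: cvg_itvN.
- exact: integrable_norm.
- rewrite normrM -[leRHS]mulr1 ler_wpM2l// indicE.
  by case: (x \in _); rewrite ?normr1 ?normr0.
apply: (cvg_unique _ H) => //.
apply: cvg_trans Fl; apply: near_eq_cvg; apply: nearW => N.
have -> : (fun x => f x * \1_(`[(- N%:R), N%:R]%classic) x) =
    f \_ `[(- N%:R), N%:R] by rewrite patch_indic.
rewrite -Rintegral_mkcond /Rintegral (FTC2_line _ dF cf)//.
by apply: le_trans (_ : 0 <= _); rewrite ?oppr_le0.
Qed.

Lemma integral_expRN c : 0 < c ->
  (\int[lam]_(u in `[0%R, +oo[) (expR (- (c * u)))%:E = (c^-1)%:E)%E.
Proof.
move=> c0.
have dN t : is_derive t (1 : R) (fun t => - (c * t)) (- c).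
  have H : is_derive t (1 : R) (- c \*: id) (- c *: 1) by apply: is_deriveZ.
  have -> : (fun t => - (c * t)) = - c \*: (id : R -> R).
    by apply/funext => s; rewrite [RHS]mulNr.
  by apply: (is_derive_eq H); rewrite [LHS]mulr1.
have dE t : is_derive t (1 : R) (fun t => expR (- (c * t))) (- c * expR (- (c * t))).
  by have := @is_derive1_comp R expR (fun t => - (c * t)) t _ _ (is_derive_expR _) (dN t);
    rewrite mulrC; exact.
pose F t := - c^-1 * expR (- (c * t)).
have dF t : is_derive t (1 : R) F (expR (- (c * t))).
  have H : is_derive t (1 : R) (- c^-1 \*: (fun t => expR (- (c * t))))
    (- c^-1 *: (- c * expR (- (c * t)))) by exact: is_deriveZ.
  by apply: (is_derive_eq H); rewrite [LHS]mulrA mulrNN mulVf ?mul1r// gt_eqF.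
have cE : continuous (fun t => expR (- (c * t))) := is_derive_continuous dE.
rewrite (@ge0_continuous_FTC2y _ _ F 0 0).
- by rewrite /F mulr0 oppr0 expR0 mulr1 sub0e EFinN oppeK.
- by move=> x _; exact: expR_ge0.
- exact: continuous_subspaceT.
- rewrite -[X in _ --> X](mulr0 (- c^-1)); apply: cvgM; first exact: cvg_cst.
  apply: (cvg_comp (fun t => c * t) (fun x => expR (- x))).
    exact: gt0_cvgMry.
  exact: cvgr_expR.
- by move=> x _; have [] := dF x.
- exact/cvg_at_right_filter/(is_derive_continuous dF).
- by move=> x _; rewrite derive1E; have [_ ->] := dF x.
Qed.

Lemma lebesgue_translation (v : R) A : measurable A ->
  pushforward lam (+%R^~ v : _ -> measurableTypeR R) A = lam A.
Proof.
move=> mA; apply/esym/lebesgue_measure_unique => //=.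
  exact: measurable_funD.
move=> _ _ [[a b]] _ <-.
rewrite /pushforward.
have -> : (+%R^~ v) @^-1` [set` `]a, b]] = [set` `]a - v, b - v]] :> set R.
  by apply/seteqP; split=> x; rewrite /= !in_itv/= ltrBlDr lerBrDr.
rewrite !lebesgue_measure_itv/= !lte_fin ltrD2r.
by case: ifP => // _; rewrite -!EFinB; congr EFin; ring.
Qed.

Lemma ge0_integral_line_translation (v : R) (h : R -> \bar R) :
  measurable_fun setT h -> (forall x, (0 <= h x)%E) ->
  (\int[lam]_x h (x + v)%R = \int[lam]_x h x)%E.
Proof.
move=> mh h0.
have mv : measurable_fun [set: measurableTypeR R]
  ((+%R^~ v) : measurableTypeR R -> measurableTypeR R).
  exact: measurable_funD.
have := @ge0_integral_pushforward _ _ _ _ _ _ mv lam setT h measurableT.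
rewrite preimage_setT => <- //.
by apply: eq_measure_integral => A mA _ /=; exact: lebesgue_translation.
Qed.

Lemma ge0_integral_line_opp (h : R -> \bar R) :
  measurable_fun setT h -> (forall x, (0 <= h x)%E) ->
  (\int[lam]_(x in `]-oo, 0%R]) h x = \int[lam]_(x in `[0%R, +oo[) h (- x)%R)%E.
Proof.
move=> mh h0.
have := @ge0_integration_by_substitution0 R (h \o -%R).
rewrite /= => -> //.
  by apply: eq_integral => x _; rewrite opprK.
by apply: measurableT_comp => //.
Qed.

Lemma integral_expRNy c : 0 < c ->
  (\int[lam]_(u in `]-oo, 0%R]) (expR (c * u))%:E = (c^-1)%:E)%E.
Proof.
move=> c0; rewrite (@ge0_integral_line_opp (fun u => (expR (c * u))%:E)).
- by under eq_integral do rewrite mulrN; exact: integral_expRN.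
- apply/measurable_EFinP; exact: measurableT_comp.
- by move=> x; rewrite lee_fin expR_ge0.
Qed.

Lemma ge0_integral_line_split (h : R -> \bar R) :
  measurable_fun setT h -> (forall x, (0 <= h x)%E) ->
  (\int[lam]_x h x = \int[lam]_(x in `]-oo, 0%R]) h x + \int[lam]_(x in `[0%R, +oo[) h x)%E.
Proof.
move=> mh h0.
rewrite -(@integral_itv_obnd_cbnd _ 0 +oo%O h); last exact: measurable_funTS.
rewrite -ge0_integral_setU//=.
- by congr integral; rewrite -(setUv `]-oo, 0%R]) setCitvl.
- exact: measurable_funTS.
- rewrite disj_set2E; apply/eqP; rewrite -subset0 => x /=.
  by rewrite !in_itv/= andbT => -[x0]; rewrite ltNge x0.
Qed.

(** The integrand is a multiple of the centred normal density of variance [1 / (2 s)]. *)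
Lemma gauss_line (s : R) : 0 < s ->
  lam.-integrable setT (EFin \o (fun t : R => expR (- (s * t ^+ 2)))) /\
  \int[lam]_t expR (- (s * t ^+ 2)) = Num.sqrt (pi / s).
Proof.
move=> s0; pose sg := Num.sqrt ((2 * s)^-1).
have s2 : sg ^+ 2 = (2 * s)^-1.
  by rewrite sqr_sqrtr// invr_ge0 mulr_ge0// ltW.
have sg0 : sg != 0 by rewrite gt_eqF// sqrtr_gt0 invr_gt0 mulr_gt0.
have E t : expR (- (s * t ^+ 2)) = Num.sqrt (pi / s) * normal_pdf 0 sg t.
  rewrite normal_pdfE//.
  rewrite /normal_peak /normal_fun subr0 s2 -[_ *+ 2]mulr_natl.
  have -> : 2 * ((2 * s)^-1 * pi) = pi / s by field; rewrite gt_eqF.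
  rewrite mulVKf; last by rewrite gt_eqF// sqrtr_gt0 divr_gt0// pi_gt0.
  congr expR; rewrite -[_ *+ 2]mulr_natl; field.
  by rewrite gt_eqF.
have -> : (fun t : R => expR (- (s * t ^+ 2))) =
    (fun t => Num.sqrt (pi / s) * normal_pdf 0 sg t) by apply/funext.
have ip : lam.-integrable setT (EFin \o normal_pdf 0 sg) by exact: integrable_normal_pdf.
split; first exact: integrableRZ.
rewrite (@RintegralZl _ _ R lam)//.
by rewrite /Rintegral integral_normal_pdf mulr1.
Qed.

(** Half of the Gaussian absorbs the polynomial factor, by [1 + y <= expR y] at [y = s t^2 / 2]. *)
Lemma sqr_expRN_le (s t : R) : 0 < s ->
  t ^+ 2 * expR (- (s * t ^+ 2)) <= 2 / s * expR (- (s / 2 * t ^+ 2)).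
Proof.
move=> s0.
have -> : - (s * t ^+ 2) = - (s / 2 * t ^+ 2) + - (s / 2 * t ^+ 2) by field.
rewrite expRD mulrA ler_wpM2r ?expR_ge0// expRN ler_pdivrMr ?expR_gt0//.
rewrite mulrAC ler_pdivlMr//.
have := expR_ge1Dx (s / 2 * t ^+ 2).
have : 0 <= s * t ^+ 2 by rewrite mulr_ge0 ?sqr_ge0// ltW.
lra.
Qed.

Lemma is_derive_gauss (s t : R) :
  is_derive t (1 : R) (fun t : R => expR (- (s * t ^+ 2)))
    (- (2 * s) * (t * expR (- (s * t ^+ 2)))).
Proof.
have dX : is_derive t (1 : R) (id ^+ 2) ((2 * t ^+ 1) *: 1) by exact: is_deriveX.
have dg : is_derive t (1 : R) (fun t => - (s * t ^+ 2)) (- s * (2 * t)).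
  have H : is_derive t (1 : R) (- s \*: (id ^+ 2)) (- s *: ((2 * t ^+ 1) *: 1)).
    exact: is_deriveZ.
  have -> : (fun t => - (s * t ^+ 2)) = - s \*: ((id : R -> R) ^+ 2).
    by apply/funext => x; rewrite [RHS]mulNr.
  by apply: (is_derive_eq H); rewrite expr1 [_ *: 1]mulr1.
have H : is_derive t (1 : R) (fun t : R => expR (- (s * t ^+ 2)))
    (expR (- (s * t ^+ 2)) * (- s * (2 * t))) :=
  @is_derive1_comp R expR (fun t => - (s * t ^+ 2)) t _ _ (is_derive_expR _) dg.
by apply: (is_derive_eq H); ring.
Qed.

Lemma cvg_gauss (s : R) : 0 < s ->
  N%:R * expR (- (s * N%:R ^+ 2)) @[N --> \oo] --> (0 : R).
Proof.
move=> s0.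
apply: (@squeeze_cvgr _ _ _ _ (cst 0) (fun N => s^-1 * N%:R^-1)).
- near=> N; rewrite mulr_ge0 ?expR_ge0//=.
  have N0 : 0 < N%:R :> R by rewrite ltr0n; near: N; exact: nbhs_infty_gt.
  rewrite expRN ler_pdivrMr ?expR_gt0// mulrAC ler_pdivlMr//.
  rewrite ler_pdivlMl//; apply: le_trans (expR_ge1Dx _).
  by rewrite -expr2 lerDr.
- exact: cvg_cst.
- rewrite -[X in _ --> X](mulr0 s^-1); apply: cvgM; first exact: cvg_cst.
  by apply/cvgr0Pnorm_lt => e e0; near=> N;
    rewrite normfV normr_nat invf_plt ?posrE// ?ltr0n; near: N;
    [exact: nbhs_infty_gtr|exact: nbhs_infty_gt].
Unshelve. all: by end_near. Qed.

(** Up to the factor [- 2 s] the integrand is the derivative of the Gaussian, which takes equal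
    values at [N] and [- N]. *)
Lemma gauss_line1 (s : R) : 0 < s ->
  lam.-integrable setT (EFin \o (fun t : R => t * expR (- (s * t ^+ 2)))) /\
  \int[lam]_t (t * expR (- (s * t ^+ 2))) = 0.
Proof.
move=> s0.
have cg : continuous (fun t : R => expR (- (s * t ^+ 2))) :=
  is_derive_continuous (is_derive_gauss s).
have ct : continuous (fun t : R => t * expR (- (s * t ^+ 2))).
  by move=> t; apply: cvgM; [exact: cvg_id|exact: cg].
have it : lam.-integrable setT (EFin \o (fun t : R => t * expR (- (s * t ^+ 2)))).
  have s20 : 0 < s / 2 by rewrite divr_gt0.
  have i1 := (gauss_line s0).1; have i2 := integrableRZ (2 / s) (gauss_line s20).1.
  apply: integrable_le (integrableRD i1 i2); first exact: continuous_measurable_fun.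
  move=> t; apply: le_trans (_ : _ <= expR (- (s * t ^+ 2)) + t ^+ 2 * expR (- (s * t ^+ 2))) _.
    have := expR_ge0 (- (s * t ^+ 2)); set e := expR _ => e0.
    rewrite normrM (ger0_norm e0).
    have -> : e + t ^+ 2 * e = (1 + t ^+ 2) * e by ring.
    rewrite ler_wpM2r// -(@real_normK _ t) ?num_real//.
    by have := normr_ge0 t; nra.
  by rewrite lerD2l sqr_expRN_le.
split => //.
have idd : lam.-integrable setT (EFin \o (fun t => - (2 * s) * (t * expR (- (s * t ^+ 2))))).
  exact: integrableRZ.
have : \int[lam]_t (- (2 * s) * (t * expR (- (s * t ^+ 2)))) = 0.
  apply: (Rintegral_derive (is_derive_gauss s)) => //.
    by move=> t; apply: cvgM; [exact: cvg_cst|exact: ct].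
  rewrite (_ : (fun N => _) = cst 0); first exact: cvg_cst.
  by apply/funext => N; rewrite sqrrN subrr.
rewrite RintegralZl// => /eqP; rewrite mulf_eq0 oppr_eq0 mulf_eq0.
by rewrite (gt_eqF s0) pnatr_eq0/= => /eqP.
Qed.

(** Integration by parts: the derivative of [t exp(- s t^2)] is
    [exp(- s t^2) - 2 s t^2 exp(- s t^2)], and the boundary terms vanish by [cvg_gauss]. *)
Lemma gauss_line2 (s : R) : 0 < s ->
  lam.-integrable setT (EFin \o (fun t : R => t ^+ 2 * expR (- (s * t ^+ 2)))) /\
  \int[lam]_t (t ^+ 2 * expR (- (s * t ^+ 2))) = Num.sqrt (pi / s) / (2 * s).
Proof.
move=> s0.
have cg : continuous (fun t : R => expR (- (s * t ^+ 2))) :=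
  is_derive_continuous (is_derive_gauss s).
have ct : continuous (fun t : R => t ^+ 2 * expR (- (s * t ^+ 2))).
  by move=> t; apply: cvgM; [exact: exprn_continuous|exact: cg].
have it : lam.-integrable setT (EFin \o (fun t : R => t ^+ 2 * expR (- (s * t ^+ 2)))).
  have s20 : 0 < s / 2 by rewrite divr_gt0.
  have i2 := integrableRZ (2 / s) (gauss_line s20).1.
  apply: integrable_le i2; first exact: continuous_measurable_fun.
  move=> t; rewrite ger0_norm; first exact: sqr_expRN_le.
  by apply: mulr_ge0; [exact: sqr_ge0|exact: expR_ge0].
split => //.
have [ig Ig] := gauss_line s0.
have dF t : is_derive t (1 : R) (fun t : R => t * expR (- (s * t ^+ 2)))
    (expR (- (s * t ^+ 2)) - 2 * s * (t ^+ 2 * expR (- (s * t ^+ 2)))).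
  have H := is_deriveM (is_derive_id t (1 : R)) (is_derive_gauss s t).
  by apply: (is_derive_eq H); rewrite /GRing.scale/=; ring.
have iZ := integrableRZ (2 * s) it.
have := @Rintegral_derive _ _ 0 dF.
rewrite RintegralB// RintegralZl// Ig => H.
have -> : Num.sqrt (pi / s) = 2 * s * \int[lam]_t (t ^+ 2 * expR (- (s * t ^+ 2))).
  apply/eqP; rewrite -subr_eq0; apply/eqP; apply: H.
  - move=> t; apply: cvgB; first exact: cg.
    by apply: cvgM; [exact: cvg_cst|exact: ct].
  - exact: integrableRB.
  - rewrite -[X in _ --> X](addr0 0); rewrite (_ : (fun N => _) =
      (fun N => N%:R * expR (- (s * N%:R ^+ 2)) + N%:R * expR (- (s * N%:R ^+ 2)))).
      by apply: cvgD; exact: cvg_gauss.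
    by apply/funext => N; rewrite sqrrN mulNr opprK.
by rewrite mulrC mulKf// mulf_neq0// gt_eqF.
Qed.

End line_integrals.

(** * The Gamma function in logarithmic variables and its pole at [0] *)

Section gamma.
Context {R : realType}.
Local Notation lam := (@lebesgue_measure R).

(** This is [t^p exp(- r t)] at [t = expR u]; integrating in [u] amounts to integrating it against
    [dt / t]. *)
Definition log_gamma_integrand (p r u : R) : R := expR (p * u - r * expR u).
Local Notation lg := log_gamma_integrand.

Lemma continuous_lg p r : continuous (lg p r).
Proof.
move=> u; apply: continuous_comp; last exact: continuous_expR.
apply: cvgB; first by apply: cvgM; [exact: cvg_cst|exact: cvg_id].
by apply: cvgM; [exact: cvg_cst|exact: continuous_expR].
Qed.

Lemma measurable_lg p r : measurable_fun setT (lg p r).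
Proof. by apply: continuous_measurable_fun; exact: continuous_lg. Qed.

Lemma bigcup_itv_expR :
  \bigcup_(N : nat) `[expR (- N%:R), expR N%:R]%classic = `]0, +oo[%classic :> set R.
Proof.
apply/seteqP; split => [t [N _]|t] /=; rewrite !in_itv/= ?andbT.
  by move=> /andP[H _]; apply: lt_le_trans H; exact: expR_gt0.
move=> t0; exists (Num.truncn `|ln t|).+1 => //=; rewrite in_itv/=.
have : `|ln t| <= (Num.truncn `|ln t|).+1%:R by rewrite ltW// truncnS_gt.
rewrite ler_norml; set M := _%:R => /andP[h1 h2].
by rewrite -(@lnK _ t) ?posrE// !ler_expR h1 h2.
Qed.

Lemma bigcup_itv_nat : \bigcup_(N : nat) `[(- N%:R), N%:R]%classic = [set: R].
Proof.
rewrite -subTset => x _; exists (Num.truncn `|x|).+1 => //=.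
by rewrite in_itv/= -ler_norml ltW// truncnS_gt.
Qed.

(* The substitution [t = expR u] turns the scaling [t |-> r * t] in the Gamma integral into a
   translation of the real line. *)
Lemma gamma_log p :
  (\int[lam]_(t in `]0%R, +oo[) (t `^ (p - 1) * expR (- t))%:E =
   \int[lam]_u (lg p 1 u)%:E)%E.
Proof.
pose G t : R := t `^ (p - 1) * expR (- t).
have G0 t : 0 <= G t by rewrite mulr_ge0 ?powR_ge0 ?expR_ge0.
have mG : measurable_fun setT G.
  apply: measurable_funM; first exact: measurable_powR.
  by apply: measurableT_comp => //; exact: measurable_funN.
have dexp : derive1 (expR : R -> R) = expR by apply/funext => x; rewrite derive1E; have [] := is_derive_expR x.
(* The substitution is made on segments; monotone convergence along the two exhaustions then gives
   the improper identity. *)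
have S N : (\int[lam]_(t in `[expR (- N%:R), expR N%:R]) (G t)%:E =
    \int[lam]_(u in `[(- N%:R)%R, N%:R%R]) (lg p 1 u)%:E)%E.
  rewrite integration_by_substitution_increasing ?dexp//.
  - apply: eq_integral => u _; congr EFin.
    rewrite /lg mul1r expRB /G /= mulrfctE /=.
    rewrite /powR gt_eqF ?expR_gt0// expRK expRN mulrBl mul1r expRB.
    by rewrite -[RHS]mul1r -(divff (lt0r_neq0 (expR_gt0 u))); ring.
  - by apply: le_trans (_ : 0 <= _); rewrite ?oppr_le0.
  - by move=> x y _ _; rewrite ltr_expR.
  - by move=> x _; exact: continuous_expR.
  - by apply/cvg_ex; exists (expR (- N%:R)); exact/cvg_at_right_filter/continuous_expR.
  - by apply/cvg_ex; exists (expR N%:R); exact/cvg_at_left_filter/continuous_expR.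
  - split; first by move=> x _; exact: derivable_expR.
      exact/cvg_at_right_filter/continuous_expR.
    exact/cvg_at_left_filter/continuous_expR.
  - apply: continuous_in_subspaceT => t; rewrite inE/= in_itv/= => /andP[t0 _].
    have {}t0 : 0 < t by apply: lt_le_trans t0; exact: expR_gt0.
    apply: cvgM; last first.
      by apply: continuous_comp; [exact: opp_continuous|exact: continuous_expR].
    have dt : derivable (@powR R ^~ (p - 1)) t 1.
      by apply: derivable_powR; rewrite in_itv/= t0.
    have ct : {for t, continuous (@powR R ^~ (p - 1))}.
      exact/differentiable_continuous/derivable1_diffP.
    exact: ct.
have H1 := @ge0_nondecreasing_set_cvg_integral _ (measurableTypeR R) R
  (fun N => `[expR (- N%:R), expR N%:R]%classic) (EFin \o G) lam.
have H2 := @ge0_nondecreasing_set_cvg_integral _ (measurableTypeR R) R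
  (fun N => `[(- N%:R), N%:R]%classic) (EFin \o lg p 1) lam.
rewrite bigcup_itv_expR in H1; rewrite bigcup_itv_nat in H2.
apply: (cvg_unique _ (H1 _ _ _ _)) => //.
- apply/nondecreasing_seqP => N; apply/subsetPset => t /=; rewrite !in_itv/=.
  move=> /andP[h1 h2]; apply/andP; split.
    by apply: le_trans h1; rewrite ler_expR lerN2 ler_nat.
  by apply: le_trans h2 _; rewrite ler_expR ler_nat.
- by move=> N; apply/measurable_EFinP; exact: measurable_funTS.
- by move=> N x _; rewrite lee_fin.
apply: cvg_trans (H2 _ _ _ _).
- apply: near_eq_cvg; apply: nearW => N; exact/esym/S.
- apply/nondecreasing_seqP => N; apply/subsetPset => t /=; rewrite !in_itv/=.
  move=> /andP[h1 h2]; apply/andP; split.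
    by apply: le_trans h1; rewrite lerN2 ler_nat.
  by apply: le_trans h2 _; rewrite ler_nat.
- by move=> N; exact: measurable_itv.
- by move=> N; apply/measurable_EFinP; apply: measurable_funTS; exact: measurable_lg.
- by move=> N x _; rewrite lee_fin expR_ge0.
Qed.

Lemma GammaE p : Gamma p = \int[lam]_u lg p 1 u.
Proof. by rewrite /Gamma /Rintegral gamma_log. Qed.

(** The shift [u - ln r] normalises [r * expR u] to [expR u] and releases the factor
    [expR (- p * ln r)]. Stated in [\bar R], it transfers integrability from [r = 1] to every
    [r > 0]. *)
Lemma lg_subordination (p r : R) : 0 < r ->
  (\int[lam]_u (lg p r u)%:E = (r `^ (- p))%:E * \int[lam]_u (lg p 1 u)%:E)%E.
Proof.
move=> r0.
have mlg : measurable_fun setT (fun u => (lg p r u)%:E).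
  by apply/measurable_EFinP; exact: measurable_lg.
rewrite -(@ge0_integral_line_translation _ (- ln r) (fun u => (lg p r u)%:E))//.
  rewrite -ge0_integralZl//.
  - apply: eq_integral => u _; rewrite -EFinM; congr EFin.
    rewrite /lg /powR gt_eqF// -expRD; congr expR.
    rewrite expRB lnK ?posrE//; field.
    by rewrite gt_eqF.
  - by apply/measurable_EFinP; exact: measurable_lg.
  - by move=> u _; rewrite lee_fin expR_ge0.
  - by rewrite lee_fin powR_ge0.
by move=> u; rewrite lee_fin expR_ge0.
Qed.

Lemma expX_le_expR k (u : R) : 0 <= u -> u ^+ k <= k%:R ^+ k * expR u.
Proof.
case: k => [|k] u0; first by rewrite !expr0 mul1r -expR0 ler_expR.
rewrite -ler_pdivrMl ?exprn_gt0// -exprVn -exprMn.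
have -> : expR u = expR (k.+1%:R^-1 * u) ^+ k.+1.
  by rewrite -expRM_natl mulrA divff ?mul1r.
apply: lerXn2r; rewrite ?nnegrE ?mulr_ge0 ?expR_ge0//.
by apply: le_trans (expR_ge1Dx _); rewrite lerDr.
Qed.

Lemma lg_le_neg p u : lg p 1 u <= expR (p * u).
Proof. by rewrite /lg ler_expR mul1r lerBlDr lerDl expR_ge0. Qed.

(** From [expR u ^ k <= k ^ k * expR (expR u)]: since [p + 1 <= k], one spare factor [expR (- u)]
    remains, and it is integrable. *)
Lemma lg_le_pos (p : R) k (u : R) : p + 1 <= k%:R -> 0 <= u ->
  lg p 1 u <= k%:R ^+ k * expR (- (1 * u)).
Proof.
move=> pk u0; rewrite /lg mul1r expRB ler_pdivrMr ?expR_gt0//.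
rewrite mul1r mulrAC.
have -> : p * u = (p + 1) * u + - u by ring.
rewrite expRD ler_wpM2r ?expR_ge0//.
apply: le_trans (expX_le_expR k (expR_ge0 u)).
by rewrite -expRM_natl ler_expR ler_wpM2r.
Qed.

Lemma integral_lg_neg (p : R) : 0 < p ->
  (\int[lam]_(u in `]-oo, 0%R]) (lg p 1 u)%:E <= (p^-1)%:E)%E.
Proof.
move=> p0; rewrite -integral_expRNy//; apply: ge0_le_integral => //.
- by move=> u _; rewrite lee_fin expR_ge0.
- by apply/measurable_EFinP/measurable_funTS; exact: measurable_lg.
- apply/measurable_EFinP/measurable_funTS.
  exact: measurableT_comp.
- by move=> u _; rewrite lee_fin; exact: lg_le_neg.
Qed.

Lemma integral_lg_pos (p : R) k : p + 1 <= k%:R ->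
  (\int[lam]_(u in `[0%R, +oo[) (lg p 1 u)%:E <= (k%:R ^+ k)%:E)%E.
Proof.
move=> pk.
have mE : measurable_fun (`[0, +oo[%classic : set R) (fun u : R => expR (- (1 * u))).
  apply: measurable_funTS; apply: measurableT_comp => //.
  by apply: measurable_funN; exact: measurable_funM.
apply: (@le_trans _ _ (\int[lam]_(u in `[0%R, +oo[) ((k%:R ^+ k : R)%:E * (expR (- (1 * u)))%:E)))%E.
  apply: ge0_le_integral => //.
  - by move=> u _; rewrite lee_fin expR_ge0.
  - by apply/measurable_EFinP/measurable_funTS; exact: measurable_lg.
  - by apply: measurable_funeM; exact/measurable_EFinP.
  - move=> u /=; rewrite in_itv/= andbT => u0.
    by rewrite -EFinM lee_fin; exact: lg_le_pos.
rewrite ge0_integralZl//.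
- by rewrite integral_expRN// invr1 mule1.
- exact/measurable_EFinP.
Qed.

Lemma lg_split p : (\int[lam]_u (lg p 1 u)%:E =
  \int[lam]_(u in `]-oo, 0%R]) (lg p 1 u)%:E +
  \int[lam]_(u in `[0%R, +oo[) (lg p 1 u)%:E)%E.
Proof.
rewrite ge0_integral_line_split//.
  by apply/measurable_EFinP; exact: measurable_lg.
by move=> u; rewrite lee_fin expR_ge0.
Qed.

(** The half-line [u <= 0] contributes at most [p^-1], the pole of Gamma at [0]; the other half
    stays bounded for bounded [p]. *)
Lemma gamma_le (p : R) k : 0 < p -> p + 1 <= k%:R ->
  (\int[lam]_u (lg p 1 u)%:E <= (p^-1 + k%:R ^+ k)%:E)%E.
Proof.
move=> p0 pk; rewrite lg_split EFinD.
by apply: leeD; [exact: integral_lg_neg|exact: integral_lg_pos].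
Qed.

Lemma integrable_lg (p : R) : 0 < p -> lam.-integrable setT (EFin \o lg p 1).
Proof.
move=> p0; apply/integrableP; split.
  by apply/measurable_EFinP; exact: measurable_lg.
under eq_integral do rewrite /= ger0_norm ?expR_ge0//.
by apply: le_lt_trans (gamma_le p0 (ltW (truncnS_gt (p + 1)))) _; exact: ltry.
Qed.

Lemma gammaE_fin (p : R) : 0 < p -> (\int[lam]_u (lg p 1 u)%:E = (Gamma p)%:E)%E.
Proof.
move=> p0; rewrite GammaE /Rintegral fineK//.
exact: integrable_fin_num (integrable_lg p0).
Qed.

Lemma Gamma_le (p : R) k : 0 < p -> p + 1 <= k%:R -> Gamma p <= p^-1 + k%:R ^+ k.
Proof. by move=> p0 pk; rewrite -lee_fin -gammaE_fin//; exact: gamma_le. Qed.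

(** On [u <= 0] one has [exp(- e^u) >= 1 - e^u]; the loss is the integral of [expR ((p + 1) * u)],
    which is [(p + 1)^-1 <= 1]. *)
Lemma Gamma_ge (p : R) : 0 < p -> p^-1 - 1 <= Gamma p.
Proof.
move=> p0; rewrite -lee_fin -gammaE_fin// lg_split.
apply: (@le_trans _ _ (\int[lam]_(u in `]-oo, 0%R]) (lg p 1 u)%:E)%E); last first.
  by rewrite leeDl// integral_ge0// => u _; rewrite lee_fin expR_ge0.
have mexp c : measurable_fun (`]-oo, 0]%classic : set R) (fun u : R => (expR (c * u))%:E).
  by apply/measurable_EFinP/measurable_funTS; exact: measurableT_comp.
rewrite EFinB leeBlDr//.
apply: (@le_trans _ _ (\int[lam]_(u in `]-oo, 0%R]) (lg p 1 u)%:E +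
   \int[lam]_(u in `]-oo, 0%R]) (expR ((p + 1) * u))%:E)%E); last first.
  apply: leeD => //; rewrite integral_expRNy ?addr_gt0// lee_fin.
  by rewrite invf_le1 ?addr_gt0// lerDr ltW.
rewrite -integral_expRNy// -ge0_integralD//=.
- apply: ge0_le_integral => //; first exact: mexp.
  + apply: emeasurable_funD; last exact: mexp.
    by apply/measurable_EFinP/measurable_funTS; exact: measurable_lg.
  + move=> u _; rewrite -EFinD lee_fin /lg mul1r expRD mulrDl expRD mul1r -mulrDr.
    rewrite -[leLHS]mulr1 ler_wpM2l ?expR_ge0//.
    by have := expR_ge1Dx (- expR u); lra.
- by move=> u _; rewrite lee_fin expR_ge0.
- by apply/measurable_EFinP/measurable_funTS; exact: measurable_lg.
- exact: mexp.
Qed.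

(** On [[0, 1]] the integrand is at least [expR (- expR 1)]. *)
Lemma Gamma_gt0 (p : R) : 0 < p -> 0 < Gamma p.
Proof.
move=> p0; rewrite -lte_fin -gammaE_fin//.
have I : (0 < \int[lam]_(u in `[0%R, 1%R]) (cst (expR (- expR 1))%:E u))%E.
  rewrite integral_cst//. rewrite /= lebesgue_measure_itv/= lte01 oppr0 adde0 mule1.
  by rewrite lte_fin expR_gt0.
apply: lt_le_trans I _.
apply: (@le_trans _ _ (\int[lam]_(u in `[0%R, 1%R]) (lg p 1 u)%:E)%E).
  apply: ge0_le_integral => //.
  - by move=> u _; rewrite lee_fin expR_ge0.
  - by apply/measurable_EFinP/measurable_funTS; exact: measurable_lg.
  - move=> u /=; rewrite in_itv/= => /andP[u0 u1]; rewrite lee_fin /lg ler_expR mul1r.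
    have : expR u <= expR 1 by rewrite ler_expR.
    have : 0 <= p * u by rewrite mulr_ge0// ltW.
    lra.
apply: ge0_subset_integral => //.
- by apply/measurable_EFinP; exact: measurable_lg.
- by move=> u _; rewrite lee_fin expR_ge0.
Qed.

(** A quantitative form of the behaviour [1 / e] of Gamma at [0]. The constant [4] is [2 ^+ 2], from
    [Gamma_le] with [k = 2], which is allowed since [e + 1 <= 2]. *)
Lemma mul_Gamma_dist (e : R) : 0 < e -> e <= 1 -> `|e * Gamma e - 1| <= 4 * e.
Proof.
move=> e0 e1.
have H1 := Gamma_ge e0.
have H2 : Gamma e <= e^-1 + 2 ^+ 2 by apply: (@Gamma_le _ 2) => //; lra.
have ee : e * e^-1 = 1 by rewrite divff// gt_eqF.
have h1 : e * e^-1 - e <= e * Gamma e.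
  by rewrite -[X in _ - X]mulr1 -mulrBr (ler_wpM2l (ltW e0)).
have h2 : e * Gamma e <= e * e^-1 + e * 4.
  by rewrite -mulrDr (ler_wpM2l (ltW e0))//; apply: le_trans H2 _; rewrite lerD2l expr2; lra.
by rewrite ler_norml; apply/andP; split; lra.
Qed.

End gamma.

Section euclidean_norm.
Context {R : realType} {n : nat}.
Implicit Types (z : 'rV[R]_n) (s : R).

Lemma dotrr_ge0 z : 0 <= dotr z z.
Proof. by apply: sumr_ge0 => i _; rewrite -expr2 sqr_ge0. Qed.

Lemma enorm_ge0 z : 0 <= enorm z.
Proof. exact: sqrtr_ge0. Qed.

Lemma enorm_sqr z : enorm z ^+ 2 = dotr z z.
Proof. by rewrite sqr_sqrtr// dotrr_ge0. Qed.

Lemma coord_le_enorm z i : `|z 0 i| <= enorm z.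
Proof.
rewrite -sqrtr_sqr ler_sqrt ?dotrr_ge0// /dotr (bigD1 i)//= -expr2 lerDl.
by apply: sumr_ge0 => j _; rewrite -expr2 sqr_ge0.
Qed.

Lemma dotrr_eq0 z : (dotr z z == 0) = (z == 0).
Proof.
apply/eqP/eqP => [z0|->]; last first.
  by rewrite /dotr big1// => i _; rewrite mxE mul0r.
apply/rowP => i; rewrite mxE; apply/eqP; rewrite -normr_le0.
by apply: le_trans (coord_le_enorm z i) _; rewrite /enorm z0 sqrtr0.
Qed.

Lemma sum_coord_le_enorm z : \sum_i `|z 0 i| <= n%:R * enorm z.
Proof.
apply: le_trans (_ : \sum_(i < n) enorm z <= _).
  by apply: ler_sum => i _; exact: coord_le_enorm.
by rewrite sumr_const card_ord mulr_natl.
Qed.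

Lemma measurable_dotrr : measurable_fun setT (fun z : 'rV[R]_n => dotr z z).
Proof. by apply: measurable_dotr. Qed.

End euclidean_norm.

(** * Gaussian moments on [R^n] *)

Section gauss_rV.
Context {R : realType} {n : nat}.
Local Notation mu := (lebesgue_rV R n).
Implicit Types (z : 'rV[R]_n) (s : R).

Definition expq s z : R := expR (- (s * dotr z z)).

Lemma expq_ge0 s z : 0 <= expq s z. Proof. exact: expR_ge0. Qed.

Lemma expq_prod s z : expq s z = \prod_i expR (- (s * z 0 i ^+ 2)).
Proof.
rewrite /expq -expR_sum; congr expR.
rewrite /dotr mulr_sumr -sumrN.
by apply: eq_bigr => i _; rewrite expr2.
Qed.

Lemma gauss_rV s : 0 < s -> mu.-integrable setT (EFin \o expq s) /\
  \int[mu]_z expq s z = Num.sqrt (pi / s) ^+ n.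
Proof.
move=> s0.
have -> : expq s = (fun z => \prod_i expR (- (s * z 0 i ^+ 2))).
  by apply/funext => z; exact: expq_prod.
have [H ->] := @integral_prod_coord R n (fun _ t => expR (- (s * t ^+ 2)))
  (fun _ => (gauss_line s0).1).
split; first exact: H.
by rewrite prodr_const card_ord (gauss_line s0).2.
Qed.

(** Off the diagonal a first moment, hence [0], appears as a factor. This isotropy is what makes the
    limit of the kernel pairing pick out exactly one component of the gradient. *)
Lemma gauss_rV2 s i j : 0 < s ->
  mu.-integrable setT (EFin \o (fun z => z 0 i * z 0 j * expq s z)) /\
  \int[mu]_z (z 0 i * z 0 j * expq s z) =
    (i == j)%:R * (Num.sqrt (pi / s) ^+ n / (2 * s)).
Proof.
move=> s0.
pose h (k : 'I_n) (t : R) := (if k == i then t else 1) * (if k == j then t else 1) *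
  expR (- (s * t ^+ 2)).
have E : (fun z => z 0 i * z 0 j * expq s z) = (fun z => \prod_k h k (z 0 k)).
  apply/funext => z; rewrite expq_prod /h !big_split /=; congr (_ * _ * _).
    by rewrite (bigD1 i)//= eqxx big1 ?mulr1// => k /negbTE ->.
  by rewrite (bigD1 j)//= eqxx big1 ?mulr1// => k /negbTE ->.
have ih k : (@lebesgue_measure R).-integrable setT (EFin \o h k).
  rewrite /h; case: eqP => _; case: eqP => _.
  - by have := (gauss_line2 s0).1; under eq_fun do rewrite expr2.
  - by under eq_fun do rewrite mulr1; exact: (gauss_line1 s0).1.
  - by under eq_fun do rewrite mul1r; exact: (gauss_line1 s0).1.
  - by under eq_fun do rewrite !mul1r; exact: (gauss_line s0).1.
have [H HE] := @integral_prod_coord R n h ih.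
rewrite E; split; first exact: H.
rewrite HE (bigD1 i)//= {1}/h eqxx.
have [ij|ij] := eqVneq i j; last first.
  rewrite mul0r.
  under eq_Rintegral do rewrite mulr1.
  by rewrite (gauss_line1 s0).2 mul0r.
rewrite mul1r.
under eq_Rintegral do rewrite -expr2.
rewrite (gauss_line2 s0).2 (eq_bigr (fun=> Num.sqrt (pi / s))); last first.
  move=> k ki; rewrite /h -ij (negbTE ki).
  by under eq_Rintegral do rewrite !mul1r; exact: (gauss_line s0).2.
rewrite prodr_const mulrAC -exprS; congr (_ ^+ _ / _).
have -> : #|(fun k : 'I_n => k != i)| = n.-1 by rewrite -[in RHS](card_ord n) -(cardC1 i).
by rewrite prednK// (leq_ltn_trans _ (ltn_ord i)).
Qed.

(** This and the next two bounds absorb powers [1], [2], [3] of the rescaled norm into half a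
    Gaussian: they serve the range [u < 0], the range [u >= 0], and the quadratic remainder on
    [u >= 0]. *)
Lemma le1_expR_sqr (y : R) : y <= expR (y ^+ 2 / 2).
Proof.
apply: le_trans (expR_ge1Dx _); have := sqr_ge0 (y - 1); rewrite sqrrB expr1n mulr1.
lra.
Qed.

Lemma le2_expR_sqr (y : R) : y ^+ 2 <= 2 * expR (y ^+ 2 / 2).
Proof. by have := expR_ge1Dx (y ^+ 2 / 2); lra. Qed.

Lemma le3_expR_sqr (y : R) : 0 <= y -> y ^+ 3 <= 4 * expR (y ^+ 2 / 2).
Proof.
move=> y0.
have -> : expR (y ^+ 2 / 2) = expR (y ^+ 2 / 4) ^+ 2.
  by rewrite -expRM_natl; congr expR; field.
have h := expR_ge1Dx (y ^+ 2 / 4).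
have h2 : (1 + y ^+ 2 / 4) ^+ 2 <= expR (y ^+ 2 / 4) ^+ 2.
  by rewrite lerXn2r// nnegrE ?expR_ge0// addr_ge0// divr_ge0// sqr_ge0.
apply: (@le_trans _ _ (4 * (1 + y ^+ 2 / 4) ^+ 2)); last by rewrite ler_wpM2l.
have := sqr_ge0 (y - y ^+ 2 / 2); have := sqr_ge0 y.
rewrite -[y ^+ 3]/(y * (y * y)) -![y ^+ 2]/(y * y).
nra.
Qed.

(** The hypothesis is used at [y = expR (u / 2) * enorm z], for which [expR (- (y ^+ 2 / 2))] is
    precisely half of the Gaussian; each power of the norm costs [expR (- (u / 2))]. *)
Lemma expq_le k (u C : R) z : 0 <= C ->
  (forall y, 0 <= y -> y ^+ k <= C * expR (y ^+ 2 / 2)) ->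
  enorm z ^+ k * expq (expR u) z <= C * expR (- (k%:R * u / 2)) * expq (expR u / 2) z.
Proof.
move=> C0 H.
have := H (expR (u / 2) * enorm z) (mulr_ge0 (expR_ge0 _) (enorm_ge0 _)).
rewrite !exprMn enorm_sqr -!expRM_natl.
have -> : 2 * (u / 2) = u by field.
have -> : k%:R * (u / 2) = k%:R * u / 2 by field.
have -> : expq (expR u) z = expq (expR u / 2) z * expq (expR u / 2) z.
  by rewrite /expq -expRD; congr expR; field.
move=> H1; rewrite mulrA ler_wpM2r ?expq_ge0//.
have -> : expq (expR u / 2) z = (expR (expR u * dotr z z / 2))^-1.
  by rewrite /expq -expRN; congr expR; field.
rewrite ler_pdivrMr ?expR_gt0// expRN mulrAC ler_pdivlMr ?expR_gt0//.
by rewrite mulrC.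
Qed.

(** The mass of the Gaussian [expq (1 / 2)] that is left once half of the exponent has been spent on
    polynomial factors. *)
Definition gauss_cst : R := Num.sqrt (2 * pi) ^+ n.

Lemma sqrt_pi_expR (c u : R) : 0 <= c ->
  Num.sqrt (c / expR u) ^+ n = Num.sqrt c ^+ n * expR (- (n%:R * u / 2)).
Proof.
move=> c0; rewrite sqrtrM// exprMn; congr (_ * _).
rewrite -expRN.
have -> : expR (- u) = expR (- u / 2) ^+ 2.
  by rewrite -expRM_natl; congr expR; field.
rewrite sqrtr_sqr ger0_norm ?expR_ge0// -expRM_natl; congr expR.
by field.
Qed.

Lemma integral_expq_half (u : R) :
  \int[mu]_z expq (expR u / 2) z = gauss_cst * expR (- (n%:R * u / 2)).
Proof.
rewrite (gauss_rV _).2 ?divr_gt0 ?expR_gt0//.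
rewrite -sqrt_pi_expR ?mulr_ge0 ?pi_ge0//; congr (Num.sqrt _ ^+ _).
by field; rewrite gt_eqF// expR_gt0.
Qed.

End gauss_rV.

(** * The kernel of the fractional gradient *)

Section two_sided_exponential.
Context {R : realType}.
Local Notation lam := (@lebesgue_measure R).

(** The majorant for the [u]-integrals below: the decay at [-oo] and the decay at [+oo] come from
    different bounds on the weight, hence two rates. *)
Definition wexp (c d u : R) : R := if u < 0 then expR (c * u) else expR (- (d * u)).

Lemma wexp_ge0 c d u : 0 <= wexp c d u.
Proof. by rewrite /wexp; case: ifP => _; exact: expR_ge0. Qed.

Lemma measurable_fun_ltr0 (f g : R -> R) : measurable_fun setT f -> measurable_fun setT g ->
  measurable_fun setT (fun u : R => if u < 0 then f u else g u).
Proof.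
move=> mf mg; apply: measurable_fun_ifT => //.
exact: measurable_fun_ltr.
Qed.

Lemma measurable_wexp c d : measurable_fun setT (wexp c d).
Proof.
apply: measurable_fun_ltr0.
  by apply: measurableT_comp => //; exact: measurable_funM.
apply: measurableT_comp => //; apply: measurable_funN; exact: measurable_funM.
Qed.

Lemma integral_ltr0 (f g : R -> R) (A B : \bar R) :
  measurable_fun setT f -> measurable_fun setT g ->
  (forall u, 0 <= f u) -> (forall u, 0 <= g u) ->
  (\int[lam]_(u in `]-oo, 0%R]) (f u)%:E = A)%E ->
  (\int[lam]_(u in `[0%R, +oo[) (g u)%:E = B)%E ->
  (\int[lam]_u (if (u < 0)%R then f u else g u)%:E = A + B)%E.
Proof.
move=> mf mg f0 g0 fA gB.
rewrite ge0_integral_line_split; first last.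
- by move=> u; rewrite lee_fin; case: ifP.
- by apply/measurable_EFinP; exact: measurable_fun_ltr0.
congr (_ + _)%E.
  rewrite -fA -!integral_itv_bndo_bndc; first last.
  - by apply/measurable_EFinP/measurable_funTS; exact: measurable_fun_ltr0.
  - exact/measurable_EFinP/measurable_funTS.
  apply: eq_integral => u; rewrite inE/= in_itv/= => ->.
  by [].
rewrite -gB; apply: eq_integral => u; rewrite inE/= in_itv/= andbT => u0.
by rewrite ltNge u0.
Qed.

Lemma integral_wexp c d : 0 < c -> 0 < d ->
  (\int[lam]_u (wexp c d u)%:E = (c^-1 + d^-1)%:E)%E.
Proof.
move=> c0 d0; rewrite EFinD; apply: integral_ltr0.
- by apply: measurableT_comp => //; exact: measurable_funM.
- by apply: measurableT_comp => //; apply: measurable_funN; exact: measurable_funM.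
- by move=> u; exact: expR_ge0.
- by move=> u; exact: expR_ge0.
- exact: integral_expRNy.
- exact: integral_expRN.
Qed.

Lemma integrable_wexp c d : 0 < c -> 0 < d ->
  lam.-integrable setT (EFin \o wexp c d).
Proof.
move=> c0 d0; apply/integrableP; split.
  by apply/measurable_EFinP; exact: measurable_wexp.
under eq_integral do rewrite /= ger0_norm ?wexp_ge0//.
by rewrite integral_wexp// ltry.
Qed.

Lemma Rintegral_wexp c d : 0 < c -> 0 < d ->
  \int[lam]_u wexp c d u = c^-1 + d^-1.
Proof. by move=> c0 d0; rewrite /Rintegral integral_wexp. Qed.

End two_sided_exponential.

(** * Subordination of the kernel to Gaussians *)

Section kernel.
Context {R : realType} {n : nat}.
Local Notation lam := (@lebesgue_measure R).
Local Notation mu := (lebesgue_rV R n).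
Implicit Types (z : 'rV[R]_n) (u : R) (i : 'I_n) (w : 'rV[R]_n -> R).

(* [div^a phi x] is the sum over [i] of the integrals of
   [(phi_i (x + z) - phi_i x) * frac_kernel a i z]. *)
Definition frac_kernel (a : R) i z : R :=
  frac_cst n a * (z 0 i / enorm z `^ (n%:R + a + 1)).

(* The factor [1 / Gamma ((1 - a) / 2)] vanishes like [(1 - a) / 2] as [a] tends to [1];
   it compensates the growth of the [u]-integrals of [heat_kernel]. *)
Definition heat_cst (a : R) : R :=
  2 `^ a * pi `^ (- (n%:R / 2)) / Gamma ((1 - a) / 2).

Local Notation lg := log_gamma_integrand.

(* Bochner subordination: [frac_kernel a i z] is [heat_cst a] times the integral over [u] of
   the Gaussian [z_i * expR (p * u - expR u * |z|^2)], where [p = (n + a + 1) / 2]. *)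
Definition heat_kernel (a : R) i z u : R :=
  z 0 i * lg ((n%:R + a + 1) / 2) (dotr z z) u.

Lemma lgE p z u : lg p (dotr z z) u = expR (p * u) * expq (expR u) z.
Proof. by rewrite /lg /log_gamma_integrand /expq -expRD mulrC [expR u * _]mulrC. Qed.

Lemma integrable_lg_scaled (p r : R) : 0 < p -> 0 < r ->
  lam.-integrable setT (EFin \o lg p r) /\ \int[lam]_u lg p r u = r `^ (- p) * Gamma p.
Proof.
move=> p0 r0; have E := @lg_subordination R p r r0.
rewrite gammaE_fin// -EFinM in E; split; last by rewrite /Rintegral E.
apply/integrableP; split; first by apply/measurable_EFinP; exact: measurable_lg.
under eq_integral do rewrite /= ger0_norm ?expR_ge0//.
by rewrite E ltry.
Qed.

Lemma enorm_powR z (q : R) : q != 0 -> enorm z `^ q = dotr z z `^ (q / 2).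
Proof.
by move=> q0; rewrite /enorm -powR12_sqrt ?dotrr_ge0// -powRrM mulrC.
Qed.

Variables (a : R).
Hypotheses (a0 : 0 < a) (a1 : a < 1).

Let n0 : 0 <= n%:R :> R. Proof. exact: ler0n. Qed.

Let p := (n%:R + a + 1) / 2.
Let p0 : 0 < p. Proof. by rewrite divr_gt0// addr_gt0// ltr_wpDl. Qed.

Lemma heat_cst_gt0 : 0 < heat_cst a.
Proof.
rewrite /heat_cst divr_gt0 ?mulr_gt0 ?powR_gt0 ?pi_gt0//.
by apply: Gamma_gt0; rewrite divr_gt0// subr_gt0.
Qed.

Lemma heat_kernel_line z i (c : R) :
  lam.-integrable setT (EFin \o (fun u => c * heat_kernel a i z u)) /\
  heat_cst a * \int[lam]_u (c * heat_kernel a i z u) = c * frac_kernel a i z.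
Proof.
(* This case contains [z = 0], where [lg] is not integrable in [u]; the factor [z 0 i] makes both
   sides vanish. *)
rewrite /heat_kernel -/p; have [z0|z0] := eqVneq (z 0 i) 0.
  have -> : (fun u => c * (z 0 i * lg p (dotr z z) u)) = cst 0.
    by apply/funext => u; rewrite z0 mul0r mulr0.
  split; first exact: integrable0.
  rewrite /frac_kernel z0 !(mul0r,mulr0) (_ : Rintegral _ _ _ = 0) ?mulr0//.
  by rewrite Rintegral_cst// mul0r.
have q0 : 0 < dotr z z.
  rewrite lt_def dotrr_ge0 andbT dotrr_eq0; apply: contra_neq z0 => ->.
  by rewrite mxE.
have [il El] := integrable_lg_scaled p0 q0.
have E : (fun u => c * (z 0 i * lg p (dotr z z) u)) = (fun u => (c * z 0 i) * lg p (dotr z z) u).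
  by apply/funext => u; rewrite mulrA.
rewrite E; split; first exact: integrableRZ.
rewrite RintegralZl// El /frac_kernel /frac_cst /heat_cst -/p.
rewrite enorm_powR; last by rewrite gt_eqF// addr_gt0// ltr_wpDl.
rewrite -/p powRN; ring.
Qed.

Lemma measurable_heat_kernel i w : measurable_fun setT w ->
  measurable_fun setT (fun x : 'rV[R]_n * measurableTypeR R => w x.1 * heat_kernel a i x.1 x.2).
Proof.
move=> mw; apply: measurable_funM; first exact: measurableT_comp.
apply: measurable_funM.
  exact: (measurableT_comp (@measurable_coord_rV R n i) measurable_fst).
apply: measurableT_comp => //; apply: measurable_funB.
  by apply: measurable_funM.
apply: measurable_funM.
  exact: (measurableT_comp (@measurable_dotrr R n) measurable_fst).
exact: measurableT_comp.
Qed.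

Section bounded_weight.
Variables (w : 'rV[R]_n -> R) (C : R) (i : 'I_n).
Hypotheses (mw : measurable_fun setT w) (C0 : 0 <= C).
Hypotheses (wC : forall z, `|w z| <= C) (wC1 : forall z, `|w z| <= C * enorm z).

Let B u : R := 2 * C * expR (p * u) * (if u < 0 then expR (- (u / 2)) else expR (- u)).

(** For [u < 0] the uniform bound on [w] leaves one power of the norm. For [u >= 0] the linear bound
    supplies a second one, and with it the additional decay in [u] that large [u] requires. *)
Lemma heat_kernel_le u z :
  `|w z * heat_kernel a i z u| <= B u * expq (expR u / 2) z.
Proof.
rewrite /heat_kernel -/p lgE /B !normrM.
rewrite (ger0_norm (expq_ge0 _ _)) (ger0_norm (expR_ge0 _)).
have zi := coord_le_enorm z i.
have e0 := expq_ge0 (expR u) z; have e20 := expq_ge0 (expR u / 2) z.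
have E0 := expR_ge0 (p * u); have x0 := enorm_ge0 z.
rewrite [leLHS](_ : _ = expR (p * u) * (`|w z| * `|z 0 i| * expq (expR u) z)); last by ring.
rewrite [leRHS](_ : _ = expR (p * u) * (C * (2 *
   (if u < 0 then expR (- (u / 2)) else expR (- u)) * expq (expR u / 2) z))); last by ring.
rewrite ler_wpM2l//.
case: ifPn => u0.
  have := @expq_le R n 1 u 1 z ler01.
  rewrite expr1 !mul1r => /(_ _) H.
  have {}H : enorm z * expq (expR u) z <= expR (- (u / 2)) * expq (expR u / 2) z.
    by apply: H => y _; rewrite expr1 mul1r; exact: le1_expR_sqr.
  apply: (@le_trans _ _ (C * (enorm z * expq (expR u) z))).
    by rewrite mulrA ler_wpM2r// ler_pM.
  rewrite ler_wpM2l//; apply: le_trans H _.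
  by rewrite -mulrA ler_peMl ?mulr_ge0 ?expR_ge0// ler1n.
have := @expq_le R n 2 u 2 z (ler0n _ _).
move=> /(_ (fun y _ => le2_expR_sqr y)) H.
apply: (@le_trans _ _ (C * (enorm z ^+ 2 * expq (expR u) z))).
  by rewrite mulrA ler_wpM2r// expr2 mulrA ler_pM.
rewrite ler_wpM2l//; apply: le_trans H _.
by have -> : 2 * u / 2 = u by field.
Qed.

(** The rates come from [(n + a + 1) / 2 - 1 / 2 - n / 2 = a / 2] and [(n + a + 1) / 2 - 1 - n / 2 =
    - (1 - a) / 2]; both are positive exactly when [0 < a < 1]. *)
Lemma heat_bound_wexp u :
  B u * (@gauss_cst R n * expR (- (n%:R * u / 2))) =
  2 * C * @gauss_cst R n * wexp (a / 2) ((1 - a) / 2) u.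
Proof.
rewrite /B /wexp; case: ifPn => _.
  rewrite [LHS](_ : _ = 2 * C * @gauss_cst R n *
    (expR (p * u) * expR (- (u / 2)) * expR (- (n%:R * u / 2)))); last by ring.
  by congr (_ * _); rewrite -!expRD; congr expR; rewrite /p; field.
rewrite [LHS](_ : _ = 2 * C * @gauss_cst R n *
  (expR (p * u) * expR (- u) * expR (- (n%:R * u / 2)))); last by ring.
by congr (_ * _); rewrite -!expRD; congr expR; rewrite /p; field.
Qed.

Lemma heat_kernel_slice u :
  mu.-integrable setT (EFin \o (fun z => w z * heat_kernel a i z u)) /\
  \int[mu]_z `|w z * heat_kernel a i z u| <=
    2 * C * @gauss_cst R n * wexp (a / 2) ((1 - a) / 2) u.
Proof.
have s0 : 0 < expR u / 2 by rewrite divr_gt0// expR_gt0.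
have iB := integrableRZ (B u) (gauss_rV (n:=n) s0).1.
have iw : mu.-integrable setT (EFin \o (fun z => w z * heat_kernel a i z u)).
  apply: integrable_le iB; last by move=> z; exact: heat_kernel_le.
  have := measurableT_comp (measurable_heat_kernel i mw)
    (@measurable_pair2 _ _ 'rV[R]_n (measurableTypeR R) u).
  exact.
split => //; rewrite -heat_bound_wexp -integral_expq_half -RintegralZl//; last first.
  exact: (gauss_rV s0).1.
apply: le_Rintegral => //; first exact: integrable_norm.
by move=> z _; exact: heat_kernel_le.
Qed.

Lemma integrable_heat_kernel :
  (mu \x lam)%E.-integrable setT (EFin \o (fun x : 'rV[R]_n * measurableTypeR R =>
    w x.1 * heat_kernel a i x.1 x.2)).
Proof.
apply/integrable21ltyP.
  by apply/measurable_EFinP; exact: measurable_heat_kernel.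
apply: (@le_lt_trans _ _ (\int[lam]_u
  (2 * C * @gauss_cst R n * wexp (a / 2) ((1 - a) / 2) u)%:E)%E).
  apply: ge0_le_integral => //.
  - by move=> u _; apply: integral_ge0.
  - apply: (measurable_fun_fubini_tonelli_G
      (abse \o (EFin \o (fun x : 'rV[R]_n * measurableTypeR R => w x.1 * heat_kernel a i x.1 x.2)))) => //=.
    apply: measurableT_comp => //.
    by apply/measurable_EFinP; exact: measurable_heat_kernel.
  - apply/measurable_EFinP; apply: measurable_funM => //.
    exact: measurable_wexp.
  - move=> u _; have [iw H] := heat_kernel_slice u.
    rewrite -lee_fin in H; apply: le_trans H.
    rewrite /Rintegral fineK//.
    exact: integrable_fin_num (integrable_norm iw).
under eq_integral do rewrite EFinM.
have w0 : 0 <= 2 * C * @gauss_cst R n by rewrite !mulr_ge0// exprn_ge0// sqrtr_ge0.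
rewrite ge0_integralZl//.
- by rewrite integral_wexp ?divr_gt0 ?subr_gt0// -EFinM ltry.
- by apply/measurable_EFinP; exact: measurable_wexp.
- by move=> u _; rewrite lee_fin wexp_ge0.
Qed.

(** Fubini replaces the singular integral in [z] by a [u]-integral of Gaussian pairings. Its first
    half is also what later provides the absolute convergence of integrals against the kernel. *)
Lemma frac_kernel_heat :
  mu.-integrable setT (EFin \o (fun z => w z * frac_kernel a i z)) /\
  \int[mu]_z (w z * frac_kernel a i z) =
    heat_cst a * \int[lam]_u \int[mu]_z (w z * heat_kernel a i z u).
Proof.
have ih := integrable_heat_kernel.
have EE : (fun z => w z * frac_kernel a i z) =
    (fun z => heat_cst a * \int[lam]_u (w z * heat_kernel a i z u)).
  by apply/funext => z; rewrite (heat_kernel_line z i (w z)).2.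
have iI : mu.-integrable setT (EFin \o (fun z => \int[lam]_u (w z * heat_kernel a i z u))).
  exact: integrable_Rintegral1 ih.
rewrite EE; split; first exact: integrableRZ.
rewrite RintegralZl//; congr (_ * _).
exact: Rintegral_fubini ih.
Qed.

Lemma integrable_heat_time :
  lam.-integrable setT (EFin \o (fun u => \int[mu]_z (w z * heat_kernel a i z u))).
Proof. exact: integrable_Rintegral2 integrable_heat_kernel. Qed.

(** The last factor is the total mass of the majorant [wexp (a / 2) ((1 - a) / 2)]. *)
Lemma frac_kernel_bound :
  `|\int[mu]_z (w z * frac_kernel a i z)| <=
   heat_cst a * (2 * C * @gauss_cst R n * (2 / a + 2 / (1 - a))).
Proof.
rewrite frac_kernel_heat.2 normrM (gtr0_norm heat_cst_gt0) (ler_wpM2l (ltW heat_cst_gt0))//.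
have iw : lam.-integrable setT (EFin \o wexp (a / 2) ((1 - a) / 2)).
  by apply: integrable_wexp; rewrite divr_gt0// subr_gt0.
have -> : 2 / a + 2 / (1 - a) = \int[lam]_u wexp (a / 2) ((1 - a) / 2) u.
  by rewrite Rintegral_wexp ?divr_gt0 ?subr_gt0// !invf_div.
rewrite -RintegralZl//.
apply: le_trans (le_normr_Rintegral measurableT integrable_heat_time) _.
apply: le_Rintegral => //.
- exact: integrable_norm integrable_heat_time.
- exact: integrableRZ.
- move=> u _; have [iu Hu] := heat_kernel_slice u.
  exact: le_trans (le_normr_Rintegral measurableT iu) Hu.
Qed.

End bounded_weight.
End kernel.

(** * Kernel pairings of weights with a linear expansion at the origin *)

Section kernel_limit.
Context {R : realType} {n : nat}.
Local Notation lam := (@lebesgue_measure R).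
Local Notation mu := (lebesgue_rV R n).
Local Notation gc := (@gauss_cst R n).
Variables (w : 'rV[R]_n -> R) (C : R) (G : 'I_n -> R).
Hypotheses (mw : measurable_fun setT w) (C0 : 0 <= C).
Hypotheses (wC : forall z, `|w z| <= C) (wC1 : forall z, `|w z| <= C * enorm z).
Hypothesis wG : forall z, `|w z - \sum_j G j * z 0 j| <= C * dotr z z.

Let m (i : 'I_n) : R := G i * (Num.sqrt pi ^+ n / 2).

(** The contribution of the linear part of [w]. It is cut off at [u < 0], where the exponential is
    not integrable; there the whole pairing is counted as remainder. *)
Let mainterm (a : R) (i : 'I_n) (u : R) : R := if u < 0 then 0 else m i * expR (- ((1 - a) / 2 * u)).

(** Second moments kill the terms [j != i], and the exponents of [expR u] add up to [(n + a + 1) / 2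
    - n / 2 - 1 = - (1 - a) / 2]. *)
Lemma heat_kernel_linear (a : R) (i : 'I_n) (u : R) : 0 < a ->
  mu.-integrable setT (EFin \o (fun z : 'rV[R]_n => (\sum_j G j * z 0 j) * heat_kernel a i z u)) /\
  \int[mu]_z ((\sum_j G j * z 0 j) * heat_kernel a i z u) =
    m i * expR (- ((1 - a) / 2 * u)).
Proof.
move=> a0; pose e := expR ((n%:R + a + 1) / 2 * u).
have E : (fun z : 'rV[R]_n => (\sum_j G j * z 0 j) * heat_kernel a i z u) =
    (fun z : 'rV[R]_n => \sum_j (e * G j) * (z 0 i * z 0 j * expq (expR u) z)).
  apply/funext => z; rewrite /heat_kernel lgE -/e mulr_suml.
  by apply: eq_bigr => j _; ring.
have s0 : 0 < expR u by exact: expR_gt0.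
have [S1 S2] := @Rintegral_lincomb _ _ _ mu _ (index_enum 'I_n) (fun j => e * G j)
  (fun j (z : 'rV[R]_n) => z 0 i * z 0 j * expq (expR u) z) (fun j => (gauss_rV2 i j s0).1).
rewrite E; split; first exact: S1.
rewrite S2 (bigD1 i)//= [X in _ + X]big1 ?addr0 => [|j ji].
  rewrite (gauss_rV2 i i s0).2 eqxx mul1r sqrt_pi_expR ?pi_ge0// /m.
  have -> : expR (- ((1 - a) / 2 * u)) = e * expR (- (n%:R * u / 2)) * expR (- u).
    by rewrite /e -!expRD; congr expR; move: (n%:R : R) => N; field.
  rewrite (expRN u); set E1 := expR (- _); set P := Num.sqrt pi ^+ n.
  by field; rewrite gt_eqF.
by rewrite (gauss_rV2 i j s0).2 eq_sym (negbTE ji) mul0r mulr0.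
Qed.

Section fixed_order.
Variables (a : R) (i : 'I_n).
Hypotheses (a0 : 0 < a) (a1 : a < 1).

(** For [u >= 0] the quadratic remainder brings a third power of the norm, so the exponent becomes
    [a / 2 - 1 <= - 1 / 2]: the decay no longer degenerates as [a] tends to [1]. For [u < 0] the
    crude bound of [heat_kernel_slice] is enough. *)
Lemma heat_kernel_remainder u :
  `|\int[mu]_z (w z * heat_kernel a i z u) - mainterm a i u| <=
  4 * C * gc * wexp (a / 2) (2^-1) u.
Proof.
have gc0 : 0 <= gc by rewrite exprn_ge0// sqrtr_ge0.
have [iw Hw] := heat_kernel_slice a i mw C0 wC wC1 u.
rewrite /mainterm; case: ifPn => u0.
  rewrite subr0; apply: le_trans (le_normr_Rintegral measurableT iw) _.
  apply: le_trans Hw _; rewrite /wexp u0 ler_wpM2r ?expR_ge0//.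
  by rewrite ler_wpM2r// ler_wpM2r//; lra.
have [il El] := heat_kernel_linear i u a0.
rewrite -El -RintegralB//.
apply: le_trans (le_normr_Rintegral measurableT (integrableRB iw il)) _.
pose e := expR ((n%:R + a + 1) / 2 * u).
pose B := e * (C * (4 * expR (- (3 * u / 2)))).
have s0 : 0 < expR u / 2 by rewrite divr_gt0// expR_gt0.
apply: (@le_trans _ _ (\int[mu]_z (B * expq (expR u / 2) z))).
  apply: le_Rintegral => //.
  - exact: integrable_norm (integrableRB iw il).
  - apply: integrableRZ; exact: (gauss_rV s0).1.
  - move=> z _; rewrite -mulrBl normrM /heat_kernel lgE -/e /B normrM.
    rewrite normrM (ger0_norm (expq_ge0 _ _)) (ger0_norm (expR_ge0 _ : 0 <= e)).
    rewrite [leLHS](_ : _ = e * (`|w z - \sum_j G j * z 0 j| * `|z 0 i| * expq (expR u) z)); last by ring.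
    rewrite -[leRHS]mulrA ler_wpM2l ?expR_ge0//.
    apply: (@le_trans _ _ (C * (enorm z ^+ 3 * expq (expR u) z))).
      rewrite mulrA ler_wpM2r ?expq_ge0// exprSr mulrA enorm_sqr.
      by rewrite ler_pM ?coord_le_enorm.
    rewrite -[leRHS]mulrA ler_wpM2l//.
    exact: (@expq_le R n 3 u 4 z (ler0n _ _) (@le3_expR_sqr R)).
rewrite RintegralZl//; last exact: (gauss_rV s0).1.
rewrite integral_expq_half /wexp (negbTE u0) /B.
rewrite [leLHS](_ : _ = 4 * C * gc * (e * expR (- (3 * u / 2)) * expR (- (n%:R * u / 2)))); last by ring.
rewrite ler_wpM2l ?mulr_ge0// /e -!expRD ler_expR.
rewrite -leNgt in u0.
have -> : (n%:R + a + 1) / 2 * u + - (3 * u / 2) + - (n%:R * u / 2) = (a / 2 - 1) * u by field.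
by rewrite -mulNr ler_wpM2r//; have := a1; lra.
Qed.

Lemma integrable_mainterm : lam.-integrable setT (EFin \o mainterm a i) /\
  \int[lam]_u mainterm a i u = m i * (2 / (1 - a)).
Proof.
have e0 : 0 < (1 - a) / 2 by rewrite divr_gt0// subr_gt0.
pose h u : R := if u < 0 then 0 else expR (- ((1 - a) / 2 * u)).
have mE : measurable_fun setT (fun u : R => expR (- ((1 - a) / 2 * u))).
  apply: measurableT_comp => //; apply: measurable_funN; exact: measurable_funM.
have Eh : (\int[lam]_u (h u)%:E = (2 / (1 - a))%:E)%E.
  rewrite -[2 / (1 - a)]add0r EFinD; apply: integral_ltr0 => //.
  - by rewrite integral0_eq.
  - by rewrite integral_expRN// invf_div.
have ih : lam.-integrable setT (EFin \o h).
  apply/integrableP; split; first by apply/measurable_EFinP; exact: measurable_fun_ltr0.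
  under eq_integral => u _.
    rewrite /= ger0_norm; last by rewrite /h; case: ifP => // _; exact: expR_ge0.
    over.
  by rewrite Eh ltry.
have -> : mainterm a i = (fun u => m i * h u).
  by apply/funext => u; rewrite /mainterm /h; case: ifP; rewrite ?mulr0.
split; first exact: integrableRZ.
by rewrite RintegralZl// /Rintegral Eh.
Qed.

(** Here the factor [2 / a + 2] stays bounded as [a] tends to [1], unlike the one in
    [frac_kernel_bound], so the error is of the order of [heat_cst a]. *)
Lemma frac_kernel_remainder :
  `|\int[mu]_z (w z * frac_kernel a i z) -
    heat_cst (n:=n) a * (Num.sqrt pi ^+ n / (1 - a)) * G i| <=
  heat_cst (n:=n) a * (4 * C * gc * (2 / a + 2)).
Proof.
have [im Em] := integrable_mainterm.
have ih := integrable_heat_time a0 a1 i mw C0 wC wC1.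
rewrite (frac_kernel_heat a0 a1 i mw C0 wC wC1).2.
have -> : heat_cst (n:=n) a * (Num.sqrt pi ^+ n / (1 - a)) * G i =
    heat_cst (n:=n) a * \int[lam]_u mainterm a i u.
  by rewrite Em /m; field; rewrite gt_eqF// subr_gt0.
rewrite -mulrBr normrM (gtr0_norm (heat_cst_gt0 (n:=n) a1)).
rewrite (ler_wpM2l (ltW (heat_cst_gt0 (n:=n) a1)))// -RintegralB//.
apply: le_trans (le_normr_Rintegral measurableT (integrableRB ih im)) _.
have iw : lam.-integrable setT (EFin \o wexp (a / 2) (2^-1 : R)).
  by apply: integrable_wexp; rewrite ?divr_gt0 ?invr_gt0.
have -> : 2 / a + 2 = \int[lam]_u wexp (a / 2) (2^-1 : R) u.
  by rewrite Rintegral_wexp ?divr_gt0 ?invr_gt0// invf_div invrK.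
rewrite -RintegralZl//; apply: le_Rintegral => //.
- exact: integrable_norm (integrableRB ih im).
- exact: integrableRZ.
- by move=> u _; exact: heat_kernel_remainder.
Qed.

End fixed_order.
End kernel_limit.

(** * Asymptotics of the normalising constants *)

Section constants.
Context {R : realType} {n : nat}.

Lemma near_left1 : \forall a \near (1 : R)^'-, 2^-1 < a < 1.
Proof.
near=> a; apply/andP; split; near: a.
  by apply: nbhs_left_gt; lra.
exact: nbhs_left_lt.
Unshelve. all: by end_near. Qed.

Lemma cvg_gamma_factor :
  (1 - a) / 2 * Gamma ((1 - a) / 2) @[a --> (1 : R)^'-] --> (1 : R).
Proof.
apply/cvgrPdist_le => d d0; near=> a.
have /andP[ha ha1] : 2^-1 < a < 1 by near: a; exact: near_left1.
rewrite distrC; apply: le_trans (mul_Gamma_dist _ _) _; [lra|lra|].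
have : 1 - d / 2 < a.
  by near: a; apply: nbhs_left_gt; rewrite ltrBlDr ltrDl divr_gt0.
lra.
Unshelve. all: by end_near. Qed.

Lemma cvg_pow2 : (2 : R) `^ a @[a --> (1 : R)^'-] --> (2 : R).
Proof.
have -> : (2 : R) = expR (1 * ln 2) by rewrite mul1r lnK// posrE.
have -> : (fun a => expR (1 * ln 2) `^ a) = (fun a : R => expR (a * ln 2)) :> (R -> R).
  by apply/funext => a; rewrite mul1r lnK ?posrE// /powR gt_eqF.
apply: continuous_cvg; first exact: continuous_expR.
apply: cvgM; last exact: cvg_cst.
by apply: cvg_at_left_filter; exact: cvg_id.
Qed.

Lemma pi_powR_half : pi `^ (- (n%:R / 2)) * Num.sqrt pi ^+ n = 1 :> R.
Proof.
have -> : Num.sqrt pi ^+ n = pi `^ (n%:R / 2) :> R.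
  by rewrite -powR12_sqrt ?pi_ge0// -powR_mulrn ?powR_ge0// -powRrM mulrC.
by rewrite powRN mulVf// gt_eqF// powR_gt0// pi_gt0.
Qed.

Lemma heat_cst_ratioE (a : R) : 2^-1 < a < 1 ->
  heat_cst (n:=n) a * (Num.sqrt pi ^+ n / (1 - a)) =
  2 `^ a / 2 * ((1 - a) / 2 * Gamma ((1 - a) / 2))^-1 :> R.
Proof.
move=> /andP[ha ha1]; rewrite /heat_cst.
have G0 : Gamma ((1 - a) / 2) != 0 by rewrite gt_eqF// Gamma_gt0//; lra.
have a0 : 1 - a != 0 by rewrite gt_eqF//; lra.
rewrite [LHS](_ : _ = 2 `^ a * (pi `^ (- (n%:R / 2)) * Num.sqrt pi ^+ n) /
  Gamma ((1 - a) / 2) / (1 - a)); last by ring.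
rewrite pi_powR_half; field.
by rewrite G0 a0.
Qed.

Lemma cvg_heat_cst_ratio :
  heat_cst (n:=n) a * (Num.sqrt pi ^+ n / (1 - a)) @[a --> (1 : R)^'-] --> (1 : R).
Proof.
have H : 2 `^ a / 2 * ((1 - a) / 2 * Gamma ((1 - a) / 2))^-1 @[a --> (1 : R)^'-] --> (2 / 2 * 1^-1 : R).
  apply: cvgM; first by apply: cvgM; [exact: cvg_pow2|exact: cvg_cst].
  by apply: cvgV; [exact: oner_neq0|exact: cvg_gamma_factor].
rewrite divff// invr1 mulr1 in H; apply: cvg_trans H.
apply: near_eq_cvg; near=> a; apply/esym/heat_cst_ratioE.
by near: a; exact: near_left1.
Unshelve. all: by end_near. Qed.

Lemma heat_cst_bounded : exists2 M : R, 0 <= M &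
  \forall a \near (1 : R)^'-, heat_cst (n:=n) a <= M * (1 - a).
Proof.
(* The ratio in [cvg_heat_cst_ratio] tends to [1], hence is at most [2] near [1]. *)
exists (2 / Num.sqrt pi ^+ n); first by rewrite divr_ge0// exprn_ge0// sqrtr_ge0.
near=> a.
have /andP[ha ha1] : 2^-1 < a < 1 by near: a; exact: near_left1.
have s0 : 0 < Num.sqrt pi ^+ n :> R by rewrite exprn_gt0// sqrtr_gt0 pi_gt0.
have : heat_cst (n:=n) a * (Num.sqrt pi ^+ n / (1 - a)) <= 2.
  near: a.
  by apply: (cvgr_le _ cvg_heat_cst_ratio); rewrite ltr1n.
have a0 : 0 < 1 - a by rewrite subr_gt0.
by rewrite mulrA ler_pdivrMr// -ler_pdivlMr// mulrAC.
Unshelve. all: by end_near. Qed.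

Lemma frac_kernel_cvg (w : 'rV[R]_n -> R) (C : R) (G : 'I_n -> R) (i : 'I_n) :
  measurable_fun setT w -> 0 <= C ->
  (forall z, `|w z| <= C) -> (forall z, `|w z| <= C * enorm z) ->
  (forall z, `|w z - \sum_j G j * z 0 j| <= C * dotr z z) ->
  \int[lebesgue_rV R n]_z (w z * frac_kernel a i z) @[a --> (1 : R)^'-] --> G i.
Proof.
move=> mw C0 wC wC1 wG.
have [M M0 HM] := heat_cst_bounded.
have H : heat_cst (n:=n) a * (Num.sqrt pi ^+ n / (1 - a)) * G i @[a --> (1 : R)^'-] --> 1 * G i.
  by apply: cvgM; [exact: cvg_heat_cst_ratio|exact: cvg_cst].
rewrite mul1r in H.
(* The number [6] bounds [2 / a + 2] for [a > 1 / 2]. *)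
pose K := M * (4 * C * @gauss_cst R n * 6).
have K0 : 0 <= K by rewrite !mulr_ge0// exprn_ge0// sqrtr_ge0.
apply/cvgrPdist_le => d d0; near=> a.
have /andP[ha ha1] : 2^-1 < a < 1 by near: a; exact: near_left1.
have a0 : 0 < a by lra.
have h1 := frac_kernel_remainder mw C0 wC wC1 wG i a0 ha1.
have h2 : `|G i - heat_cst (n:=n) a * (Num.sqrt pi ^+ n / (1 - a)) * G i| <= d / 2.
  near: a; move/cvgrPdist_le : H; apply; lra.
have h3 : heat_cst (n:=n) a <= M * (1 - a) by near: a.
have gc0 : 0 <= @gauss_cst R n by rewrite exprn_ge0// sqrtr_ge0.
have h4 : heat_cst (n:=n) a * (4 * C * @gauss_cst R n * (2 / a + 2)) <= K * (1 - a).
  apply: (@le_trans _ _ (M * (1 - a) * (4 * C * @gauss_cst R n * 6))); last first.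
    by rewrite /K; lra.
  have x0 : 0 <= 4 * C * @gauss_cst R n by rewrite !mulr_ge0.
  have : 2 / a <= 4 by rewrite ler_pdivrMr//; lra.
  have : 0 <= 2 / a by rewrite divr_ge0// ltW.
  move=> y0 y4; apply: ler_pM => //.
  - exact: ltW (heat_cst_gt0 (n:=n) ha1).
  - by rewrite mulr_ge0//; lra.
  - by rewrite ler_wpM2l//; lra.
have h5 : K * (1 - a) <= d / 2.
  have : 1 - d / (2 * (K + 1)) < a.
    near: a; apply: nbhs_left_gt; rewrite ltrBlDr ltrDl divr_gt0//; lra.
  rewrite ltrBlDr addrC -ltrBlDr => h.
  apply: (@le_trans _ _ ((K + 1) * (1 - a))); first by rewrite ler_wpM2r//; lra.
  rewrite -ler_pdivlMl; last lra.
  apply: le_trans (ltW h) _; rewrite le_eqVlt; apply/orP; left; apply/eqP.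
  field; rewrite gt_eqF//; lra.
have := ler_normD (G i - heat_cst (n:=n) a * (Num.sqrt pi ^+ n / (1 - a)) * G i)
  (heat_cst (n:=n) a * (Num.sqrt pi ^+ n / (1 - a)) * G i -
    \int[lebesgue_rV R n]_z (w z * frac_kernel a i z)).
rewrite subrKA [X in _ <= _ + X]distrC => h6.
apply: le_trans h6 _; rewrite [leRHS]splitr; apply: lerD => //.
by apply: le_trans h1 _; exact: le_trans h4 h5.
Unshelve. all: by end_near. Qed.

End constants.

(** * Translation increments of test functions and of Lipschitz functions *)

Section lipschitz_compact_support.
Context {R : realType} {n : nat}.
Local Notation mu := (lebesgue_rV R n).
Implicit Types (h : 'rV[R]_n -> R) (x z : 'rV[R]_n).

(** The common properties of product bumps and of the components of test fields that the arguments
    on increments rely on. *)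
Definition lip_csupp h := [/\ measurable_fun setT h,
  exists k, forall x, ~ cube k x -> h x = 0 &
  exists2 C, 0 <= C & forall x z, `|h x| <= C /\ `|h (x + z) - h x| <= C * enorm z].

Lemma lip_csupp_integrable h : lip_csupp h -> mu.-integrable setT (EFin \o h).
Proof.
move=> [mh [k hk] [C C0 HC]].
apply: (@integrable_le _ _ _ _ _ (fun x => C * \1_(cube k) x)) => //.
  move=> x; rewrite indicE; have [xk|xk] := boolP (x \in cube k).
    by rewrite mulr1; have [] := HC x 0.
  by rewrite hk ?normr0 ?mulr0//; rewrite notin_setE in xk.
exact: integrableRZ (integrable_cube k).
Qed.

(** The increment vanishes unless [x] or [x + z] lies in the cube, two sets of the same measure;
    this is the factor [V + V]. *)
Lemma lip_csupp_translate h : lip_csupp h -> exists2 C, 0 <= C & forall z,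
  \int[mu]_x `|h (x + z) - h x| <= C /\ \int[mu]_x `|h (x + z) - h x| <= C * enorm z.
Proof.
move=> hl; have ih := lip_csupp_integrable hl; have [mh [k hk] [C C0 HC]] := hl.
pose V := \int[mu]_x (\1_(cube k) x : R).
have V0 : 0 <= V by apply: Rintegral_ge0 => x _; rewrite indicE.
have ik := @integrable_cube R n k.
have key z c : 0 <= c -> (forall x, `|h (x + z) - h x| <= c) ->
    \int[mu]_x `|h (x + z) - h x| <= c * (V + V).
  move=> c0 Hc.
  have ikz := @integrable_translation R n z _ ik.
  have -> : c * (V + V) = \int[mu]_x (c * (\1_(cube k) (x + z) + \1_(cube k) x)).
    rewrite RintegralZl//; last exact: integrableRD ikz ik.
    rewrite RintegralD// (@Rintegral_translation R n z (\1_(cube k)))//.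
    by apply: measurable_indic; exact: measurable_cube.
  apply: le_Rintegral => //.
  - apply: integrable_norm; apply: integrableRB => //.
    exact: (@integrable_translation R n z (EFin \o h)).
  - by apply: integrableRZ; exact: integrableRD ikz ik.
  - move=> x _; have [xk|xk] := pselect (cube k x).
      rewrite [X in _ * (_ + X)]indicE mem_set//.
      apply: le_trans (Hc x) _; rewrite -[leLHS]mulr1 ler_wpM2l//.
      by rewrite lerDr indicE.
    have [xzk|xzk] := pselect (cube k (x + z)).
      rewrite [X in _ * (X + _)]indicE mem_set//.
      apply: le_trans (Hc x) _; rewrite -[leLHS]mulr1 ler_wpM2l//.
      by rewrite lerDl indicE.
    by rewrite !hk// subrr normr0 mulr_ge0// addr_ge0// indicE.
exists (2 * C * (V + V)); first by rewrite !mulr_ge0// addr_ge0.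
move=> z; split.
  apply: key; first by rewrite mulr_ge0.
  move=> x; apply: le_trans (ler_normB _ _) _.
  have [h1 _] := HC (x + z) 0; have [h2 _] := HC x 0; lra.
have := key z (C * enorm z) (mulr_ge0 C0 (enorm_ge0 z)) (fun x => (HC x z).2).
move=> H; apply: le_trans H _.
rewrite [leRHS](_ : _ = C * (2 * (enorm z * (V + V)))); last by ring.
rewrite -mulrA ler_wpM2l// ler_peMl ?ler1n//.
by rewrite mulr_ge0 ?enorm_ge0// addr_ge0.
Qed.

Lemma lipschitz_line (g g' : R -> R) (B a b : R) :
  (forall t, is_derive t (1 : R) g (g' t)) -> (forall t, `|g' t| <= B) ->
  `|g b - g a| <= B * `|b - a|.
Proof.
move=> dg Bg; wlog ab : a b / a <= b => [H|].
  have [/H//|/ltW/H] := leP a b.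
  by rewrite distrC [X in _ -> _ <= _ * X]distrC.
have cg := is_derive_continuous dg.
have [c _ ->] := MVT_segment ab (fun t _ => dg t) (continuous_subspaceT cg).
by rewrite normrM ler_wpM2r.
Qed.

(** The path from [x] to [x + z] follows the coordinate directions one at a time, so that partial
    derivatives suffice; the factor [n] bounds the sum of the coordinates by the Euclidean norm. *)
Lemma lipschitz_partial h (dh : 'I_n -> 'rV[R]_n -> R) (B : R) x z : 0 <= B ->
  (forall j y, is_derive y (delta_mx 0 j) h (dh j y)) ->
  (forall j y, `|dh j y| <= B) ->
  `|h (x + z) - h x| <= B * n%:R * enorm z.
Proof.
move=> B0 Dh Bh.
have step j y t : `|h (y + t *: delta_mx 0 j) - h y| <= B * `|t|.
  have := @lipschitz_line (fun s => h (y + s *: delta_mx 0 j))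
    (fun s => dh j (y + s *: delta_mx 0 j)) B 0 t.
  rewrite scale0r addr0 subr0; apply => s; last exact: Bh.
  exact: is_derive_line.
have S (r : seq 'I_n) : `|h (x + \sum_(j <- r) z 0 j *: delta_mx 0 j) - h x| <=
    B * \sum_(j <- r) `|z 0 j|.
  elim: r => [|j r IH]; first by rewrite !big_nil addr0 subrr normr0 mulr0.
  rewrite !big_cons mulrDr addrCA addrC.
  set y := x + \sum_(j <- r) _ in IH *.
  rewrite -(subrK (h y) (h (y + _))) -addrA.
  by apply: le_trans (ler_normD _ _) _; apply: lerD.
have := S (index_enum 'I_n).
rewrite -row_sum_delta => H; apply: le_trans H _.
by rewrite -mulrA ler_wpM2l// sum_coord_le_enorm.
Qed.

Lemma continuous_csupp_bounded h k : continuous h -> (forall x, ~ cube k x -> h x = 0) ->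
  exists2 B, 0 <= B & forall x, `|h x| <= B.
Proof.
move=> ch hk; have [K cK kK] := @cube_sub_compact R n k.
have : bounded_set (h @` K).
  apply: compact_bounded; apply: continuous_compact => //.
  exact: continuous_subspaceT.
move=> [B [_ HB]]; exists (`|B| + 1) => [|x]; first by rewrite addr_ge0.
have [xk|xk] := pselect (cube k x); last by rewrite hk// normr0 addr_ge0.
apply: HB; first by rewrite (le_lt_trans (ler_norm _))// ltrDl.
by exists x => //; exact: kK.
Qed.

Lemma lip_csupp_test_field (phi : 'rV[R]_n -> 'rV[R]_n) i : test_field phi ->
  lip_csupp (fun x => phi x 0 i).
Proof.
move=> [sphi cphi].
have [k Kk] := compact_sub_cube cphi.
have c0 : continuous phi by have [] := sphi [::].
have cc (g : 'rV[R]_n -> 'rV[R]_n) : continuous g -> continuous (fun x => g x 0 i).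
  move=> cg x.
  exact: (@continuous_comp _ _ _ g (fun y : 'rV[R]_n => y 0 i) x (cg x)
    (@coord_continuous R 1 n 0 i (g x))).
have phi0 x : ~ cube k%:R x -> phi x 0 i = 0.
  move=> xk; apply/eqP; apply: contrapT => p0; apply: xk; apply: Kk.
  apply: subset_closure => /=; apply/negP => /eqP px; apply: p0.
  by rewrite px mxE.
(* Off its closed support [phi] vanishes in a neighbourhood, and so do its partial derivatives. *)
have dphi0 j x : ~ cube k%:R x -> partial j phi x = 0.
  move=> xk; rewrite /partial (@near_eq_derive _ _ _ phi (cst 0)) ?derive_cst//.
  have : open (~` closure [set x | phi x != 0]) by apply: closed_openC; exact: closed_closure.
  move=> oC; have H : nbhs x (~` closure [set x | phi x != 0]).
    by apply: open_nbhs_nbhs; split => // /Kk.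
  apply: filterS H => y /= yC; apply/eqP; apply: contrapT => /negP y0; apply: yC.
  exact: subset_closure.
have [B0 B00 HB0] := continuous_csupp_bounded (cc _ c0) phi0.
have HBj j : exists B, forall x, `|partial j phi x 0 i| <= B.
  have cj : continuous (partial j phi) by have [] := sphi [:: j].
  have [|B _ HB] := @continuous_csupp_bounded (fun x => partial j phi x 0 i) k%:R (cc _ cj).
    by move=> x xk; rewrite dphi0// mxE.
  by exists B.
have [B HB] := choice HBj.
have B1 j : 0 <= B j by exact: le_trans (normr_ge0 _) (HB j 0).
pose BB := \sum_j B j.
have BB0 : 0 <= BB by apply: sumr_ge0.
split.
- by apply: continuous_measurable_rV; exact: cc.
- by exists k%:R.
- exists (B0 + BB * n%:R); first by rewrite addr_ge0// mulr_ge0.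
  move=> x z; split; first by apply: le_trans (HB0 x) _; rewrite lerDl mulr_ge0.
  apply: (@le_trans _ _ (BB * n%:R * enorm z)).
    apply: (@lipschitz_partial (fun x => phi x 0 i) (fun j x => partial j phi x 0 i)) => //.
      move=> j y; have [_ /(_ j y) dj] := sphi [::].
      have /derivable_mxP/(_ 0 i) dji := dj.
      apply: DeriveDef => //; rewrite /partial derive_mx// mxE.
      by [].
    by move=> j y; apply: le_trans (HB j y) _; rewrite /BB (bigD1 j)//= lerDl sumr_ge0.
  by rewrite ler_wpM2r ?enorm_ge0// lerDr.
Qed.

Lemma lip_csupp_tens (b : 'I_n -> R -> R) (l : 'I_n) : cbump b -> lip_csupp (tens b).
Proof.
move=> cb; have := lip_csupp_test_field l (test_field_tensv l cb).
rewrite (_ : (fun x => _) = tens b)//.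
by apply/funext => x; rewrite /tensv mxE mxE !eqxx mulr1.
Qed.

End lipschitz_compact_support.

(** * Increments of a function with a bounded weak gradient *)

Section weak_gradient_shift.
Context {R : realType} {n : nat}.
Local Notation lam := (@lebesgue_measure R).
Local Notation mu := (lebesgue_rV R n).
(** Integrals over [t] in [[0, 1]] are written on the whole line against [chi], so that the product
    integrals on [setT] apply. *)
Local Notation chi := (\1_(`[(0 : R), 1]%classic) : R -> R).
Implicit Types (x z : 'rV[R]_n) (t : R) (b : 'I_n -> R -> R).

Lemma chi_ge0 t : 0 <= chi t. Proof. by rewrite indicE. Qed.

Lemma chi_integrable : lam.-integrable setT (EFin \o chi).
Proof.
apply: integrable_indicT; first exact: measurable_itv.
by rewrite /= lebesgue_measure_itv/= lte_fin ltr01 -EFinB ltry.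
Qed.

Lemma Rintegral_chi : \int[lam]_t chi t = 1.
Proof.
by rewrite /Rintegral integral_indic// setIT
  /= lebesgue_measure_itv/= lte_fin ltr01 -EFinB subr0.
Qed.

Lemma integrable_slab (h : 'rV[R]_n * measurableTypeR R -> R) (K k : R) :
  measurable_fun setT h ->
  (forall x t, `|h (x, t)| <= K * (\1_(cube k) x * chi t)) ->
  (mu \x lam)%E.-integrable setT (EFin \o h).
Proof.
move=> mh hK.
have ik := @integrable_cube R n k.
have it := integrableRZ K (integrable_tensor ik chi_integrable).
by apply: integrable_le it => // -[x t]; exact: hK.
Qed.

Lemma measurable_shift z :
  measurable_fun setT (fun p : 'rV[R]_n * measurableTypeR R => p.1 + p.2 *: z).
Proof. by apply: measurable_rVD => //; apply: measurable_rVZ. Qed.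

Lemma cube_shift k x z t : 0 <= t <= 1 -> cube k (x + t *: z) ->
  cube (k + \sum_i `|z 0 i|) x.
Proof.
move=> /andP[t0 t1] /cubeP H; apply/cubeP => i; have := H i; rewrite !mxE => Hi.
have zi : `|z 0 i| <= \sum_i `|z 0 i| by rewrite (bigD1 i)//= lerDl sumr_ge0.
have tz : `|t * z 0 i| <= `|z 0 i| by rewrite normrM (ger0_norm t0) ler_piMl.
have := ler_normB (x 0 i + t * z 0 i) (t * z 0 i); rewrite addrK; lra.
Qed.

(** The factor [1 *] puts the shift in the form expected by [Coo_affine] and [is_derive_affine]. *)
Definition shift_bump b z : 'I_n -> R -> R := fun i s => b i (1 * s + z 0 i).

Lemma tens_shift b z x : tens (shift_bump b z) x = tens b (x + z).
Proof. by apply: eq_bigr => i _; rewrite /shift_bump mul1r mxE. Qed.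

Lemma cbump_shift b z : cbump b -> cbump (shift_bump b z).
Proof.
move=> [cb [M bM]]; split; first by move=> i; exact: Coo_affine.
exists (M + \sum_i `|z 0 i|) => i t; rewrite in_itv/= -ltr_norml -leNgt => tM.
apply: bM; rewrite in_itv/= -ltr_norml -leNgt mul1r.
have zi : `|z 0 i| <= \sum_i `|z 0 i| by rewrite (bigD1 i)//= lerDl sumr_ge0.
have := ler_normB (t + z 0 i) (z 0 i); rewrite addrK; lra.
Qed.

Lemma tens_ftc b b' x z : (forall i t, is_derive t (1 : R) (b i) (b' i t)) ->
  (forall i, Coo (b i)) ->
  tens b (x + z) - tens b x =
    \sum_j z 0 j * \int[lam]_t (tens (upd b j (b' j)) (x + t *: z) * chi t).
Proof.
move=> db cb.
have cb' j : Coo (b' j).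
  have [c [dc cc]] := CooP (cb j); suff -> : b' j = c by [].
  by apply/funext => t; have [_ <-] := db j t; have [_ <-] := dc t.
pose F t := tens b (x + t *: z).
pose F' j t := tens (upd b j (b' j)) (x + t *: z).
have dF t : is_derive t (1 : R) F (\sum_j z 0 j * F' j t).
  by apply: is_derive_line; exact: is_derive_tens.
have cF' j : continuous (F' j).
  have [b'' [db'' _]] := Coo_derive (Coo_upd j cb (cb' j)).
  apply: is_derive_continuous => t; apply: is_derive_line.
  exact: is_derive_tens.
have cS : continuous (fun t => \sum_j z 0 j * F' j t).
  elim: (index_enum _) => [|j r IH].
    by under eq_fun do rewrite big_nil; move=> t; exact: cvg_cst.
  under eq_fun do rewrite big_cons.
  move=> t; apply: cvgD; last exact: IH.
  by apply: cvgM; [exact: cvg_cst|exact: cF'].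
have iF j : lam.-integrable setT (EFin \o (fun t => F' j t * chi t)).
  apply: (integrable_restrictP lam _ (measurable_itv _)).1.
  apply: continuous_compact_integrable; first exact: segment_compact.
  exact: continuous_subspaceT.
have [_ <-] := Rintegral_lincomb (index_enum 'I_n) (z 0) iF.
have -> : tens b (x + z) - tens b x = F 1 - F 0.
  by rewrite /F scale1r scale0r addr0.
have := FTC2_line ler01 dF cS.
move=> /(congr1 fine) /= <-.
rewrite -[LHS]/(Rintegral lam `[0, 1] _) Rintegral_mkcond; apply: eq_Rintegral => t _.
rewrite patch_indic /= mulr_suml; apply: eq_bigr => j _.
by rewrite mulrA.
Qed.

Lemma integrable_bounded_cube (K k : R) (h : 'rV[R]_n -> R) :
  measurable_fun setT h -> (forall x, `|h x| <= K) ->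
  mu.-integrable (cube k) (EFin \o h).
Proof.
move=> mh hK; apply: (integrable_restrictP mu h (measurable_cube k)).2.
exact: integrable_bounded_mul mh hK (integrable_cube k).
Qed.

Lemma integrable_bounded_tens (K : R) (h : 'rV[R]_n -> R) b : cbump b ->
  measurable_fun setT h -> (forall x, `|h x| <= K) ->
  mu.-integrable setT (EFin \o (fun x => h x * tens b x)).
Proof. move=> cb mh hM; exact: integrable_bounded_mul mh hM (cbump_integrable cb). Qed.

Lemma integrable_tens_shift (K : R) (h : 'rV[R]_n -> R) b z : cbump b ->
  measurable_fun setT h -> (forall x, `|h x| <= K) ->
  mu.-integrable setT (EFin \o (fun x => h x * tens b (x + z))).
Proof.
move=> cb mh hM; have := integrable_bounded_tens (cbump_shift z cb) mh hM.
by congr (_.-integrable _ _); apply/funext => x /=; rewrite tens_shift.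
Qed.

Lemma tens_shift_slab (K : R) (h : 'rV[R]_n -> R) b z : cbump b ->
  measurable_fun setT h -> (forall x, `|h x| <= K) ->
  (mu \x lam)%E.-integrable setT (EFin \o
    (fun p : 'rV[R]_n * measurableTypeR R => h p.1 * tens b (p.1 + p.2 *: z) * chi p.2)).
Proof.
move=> cb mh hM; have K0 : 0 <= K by exact: le_trans (normr_ge0 _) (hM 0).
have [B B0 HB] := cbump_bounded cb; have [_ [k bk]] := cb.
apply: (@integrable_slab _ (K * B) (k + \sum_i `|z 0 i|)).
  apply: measurable_funM.
    apply: measurable_funM; first exact: measurableT_comp.
    exact: measurableT_comp (cbump_measurable cb) (measurable_shift z).
  by apply: measurableT_comp => //; apply: measurable_indic; exact: measurable_itv.
move=> x t /=; rewrite !normrM (ger0_norm (chi_ge0 t)) mulrA.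
have [t01|t01] := boolP (t \in (`[0, 1]%classic : set R)); last first.
  by rewrite [chi t]indicE (negbTE t01) !mulr0.
rewrite ler_wpM2r ?chi_ge0//.
have [xk|xk] := pselect (cube k (x + t *: z)).
  rewrite [X in _ <= _ * X]indicE mem_set ?mulr1 ?ler_pM//.
  apply: cube_shift xk; move: t01; rewrite inE/= in_itv/=; exact.
by rewrite (tens_out bk xk) normr0 mulr0 !mulr_ge0// indicE.
Qed.

Variables (f : 'rV[R]_n -> R) (g : 'rV[R]_n -> 'rV[R]_n) (M : R).
Hypotheses (mf : measurable_fun setT f) (mg : measurable_fun setT g).
Hypotheses (fM : forall x, `|f x| <= M) (gM : forall x j, `|g x 0 j| <= M).
Hypothesis fg : is_weak_gradient f g.

Let M0 : 0 <= M. Proof. exact: le_trans (normr_ge0 _) (fM 0). Qed.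

Let mgj j : measurable_fun setT (fun x => g x 0 j).
Proof. exact: measurable_rV_coord. Qed.

Lemma weak_gradient_tens b b' j : cbump b ->
  (forall i t, is_derive t (1 : R) (b i) (b' i t)) ->
  \int[mu]_x (f x * tens (upd b j (b' j)) x) = - \int[mu]_x (g x 0 j * tens b x).
Proof.
move=> cb db; have [_ /(_ _ (test_field_tensv j cb)) H] := fg.
have -> : \int[mu]_x (f x * tens (upd b j (b' j)) x) =
    \int[mu]_x (f x * divergence (tensv b j) x).
  apply: eq_Rintegral => x _; congr (_ * _); rewrite /divergence (bigD1 j)//= big1 ?addr0 => [|i ij].
    rewrite /partial; have [_ ->] := is_derive_tensv j x j db.
    by rewrite /tensv mxE mxE !eqxx mulr1.
  rewrite /partial; have [_ ->] := is_derive_tensv j x i db.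
  by rewrite /tensv mxE mxE eqxx (negbTE ij) mulr0.
by rewrite H; congr (- _); apply: eq_Rintegral => x _; rewrite dotr_tensv.
Qed.

Lemma weak_gradient_tens_shift b b' j z : cbump b ->
  (forall i t, is_derive t (1 : R) (b i) (b' i t)) ->
  \int[mu]_x (f x * tens (upd b j (b' j)) (x + z)) =
  - \int[mu]_x (g x 0 j * tens b (x + z)).
Proof.
move=> cb db.
have dsh i t : is_derive t (1 : R) (shift_bump b z i) (shift_bump b' z i t).
  by apply: (is_derive_eq (is_derive_affine (db i _))); rewrite mul1r.
have := weak_gradient_tens j (cbump_shift z cb) dsh.
under [in RHS]eq_Rintegral do rewrite tens_shift.
move=> <-; apply: eq_Rintegral => x _; congr (_ * _).
rewrite !tens_upd /shift_bump mul1r mxE; congr (_ * _).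
by apply: eq_bigr => i _; rewrite mul1r mxE.
Qed.

(** The increment of the bump is an integral of its derivatives along the segment. After Fubini each
    derivative is transferred to [f], because a translated product bump is again an admissible test
    function. *)
Lemma weak_gradient_segment b z : cbump b ->
  \int[mu]_x (f x * (tens b x - tens b (x + z))) =
  \sum_j z 0 j * \int[lam]_t (\int[mu]_x (g x 0 j * tens b (x + t *: z)) * chi t).
Proof.
move=> cb; have [b' [db cb']] := Coo_derive cb.1.
have cu j := cbump_upd j cb db.
pose I j x := \int[lam]_t (f x * tens (upd b j (b' j)) (x + t *: z) * chi t).
have sl j := tens_shift_slab z (cu j) mf fM.
have iI j : mu.-integrable setT (EFin \o I j) by exact: (integrable_Rintegral1 (sl j)).
have -> : \int[mu]_x (f x * (tens b x - tens b (x + z))) =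
    \int[mu]_x (\sum_j - z 0 j * I j x).
  apply: eq_Rintegral => x _.
  rewrite -opprB (tens_ftc _ _ db cb.1) mulrN mulr_sumr -sumrN.
  apply: eq_bigr => j _; rewrite mulrCA mulNr; congr (- (_ * _)).
  rewrite /I -RintegralZl//.
    by apply: eq_Rintegral => t _; rewrite mulrA.
  apply: (integrable_restrictP lam _ (measurable_itv _)).1.
  apply: continuous_compact_integrable; first exact: segment_compact.
  apply: continuous_subspaceT.
  have [b'' [db'' _]] := Coo_derive (cu j).1.
  apply: is_derive_continuous => t; apply: is_derive_line.
  exact: is_derive_tens.
rewrite (Rintegral_lincomb _ _ iI).2; apply: eq_bigr => j _.
rewrite mulNr -mulrN; congr (_ * _).
rewrite /I (Rintegral_fubini (sl j)) /=.
rewrite -[LHS]mulN1r -RintegralZl//; last exact: (integrable_Rintegral2 (sl j)).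
apply: eq_Rintegral => t _; rewrite mulN1r RintegralZr//; last first.
  exact: (integrable_tens_shift _ (cu j)).
by rewrite (weak_gradient_tens_shift j (t *: z) cb db) mulNr opprK.
Qed.

(** For a fixed [w], the fundamental lemma identifies the increment with the integral of [w . g]
    along the segment. The exceptional null set depends on [w], so no bound is obtained at a fixed
    [x] for all [w] at once. *)
Lemma ae_translation_lipschitz w :
  {ae mu, forall x, `|f (x + w) - f x| <= M * (n%:R * enorm w)}.
Proof.
pose I j x := \int[lam]_t (g (x + t *: w) 0 j * chi t).
have mgw j : measurable_fun setT
    (fun p : 'rV[R]_n * measurableTypeR R => g (p.1 + p.2 *: w) 0 j * chi p.2).
  apply: measurable_funM; first exact: measurableT_comp (mgj j) (measurable_shift w).
  by apply: measurableT_comp => //; apply: measurable_indic; exact: measurable_itv.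
have mI j : measurable_fun setT (I j) by exact: (@measurable_Rintegral1 _ _ _ _ _ lam _ (mgw j)).
have Igj j x : lam.-integrable setT (EFin \o (fun t : R => g (x + t *: w) 0 j * chi t)).
  apply: integrable_le (integrableRZ M chi_integrable).
    exact: (measurableT_comp (mgw j) (measurable_pair1 x)).
  by move=> t; rewrite normrM (ger0_norm (chi_ge0 t)) ler_wpM2r ?chi_ge0.
have IM j x : `|I j x| <= M.
  apply: le_trans (le_normr_Rintegral measurableT (Igj j x)) _.
  rewrite -[leRHS]mulr1 -[X in _ <= _ * X]Rintegral_chi -RintegralZl//; last exact: chi_integrable.
  apply: le_Rintegral => //.
  - exact: integrable_norm.
  - exact: integrableRZ chi_integrable.
  - by move=> t _; rewrite normrM (ger0_norm (chi_ge0 t)) ler_wpM2r ?chi_ge0.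
pose S x := \sum_j w 0 j * I j x.
have SM x : `|S x| <= M * (n%:R * enorm w).
  apply: le_trans (ler_norm_sum _ _ _) _.
  apply: (@le_trans _ _ (M * \sum_j `|w 0 j|)); last by rewrite ler_wpM2l// sum_coord_le_enorm.
  by rewrite mulr_sumr ler_sum// => j _; rewrite normrM mulrC ler_wpM2r.
have mS : measurable_fun setT S.
  by apply: measurable_sum => j; apply: measurable_funM.
have mfw : measurable_fun setT (fun x => f (x + w)).
  by apply: measurableT_comp => //; apply: measurable_rVD.
suff : {ae mu, forall x, f (x + w) - f x - S x = 0}.
  by apply: filterS => x /subr0_eq ->.
apply: fundamental_lemma.
- by apply: measurable_funB => //; exact: measurable_funB.
- move=> k; apply: (@integrable_bounded_cube (M + M + M * (n%:R * enorm w))).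
    by apply: measurable_funB => //; exact: measurable_funB.
  move=> x; apply: le_trans (ler_normB _ _) _; apply: lerD => //.
  by apply: le_trans (ler_normB _ _) _; exact: lerD.
move=> b cb.
have iI j : mu.-integrable setT (EFin \o (fun x => I j x * tens b x)).
  exact: (integrable_bounded_tens cb (mI j) (IM j)).
have iS := Rintegral_lincomb (index_enum 'I_n) (w 0) iI.
have ifw : mu.-integrable setT (EFin \o (fun x => f (x + w) * tens b x)).
  by apply: (@integrable_bounded_tens M).
have if0 : mu.-integrable setT (EFin \o (fun x => f x * tens b x)).
  by apply: (@integrable_bounded_tens M).
have -> : \int[mu]_x ((f (x + w) - f x - S x) * tens b x) =
   \int[mu]_x (f (x + w) * tens b x - f x * tens b x - \sum_j w 0 j * (I j x * tens b x)).
  apply: eq_Rintegral => x _; rewrite 2!mulrBl; congr (_ - _).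
  by rewrite mulr_suml; apply: eq_bigr => j _; rewrite mulrA.
rewrite RintegralB//; [|exact: integrableRB|exact: iS.1].
(* Fubini, and then a translation by [- (t *: w)] for each [t], move the shift from [g] to the bump;
   this matches [weak_gradient_segment] at [- w]. *)
have EI j : \int[mu]_x (I j x * tens b x) =
    \int[lam]_t (\int[mu]_x (g x 0 j * tens b (x + t *: - w)) * chi t).
  pose h (p : 'rV[R]_n * measurableTypeR R) :=
    g (p.1 + p.2 *: w) 0 j * chi p.2 * tens b p.1.
  have mh : measurable_fun setT h.
    apply: measurable_funM => //; exact: measurableT_comp (cbump_measurable cb) _.
  have ih : (mu \x lam)%E.-integrable setT (EFin \o h).
    apply: integrable_le (integrableRZ M
      (integrable_tensor (integrable_norm (cbump_integrable cb)) chi_integrable)) => //.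
    move=> [x t]; rewrite /h /= !normrM (ger0_norm (chi_ge0 t)).
    by rewrite -mulrA [chi t * _]mulrC ler_wpM2r// mulr_ge0 ?chi_ge0.
  transitivity (\int[mu]_x \int[lam]_t h (x, t)).
    by apply: eq_Rintegral => x _; rewrite /I /h /= RintegralZr.
  rewrite (Rintegral_fubini ih); apply: eq_Rintegral => t _.
  rewrite -RintegralZr//; last exact: (integrable_tens_shift _ cb (mgj j) (fun x => gM x j)).
  rewrite -(@Rintegral_translation R n (- (t *: w)) (fun x : 'rV[R]_n => h (x, t))); last first.
    exact: (measurableT_comp mh (measurable_pair2 t)).
  by apply: eq_Rintegral => x _; rewrite /h /= addrNK scalerN mulrAC.
have Ef : \int[mu]_x (f (x + w) * tens b x) = \int[mu]_x (f x * tens b (x - w)).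
  rewrite -(@Rintegral_translation R n (- w) (fun x : 'rV[R]_n => f (x + w) * tens b x)); last first.
    by apply: measurable_funM => //; exact: cbump_measurable.
  by apply: eq_Rintegral => x _; rewrite addrNK.
have := weak_gradient_segment (- w) cb.
under eq_Rintegral do rewrite mulrBr.
rewrite RintegralB//; last exact: (integrable_tens_shift _ cb mf fM).
rewrite RintegralB// iS.2 Ef => H.
under eq_bigr do rewrite EI.
rewrite -[X in X - _]opprB H -sumrN -sumrB; apply: big1 => j _.
by rewrite mxE mulNr opprK subrr.
Qed.

End weak_gradient_shift.

(** * The fractional gradient of a Lipschitz function *)

Section clamp.
Context {R : realDomainType}.
Implicit Types c v : R.

(** Truncation turns a bound valid almost everywhere into one valid everywhere, without changing the
    function off a null set. *)
Definition clamp c v : R := Num.max (- c) (Num.min c v).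

Lemma clamp_bound c v : 0 <= c -> `|clamp c v| <= c /\ `|clamp c v| <= `|v|.
Proof.
move=> c0; rewrite /clamp !ler_norml.
have := ler_norm v; have := ler_norm (- v); rewrite normrN => v1 v2.
case: (leP c v) => cv; [case: (leP (- c) c)|case: (leP (- c) v)] => H;
  by split; apply/andP; split; lra.
Qed.

Lemma clamp_id c v : `|v| <= c -> clamp c v = v.
Proof.
rewrite ler_norml /clamp => /andP[cv vc].
by rewrite (min_idPr vc) (max_idPr cv).
Qed.

End clamp.

Section dominated_slices.
Context d1 d2 (T1 : measurableType d1) (T2 : measurableType d2) (R : realType).
Variable m1 : {sigma_finite_measure set T1 -> \bar R}.
Variable m2 : {sigma_finite_measure set T2 -> \bar R}.

Lemma integrable_dominated_slices (h : T1 * T2 -> R) (G : T2 -> R) :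
  measurable_fun setT h ->
  (forall y, m1.-integrable setT (EFin \o (fun x => h (x, y)))) ->
  (forall y, \int[m1]_x `|h (x, y)| <= G y) ->
  m2.-integrable setT (EFin \o G) ->
  (m1 \x m2)%E.-integrable setT (EFin \o h).
Proof.
move=> mh ih hG iG.
have mh' : measurable_fun setT (EFin \o h) by exact/measurable_EFinP.
have mha : measurable_fun setT (abse \o (EFin \o h)) by exact: measurableT_comp.
apply/(integrable21ltyP m1 m2 mh'); have /integrableP[mG Goo] := iG.
apply: le_lt_trans Goo; apply: ge0_le_integral => //.
- by move=> y _; exact: integral_ge0.
- exact: (measurable_fun_fubini_tonelli_G (m1 := m1) _ mha (fun=> abse_ge0 _)).
- exact: measurableT_comp.
- move=> y _.
  have iny := integrable_fin_num measurableT (integrable_norm (ih y)).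
  rewrite -(fineK iny) lee_fin.
  by apply: le_trans (hG y) _; exact: ler_norm.
Qed.

End dominated_slices.

Section bounded_fields.
Context {R : realType} {n : nat}.
Local Notation mu := (lebesgue_rV R n).
Implicit Types (g : 'rV[R]_n -> 'rV[R]_n) (z : 'rV[R]_n).

Lemma enorm_le_sum z : enorm z <= \sum_i `|z 0 i|.
Proof.
have S0 : 0 <= \sum_i `|z 0 i| by apply: sumr_ge0.
rewrite -(ler_pXn2r (n := 2)) ?nnegrE ?enorm_ge0// enorm_sqr expr2 mulr_suml.
apply: ler_sum => i _; apply: le_trans (ler_norm _) _.
by rewrite normrM ler_wpM2l// (bigD1 i)//= lerDl sumr_ge0.
Qed.

Lemma enorm_le_bound (B : R) z : (forall i, `|z 0 i| <= B) -> enorm z <= n%:R * B.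
Proof.
move=> zB; apply: le_trans (enorm_le_sum z) _.
apply: le_trans (ler_sum _ (fun i _ => zB i)) _.
by rewrite sumr_const card_ord mulr_natl.
Qed.

Lemma bounded_vL1loc (B : R) g : measurable_fun setT g ->
  (forall x i, `|g x 0 i| <= B) -> vL1loc g.
Proof.
move=> mg gB; split=> // K cK; have mK := compact_measurable_rV cK.
have [k Kk] := compact_sub_cube cK.
have muK : (mu K < +oo)%E.
  apply: le_lt_trans (measure_cube_lty k%:R); apply: le_measure => //.
  - by rewrite inE.
  - by rewrite inE; exact: measurable_cube.
apply: (@le_lt_trans _ _ (\int[mu]_(x in K) `|n%:R * B|%:E)%E).
  apply: ge0_le_integral => //.
  - by move=> x _; rewrite lee_fin enorm_ge0.
  - apply/measurable_EFinP; apply: measurable_funTS; exact: measurable_enorm.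
  - by move=> x _; rewrite lee_fin; apply: le_trans (ler_norm _); exact: enorm_le_bound.
by rewrite integral_cst// lte_mul_pinfty.
Qed.

Lemma measurable_frac_kernel a i : measurable_fun setT (@frac_kernel R n a i).
Proof.
rewrite /frac_kernel; apply: measurable_funM => //.
under eq_fun do rewrite -powRN.
apply: measurable_funM; first exact: measurable_rV_coord.
apply: (measurableT_comp (@measurable_powR R _)).
exact: measurable_enorm.
Qed.

Lemma integrable_translate_kernel a (h : 'rV[R]_n -> R) x i : 0 < a -> a < 1 ->
  lip_csupp h ->
  mu.-integrable setT (EFin \o (fun z => (h (x + z) - h x) * frac_kernel a i z)).
Proof.
move=> a0 a1 [mh _ [C C0 HC]].
have C20 : 0 <= 2 * C by rewrite mulr_ge0.
have mw : measurable_fun setT (fun z => h (x + z) - h x).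
  apply: measurable_funB => //.
  by apply: (measurableT_comp mh); exact: measurable_rVD.
apply: (frac_kernel_heat a0 a1 i mw C20 _ _).1 => z.
  apply: le_trans (ler_normB _ _) _.
  by have := (HC (x + z) 0).1; have := (HC x 0).1; lra.
apply: le_trans (HC x z).2 _.
by rewrite ler_wpM2r ?enorm_ge0// ler_peMl// ler1n.
Qed.

(** The change of variable [y = x + z], followed by a splitting into components, each of which
    converges absolutely by [integrable_translate_kernel]. *)
Lemma frac_divergenceE a (phi : 'rV[R]_n -> 'rV[R]_n) x : 0 < a -> a < 1 ->
  test_field phi -> frac_divergence a phi x =
    \sum_i \int[mu]_z ((phi (x + z) 0 i - phi x 0 i) * frac_kernel a i z).
Proof.
move=> a0 a1 tphi.
have ik i := integrable_translate_kernel x i a0 a1 (lip_csupp_test_field i tphi).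
have mphi : measurable_fun setT phi.
  by apply/measurable_fun_rVP => i; have [] := lip_csupp_test_field i tphi.
rewrite /frac_divergence.
have mI : measurable_fun setT (fun y : 'rV[R]_n => dotr (y - x) (phi y - phi x) /
    enorm (y - x) `^ (n%:R + a + 1)).
  under eq_fun do rewrite -powRN.
  apply: measurable_funM.
    by apply: measurable_dotr; apply: measurable_rVB.
  apply: (measurableT_comp (@measurable_powR R _)).
  by apply: measurable_enorm; apply: measurable_rVB.
rewrite -(Rintegral_translation x mI).
transitivity (frac_cst n a * \int[mu]_z (\sum_i (phi (x + z) 0 i - phi x 0 i) *
    (z 0 i / enorm z `^ (n%:R + a + 1)))).
  congr (_ * _); apply: eq_Rintegral => z _.
  rewrite addrK [z + x]addrC /dotr mulr_suml; apply: eq_bigr => i _.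
  by rewrite !mxE mulrAC mulrC.
(* A nonzero constant can be divided out, which carries integrability over to the unnormalised
   integrand of [frac_divergence]. *)
have c0 : frac_cst n a != 0.
  have n0 : 0 <= n%:R :> R by [].
  by rewrite gt_eqF// /frac_cst !mulr_gt0 ?invr_gt0 ?powR_gt0 ?pi_gt0 ?Gamma_gt0//; lra.
have iK i : mu.-integrable setT (EFin \o (fun z => (phi (x + z) 0 i - phi x 0 i) *
    (z 0 i / enorm z `^ (n%:R + a + 1)))).
  apply: eq_integrable (integrableRZ (frac_cst n a)^-1 (ik i)) => // z _ /=.
  by rewrite /frac_kernel mulrCA mulKf.
have [_ E] := Rintegral_lincomb (index_enum 'I_n) (fun=> frac_cst n a) iK.
rewrite -RintegralZl//; last first.
  have [H _] := Rintegral_lincomb (index_enum 'I_n) (fun=> 1) iK.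
  by move: H; congr (_.-integrable _ _); apply/funext => z /=; under eq_bigr do rewrite mul1r.
under eq_Rintegral do rewrite mulr_sumr.
rewrite E; apply: eq_bigr => i _.
by rewrite -RintegralZl//; apply: eq_Rintegral => z _; rewrite /frac_kernel mulrCA.
Qed.

End bounded_fields.

(** * The fractional gradient as an absolutely convergent integral *)

Section fractional_gradient.
Context {R : realType} {n : nat}.
Local Notation mu := (lebesgue_rV R n).
Variables (f : 'rV[R]_n -> R) (g : 'rV[R]_n -> 'rV[R]_n) (M : R).
Hypotheses (mf : measurable_fun setT f) (mg : measurable_fun setT g).
Hypotheses (fM : forall x, `|f x| <= M) (gM : forall x j, `|g x 0 j| <= M).
Hypothesis fg : is_weak_gradient f g.
Implicit Types (x z : 'rV[R]_n) (h : 'rV[R]_n -> R).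

Let M0 : 0 <= M. Proof. exact: le_trans (normr_ge0 _) (fM 0). Qed.

Let n0 : 0 <= n%:R :> R. Proof. exact: ler0n. Qed.

(* By [ae_translation_lipschitz] the truncation is inactive for almost every
   [x]; it makes the bounds below hold everywhere. *)
Definition increment x z : R := clamp (M * (n%:R * enorm z)) (f x - f (x - z)).

(** [M + M] bounds an increment of [f] and [M * n] is the Lipschitz constant; the sum covers both,
    since the kernel estimates ask for a single constant. *)
Definition incr_cst : R := M + M + M * n%:R.

Lemma incr_cst_ge0 : 0 <= incr_cst.
Proof. by rewrite /incr_cst !addr_ge0 ?mulr_ge0. Qed.

Lemma increment_bound x z :
  `|increment x z| <= incr_cst /\ `|increment x z| <= incr_cst * enorm z.
Proof.
have z0 := enorm_ge0 z.
have L0 : 0 <= M * (n%:R * enorm z) by rewrite !mulr_ge0.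
have [H1 H2] := clamp_bound (f x - f (x - z)) L0.
rewrite /increment /incr_cst; split.
  apply: le_trans H2 _; apply: le_trans (ler_normB _ _) _.
  by rewrite ler_wpDr ?mulr_ge0// lerD.
by apply: le_trans H1 _; rewrite mulrA ler_wpM2r// lerDr addr_ge0.
Qed.

Lemma measurable_increment :
  measurable_fun setT (fun p : 'rV[R]_n * 'rV[R]_n => increment p.1 p.2).
Proof.
have mL : measurable_fun setT (fun p : 'rV[R]_n * 'rV[R]_n => M * (n%:R * enorm p.2)).
  by apply: measurable_funM => //; apply: measurable_funM => //; exact: measurable_enorm.
apply: measurable_maxr; first exact: measurable_funN.
apply: measurable_minr => //; apply: measurable_funB; first exact: measurableT_comp.
by apply: (measurableT_comp mf); exact: measurable_rVB.
Qed.

(** Backward differences are what appears when a translation is moved from the test function to [f].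
    As the kernel is odd, forward differences would, up to the truncation, define the same
    integral. *)
Definition frac_gradient (a : R) x : 'rV[R]_n :=
  \row_i \int[mu]_z (increment x z * frac_kernel a i z).

Lemma measurable_frac_gradient a : measurable_fun setT (frac_gradient a).
Proof.
apply/measurable_fun_rVP => i; under eq_fun do rewrite mxE.
apply: (@measurable_Rintegral1 _ _ _ _ _ mu
  (fun p : 'rV[R]_n * 'rV[R]_n => increment p.1 p.2 * frac_kernel a i p.2)).
apply: measurable_funM; first exact: measurable_increment.
exact: measurableT_comp (measurable_frac_kernel a i) _.
Qed.

Definition frac_gradient_cst (a : R) : R :=
  heat_cst (n:=n) a * (2 * incr_cst * @gauss_cst R n * (2 / a + 2 / (1 - a))).

Lemma frac_gradient_bound a x i : 0 < a -> a < 1 ->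
  `|frac_gradient a x 0 i| <= frac_gradient_cst a.
Proof.
move=> a0 a1; rewrite /frac_gradient mxE.
have mI := measurableT_comp measurable_increment (measurable_pair1 x).
apply: (frac_kernel_bound a0 a1 i mI incr_cst_ge0) => z.
  exact: (increment_bound x z).1.
exact: (increment_bound x z).2.
Qed.

(** With [z] fixed the truncation is inactive for almost every [x]; translating the second term then
    moves the shift to [h]. *)
Lemma increment_pairing h z : lip_csupp h ->
  \int[mu]_x (increment x z * h x) = \int[mu]_x (f x * (h x - h (x + z))).
Proof.
move=> hl; have ih := lip_csupp_integrable hl; have [mh _ _] := hl.
have mfz : measurable_fun setT (fun x => f (x - z)).
  by apply: (measurableT_comp mf); exact: measurable_rVB.
transitivity (\int[mu]_x ((f x - f (x - z)) * h x)).
  apply: ae_eq_Rintegral.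
  - apply: measurable_funM => //.
    exact: (measurableT_comp measurable_increment (measurable_pair2 z)).
  - by apply: measurable_funM => //; exact: measurable_funB.
  - have := ae_translation_lipschitz mf mg fM gM fg (- z); apply: filterS => x H.
    rewrite /increment clamp_id// distrC; apply: le_trans H _.
    by rewrite /enorm (_ : dotr (- z) (- z) = dotr z z)// /dotr; apply: eq_bigr => i _;
      rewrite !mxE mulrNN.
under eq_Rintegral do rewrite mulrBl.
rewrite RintegralB//; [|exact: integrable_bounded_mul fM ih|exact: integrable_bounded_mul ih].
rewrite -(@Rintegral_translation R n z (fun x : 'rV[R]_n => f (x - z) * h x)); last exact: measurable_funM.
under [X in _ - X]eq_Rintegral do rewrite addrK.
under [RHS]eq_Rintegral do rewrite mulrBr.
rewrite RintegralB//; first exact: integrable_bounded_mul fM ih.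
have := @integrable_translation R n z _ (integrable_bounded_mul mfz (fun x => fM (x - z)) ih).
by congr (_.-integrable _ _); apply/funext => x /=; rewrite addrK.
Qed.

(** A majorant for all increments at once: the constant controls the kernel at infinity, the linear
    bound at its singularity. *)
Lemma integrable_min_frac_kernel a i (C : R) : 0 < a -> a < 1 -> 0 <= C ->
  mu.-integrable setT
    (EFin \o (fun z => Num.min C (C * enorm z) * `|frac_kernel a i z|)).
Proof.
move=> a0 a1 C0.
have mw : measurable_fun setT (fun z : 'rV[R]_n => Num.min C (C * enorm z)).
  by apply: measurable_minr => //; apply: measurable_funM => //; exact: measurable_enorm.
have w0 z : 0 <= Num.min C (C * enorm z) by rewrite le_min C0 mulr_ge0 ?enorm_ge0.
have H := (frac_kernel_heat a0 a1 i mw C0 _ _).1.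
have {}H : mu.-integrable setT (EFin \o (fun z => Num.min C (C * enorm z) * frac_kernel a i z)).
  by apply: H => z; rewrite ger0_norm// ge_min lexx ?orbT.
have := integrable_norm H; congr (_.-integrable _ _).
by apply/funext => z /=; rewrite normrM ger0_norm.
Qed.

Lemma integrable_increment_kernel a i h : 0 < a -> a < 1 ->
  mu.-integrable setT (EFin \o h) ->
  (mu \x mu)%E.-integrable setT (EFin \o
    (fun p : 'rV[R]_n * 'rV[R]_n => increment p.1 p.2 * frac_kernel a i p.2 * h p.1)).
Proof.
move=> a0 a1 ih; have /measurable_EFinP mh := measurable_int _ ih.
have mk := measurable_frac_kernel a i.
apply: integrable_le (integrable_tensor (integrable_norm ih)
  (integrable_min_frac_kernel i a0 a1 incr_cst_ge0)).
  apply: measurable_funM; last exact: measurableT_comp mh _.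
  apply: measurable_funM; first exact: measurable_increment.
  exact: measurableT_comp mk _.
move=> [x z] /=; rewrite !normrM mulrC ler_wpM2l// ler_wpM2r//.
by have [H1 H2] := increment_bound x z; rewrite le_min H1 H2.
Qed.

(** Fubini leaves a kernel integral whose weight depends on [z] alone, the form treated by
    [frac_kernel_cvg]. *)
Lemma frac_gradient_pairing a i h : 0 < a -> a < 1 ->
  mu.-integrable setT (EFin \o h) ->
  \int[mu]_x (frac_gradient a x 0 i * h x) =
  \int[mu]_z ((\int[mu]_x (increment x z * h x)) * frac_kernel a i z).
Proof.
move=> a0 a1 ih; have iI := integrable_increment_kernel i a0 a1 ih.
have /measurable_EFinP mh := measurable_int _ ih.
transitivity (\int[mu]_x \int[mu]_z (increment x z * frac_kernel a i z * h x)).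
  apply: eq_Rintegral => x _; rewrite /frac_gradient mxE RintegralZr//.
  have mI := measurableT_comp measurable_increment (measurable_pair1 x).
  apply: (frac_kernel_heat a0 a1 i mI incr_cst_ge0 _ _).1 => z.
    exact: (increment_bound x z).1.
  exact: (increment_bound x z).2.
rewrite (Rintegral_fubini iI) /=; apply: eq_Rintegral => z _.
rewrite -RintegralZr//; first by apply: eq_Rintegral => x _; rewrite mulrAC.
apply: integrable_bounded_mul ih => [|x]; last exact: (increment_bound x z).1.
exact: (measurableT_comp measurable_increment (measurable_pair2 z)).
Qed.

(** The nonlocal integration by parts. By Fubini both sides are kernel integrals in [z], and
    [increment_pairing] identifies their weights for each [z]. *)
Lemma frac_gradient_test a i h : 0 < a -> a < 1 -> lip_csupp h ->
  mu.-integrable setT (EFin \o (fun x =>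
    f x * \int[mu]_z ((h (x + z) - h x) * frac_kernel a i z))) /\
  \int[mu]_x (f x * \int[mu]_z ((h (x + z) - h x) * frac_kernel a i z)) =
  - \int[mu]_x (frac_gradient a x 0 i * h x).
Proof.
move=> a0 a1 hl; have ih := lip_csupp_integrable hl.
have [mh _ [B B0 HB]] := hl; have [C C0 HC] := lip_csupp_translate hl.
have mk := measurable_frac_kernel a i.
pose G (p : 'rV[R]_n * 'rV[R]_n) := f p.1 * (h (p.1 + p.2) - h p.1) * frac_kernel a i p.2.
have ihz z : mu.-integrable setT (EFin \o (fun x => h (x + z) - h x)).
  by apply: integrableRB => //; exact: (@integrable_translation R n z _ ih).
have mG : measurable_fun setT G.
  apply: measurable_funM; last exact: measurableT_comp mk _.
  apply: measurable_funM; first exact: measurableT_comp.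
  apply: measurable_funB; last exact: measurableT_comp.
  by apply: (measurableT_comp mh); exact: measurable_rVD.
pose D z x := M * `|h (x + z) - h x| * `|frac_kernel a i z|.
have GD z x : `|G (x, z)| <= D z x by rewrite /G /D /= !normrM ler_wpM2r// ler_wpM2r.
have iD z : mu.-integrable setT (EFin \o D z).
  have := integrableRZ `|frac_kernel a i z| (integrableRZ M (integrable_norm (ihz z))).
  by congr (_.-integrable _ _); apply/funext => x /=; rewrite mulrC.
have iGz z : mu.-integrable setT (EFin \o (fun x => G (x, z))).
  exact: integrable_le (measurableT_comp mG (measurable_pair2 z)) (GD z) (iD z).
(* Since [f] is merely bounded, integrability in [x] comes from the increment of [h], whose [L^1]
   norm is at most [Num.min C (C * enorm z)]. *)
have iG : (mu \x mu)%E.-integrable setT (EFin \o G).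
  apply: (integrable_dominated_slices mG iGz _
    (integrableRZ M (integrable_min_frac_kernel i a0 a1 C0))) => z.
  apply: (@le_trans _ _ (\int[mu]_x D z x)).
    apply: le_Rintegral => //; exact: integrable_norm.
  rewrite RintegralZr//; last exact: integrableRZ (integrable_norm (ihz z)).
  rewrite RintegralZl//; last exact: integrable_norm (ihz z).
  have [H1 H2] := HC z; rewrite mulrA ler_wpM2r// ler_wpM2l//.
  by rewrite le_min H1 H2.
have -> : (fun x => f x * \int[mu]_z ((h (x + z) - h x) * frac_kernel a i z)) =
    (fun x => \int[mu]_z G (x, z)).
  apply/funext => x.
  rewrite -(RintegralZl _ measurableT (integrable_translate_kernel x i a0 a1 hl)).
  by apply: eq_Rintegral => z _; rewrite mulrA.
split; first exact: integrable_Rintegral1 iG.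
rewrite (Rintegral_fubini iG) frac_gradient_pairing//.
rewrite -[LHS]opprK; congr (- _).
rewrite -mulN1r -RintegralZl//; last exact: integrable_Rintegral2 iG.
apply: eq_Rintegral => z _; rewrite increment_pairing// /G /=.
have ifh : mu.-integrable setT (EFin \o (fun x => f x * (h (x + z) - h x))).
  exact: integrable_bounded_mul mf fM (ihz z).
rewrite RintegralZr// mulrA -RintegralZl//; congr (_ * _).
by apply: eq_Rintegral => x _; rewrite mulN1r -mulrN opprB.
Qed.

Lemma is_weak_frac_gradient_bounded a : 0 < a -> a < 1 ->
  is_weak_frac_gradient a f (frac_gradient a).
Proof.
move=> a0 a1; split.
  apply: (bounded_vL1loc (measurable_frac_gradient a)) => x i.
  exact: frac_gradient_bound.
move=> phi tphi; have lphi i := lip_csupp_test_field i tphi.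
have mga i := measurable_rV_coord i (measurable_frac_gradient a).
have iga i : mu.-integrable setT (EFin \o (fun x => frac_gradient a x 0 i * phi x 0 i)).
  apply: integrable_bounded_mul (lip_csupp_integrable (lphi i)) => // x.
  exact: frac_gradient_bound.
transitivity (\int[mu]_x (\sum_i 1 *
    (f x * \int[mu]_z ((phi (x + z) 0 i - phi x 0 i) * frac_kernel a i z)))).
  apply: eq_Rintegral => x _; rewrite frac_divergenceE// mulr_sumr.
  by apply: eq_bigr => i _; rewrite mul1r.
rewrite (Rintegral_lincomb _ _ (fun i => (frac_gradient_test i a0 a1 (lphi i)).1)).2.
under eq_bigr do rewrite mul1r (frac_gradient_test _ a0 a1 (lphi _)).2 -mulN1r.
rewrite -mulr_sumr mulN1r; congr (- _).
rewrite [RHS](_ : _ = \int[mu]_x (\sum_i 1 * (frac_gradient a x 0 i * phi x 0 i))); last first.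
  by apply: eq_Rintegral => x _; apply: eq_bigr => i _; rewrite mul1r.
by rewrite (Rintegral_lincomb _ _ iga).2; apply: eq_bigr => i _; rewrite mul1r.
Qed.

End fractional_gradient.

(** * Weak* convergence and lower semicontinuity *)

Section Lnorm_infty.
Context d (T : measurableType d) (R : realType).
Variable mu : {measure set T -> \bar R}.

Lemma Lnorm_infty_leP (h : T -> R) c : 0 <= c ->
  (Lnorm mu +oo (EFin \o h) <= c%:E)%E <-> {ae mu, forall x, `|h x| <= c}.
Proof.
move=> c0; rewrite unlock; case: ifPn => [_|].
  split=> [/ess_supP|H]; first by apply: filterS => x /=; rewrite lee_fin.
  by apply/ess_supP; apply: filterS H => x /=; rewrite lee_fin.
(* On a space of measure zero the norm is [0] by convention, and every property holds almost
   everywhere. *)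
rewrite -leNgt => mu0; split=> [_|]; last by rewrite lee_fin.
exists setT; split => //; apply/eqP; rewrite eq_le mu0 /=; exact: measure_ge0.
Qed.

End Lnorm_infty.

(** * Vector fields, their norms, and uniqueness of weak gradients *)

Section vector_fields.
Context {R : realType} {n : nat}.
Local Notation mu := (lebesgue_rV R n).
Implicit Types (g h psi : 'rV[R]_n -> 'rV[R]_n) (u v : 'rV[R]_n).

Lemma enorm0P u : enorm u = 0 -> u = 0.
Proof. by move=> u0; apply/eqP; rewrite -dotrr_eq0 -enorm_sqr u0 expr0n. Qed.

(** Cauchy-Schwarz, by expanding the squared norm of [enorm v *: w - enorm w *: v]. *)
Lemma dotr_le_enorm u v : `|dotr u v| <= enorm u * enorm v.
Proof.
have H w : dotr w v <= enorm w * enorm v.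
  have w0 := enorm_ge0 w; have v0 := enorm_ge0 v.
  have [wv|] := eqVneq (enorm w * enorm v) 0.
    rewrite wv; move/eqP: wv; rewrite mulf_eq0 => /orP[] /eqP/enorm0P ->.
      by rewrite /dotr big1// => i _; rewrite mxE mul0r.
    by rewrite /dotr big1// => i _; rewrite mxE mulr0.
  move=> wv0; have wv : 0 < enorm w * enorm v by rewrite lt_def wv0 mulr_ge0.
  have := dotrr_ge0 (enorm v *: w - enorm w *: v).
  have -> : dotr (enorm v *: w - enorm w *: v) (enorm v *: w - enorm w *: v) =
      enorm v ^+ 2 * dotr w w + enorm w ^+ 2 * dotr v v - 2 * (enorm w * enorm v) * dotr w v.
    rewrite /dotr !mulr_sumr -big_split -sumrB/=; apply: eq_bigr => i _.
    by rewrite !mxE; ring.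
  rewrite -!enorm_sqr => K; rewrite -(ler_pM2l wv).
  by move: K; set p := enorm w; set q := enorm v; nra.
rewrite ler_norml H andbT lerNl; have := H (- u).
have -> : dotr (- u) v = - dotr u v.
  by rewrite /dotr -sumrN; apply: eq_bigr => i _; rewrite mxE mulNr.
have -> // : enorm (- u) = enorm u.
by rewrite /enorm /dotr; congr Num.sqrt; apply: eq_bigr => i _; rewrite !mxE mulrNN.
Qed.

Lemma vLnorm_infty_leP g c : 0 <= c ->
  (vLnorm +oo g <= c%:E)%E <-> {ae mu, forall x, enorm (g x) <= c}.
Proof.
move=> c0; have [H1 H2] := Lnorm_infty_leP mu (fun x => enorm (g x)) c0.
split=> [/H1|H]; first by apply: filterS => x; rewrite ger0_norm ?enorm_ge0.
by apply: H2; apply: filterS H => x; rewrite ger0_norm ?enorm_ge0.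
Qed.

Lemma vLnorm_ge0 p g : (0 <= vLnorm p g)%E.
Proof. exact: Lnorm_ge0. Qed.

Lemma vLfun_infty_ae g : vLfun +oo g ->
  exists2 c, 0 <= c & {ae mu, forall x, enorm (g x) <= c}.
Proof.
move=> [_ goo]; have g0 := vLnorm_ge0 +oo g.
have gf : vLnorm +oo g \is a fin_num by rewrite ge0_fin_numE.
exists (fine (vLnorm +oo g)); first by rewrite fine_ge0.
by apply/vLnorm_infty_leP; rewrite ?fine_ge0// fineK.
Qed.

Lemma vLfun1_coord psi i : vLfun 1 psi -> mu.-integrable setT (EFin \o (fun x => psi x 0 i)).
Proof.
move=> [mpsi]; rewrite /vLnorm Lnorm1 => psioo.
have ie : mu.-integrable setT (EFin \o (fun x => enorm (psi x))).
  apply/integrableP; split=> //; apply/measurable_EFinP; exact: measurable_enorm.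
apply: integrable_le ie; first exact: measurable_rV_coord.
by move=> x; exact: coord_le_enorm.
Qed.

Lemma Rintegral_dotr g psi (B : R) : measurable_fun setT g ->
  (forall x i, `|g x 0 i| <= B) ->
  (forall i, mu.-integrable setT (EFin \o (fun x => psi x 0 i))) ->
  \int[mu]_x dotr (g x) (psi x) = \sum_i \int[mu]_x (g x 0 i * psi x 0 i).
Proof.
move=> mg gB ipsi.
have ig i : mu.-integrable setT (EFin \o (fun x => g x 0 i * psi x 0 i)).
  exact: integrable_bounded_mul (measurable_rV_coord i mg) (fun x => gB x i) (ipsi i).
have := (Rintegral_lincomb (index_enum 'I_n) (fun=> 1) ig).2.
under [in RHS]eq_bigr do rewrite mul1r.
by move=> <-; apply: eq_Rintegral => x _; apply: eq_bigr => i _; rewrite mul1r.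
Qed.

Lemma vL1loc_integrable g (k : nat) i : vL1loc g ->
  mu.-integrable (cube k%:R) (EFin \o (fun x => g x 0 i)).
Proof.
move=> [mg gloc]; have [K cK kK] := @cube_sub_compact R n k%:R.
have mK := compact_measurable_rV cK; have mgi := measurable_rV_coord i mg.
apply/integrableP; split; first by apply/measurable_EFinP; exact: measurable_funTS.
apply: le_lt_trans (gloc _ cK).
apply: (@le_trans _ _ (\int[mu]_(x in cube k%:R) (enorm (g x))%:E)%E).
  apply: ge0_le_integral => //; first exact: measurable_cube.
  - apply: measurableT_comp => //; apply/measurable_EFinP; exact: measurable_funTS.
  - apply/measurable_EFinP; apply: measurable_funTS; exact: measurable_enorm.
  - by move=> x _; rewrite lee_fin coord_le_enorm.
apply: ge0_subset_integral => //; first exact: measurable_cube.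
  apply/measurable_EFinP; apply: measurable_funTS; exact: measurable_enorm.
by move=> x _; rewrite lee_fin enorm_ge0.
Qed.

Lemma integrable_loc_tens (q : 'rV[R]_n -> R) b : measurable_fun setT q -> cbump b ->
  (forall k : nat, mu.-integrable (cube k%:R) (EFin \o q)) ->
  mu.-integrable setT (EFin \o (fun x => q x * tens b x)).
Proof.
move=> mq cb iq; have [B B0 HB] := cbump_bounded cb; have [_ [k bk]] := cb.
pose N := (Num.truncn k).+1.
have iN := (integrable_restrictP mu q (measurable_cube N%:R)).1 (iq N).
apply: integrable_le (integrableRZ B (integrable_norm iN)).
  by apply: measurable_funM => //; exact: cbump_measurable.
move=> x; rewrite /= !normrM.
have [xk|xk] := pselect (cube k x); last by rewrite (tens_out bk xk) normr0 mulr0 !mulr_ge0.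
have xN : cube N%:R x.
  apply/cubeP => i; apply: lt_trans ((cubeP _ _).1 xk i) _.
  exact: truncnS_gt.
by rewrite indicE mem_set// normr1 mulr1 mulrC ler_wpM2r.
Qed.

(** Testing with one nonzero component at a time reduces to the scalar fundamental lemma. This is
    what ties the representative chosen by [xget] to an explicitly constructed one. *)
Lemma vL1loc_unique g h : vL1loc g -> vL1loc h ->
  (forall phi, test_field phi -> \int[mu]_x dotr (g x) (phi x) = \int[mu]_x dotr (h x) (phi x)) ->
  {ae mu, forall x, g x = h x}.
Proof.
move=> gloc hloc gh.
suff H (l : 'I_n) : {ae mu, forall x, g x 0 l - h x 0 l = 0}.
  have := filter_forall (ae_filter_ringOfSetsType mu) H.
  apply: filterS => x Hx; apply/rowP => l; exact/subr0_eq/(Hx l).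
have mgl := measurable_rV_coord l gloc.1; have mhl := measurable_rV_coord l hloc.1.
apply: fundamental_lemma; first exact: measurable_funB.
  move=> k; have := integrableB (measurable_cube k%:R)
    (vL1loc_integrable k l gloc) (vL1loc_integrable k l hloc).
  by apply: eq_integrable => //; exact: measurable_cube.
move=> b cb; under eq_Rintegral do rewrite mulrBl.
rewrite RintegralB//; first last.
- by apply: integrable_loc_tens => // k; exact: vL1loc_integrable.
- by apply: integrable_loc_tens => // k; exact: vL1loc_integrable.
have := gh _ (test_field_tensv l cb).
under eq_Rintegral do rewrite dotr_tensv.
by under [in RHS]eq_Rintegral do rewrite dotr_tensv; move=> ->; rewrite subrr.
Qed.

End vector_fields.

(** * Convergence of the fractional gradients against [L^1] functions *)

Section fractional_gradient_limit.
Context {R : realType} {n : nat}.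
Local Notation mu := (lebesgue_rV R n).
Local Notation lam := (@lebesgue_measure R).
Local Notation chi := (\1_(`[(0 : R), 1]%classic) : R -> R).
Variables (f : 'rV[R]_n -> R) (g : 'rV[R]_n -> 'rV[R]_n) (M : R).
Hypotheses (mf : measurable_fun setT f) (mg : measurable_fun setT g).
Hypotheses (fM : forall x, `|f x| <= M) (gM : forall x j, `|g x 0 j| <= M).
Hypothesis fg : is_weak_gradient f g.
Implicit Types (x z : 'rV[R]_n) (h : 'rV[R]_n -> R).

Let M0 : 0 <= M. Proof. exact: le_trans (normr_ge0 _) (fM 0). Qed.

Let n0 : 0 <= n%:R :> R. Proof. exact: ler0n. Qed.

Let mgj j : measurable_fun setT (fun x => g x 0 j).
Proof. exact: measurable_rV_coord. Qed.

(** A quadratic remainder although [f] is only Lipschitz: one difference is spent on [f] through its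
    weak gradient, the other falls on the bump, whose translates differ by [O(|z|)] in [L^1]. *)
Lemma increment_linear b (i : 'I_n) : cbump b -> exists2 C, 0 <= C & forall z,
  `|\int[mu]_x (increment f M x z * tens b x) -
    \sum_j (\int[mu]_x (g x 0 j * tens b x)) * z 0 j| <= C * dotr z z.
Proof.
move=> cb; have hl : lip_csupp (tens b) by exact: lip_csupp_tens i cb.
have ih := lip_csupp_integrable hl; have [C C0 HC] := lip_csupp_translate hl.
pose G j := \int[mu]_x (g x 0 j * tens b x).
exists (M * C * n%:R); first by rewrite !mulr_ge0.
move=> z.
pose I j (t : R) := \int[mu]_x (g x 0 j * tens b (x + t *: z)).
have iI j : lam.-integrable setT (EFin \o (fun t : R => I j t * chi t)).
  have := integrable_Rintegral2 (tens_shift_slab z cb (mgj j) (fun x => gM x j)).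
  congr (_.-integrable _ _); apply/funext => t /=; congr EFin.
  rewrite RintegralZr//.
  exact: (integrable_tens_shift _ cb (mgj j) (fun x => gM x j)).
rewrite (increment_pairing mf mg fM gM fg z hl) (weak_gradient_segment mf fM fg z cb).
rewrite -sumrB.
have -> : M * C * n%:R * dotr z z = M * C * enorm z * (n%:R * enorm z).
  by rewrite -enorm_sqr; ring.
apply: le_trans (ler_norm_sum _ _ _) _.
apply: (@le_trans _ _ (M * C * enorm z * \sum_j `|z 0 j|)); last first.
  by rewrite ler_wpM2l ?sum_coord_le_enorm// !mulr_ge0// enorm_ge0.
rewrite mulr_sumr; apply: ler_sum => j _; rewrite -/(G j) -/(I j) [G j * _]mulrC -mulrBr.
rewrite normrM mulrC ler_wpM2r//.
have iG : lam.-integrable setT (EFin \o (fun t : R => G j * chi t)).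
  exact: integrableRZ chi_integrable.
have -> : G j = \int[lam]_t (G j * chi t).
  by rewrite RintegralZl ?Rintegral_chi ?mulr1//; exact: chi_integrable.
rewrite -RintegralB//; last exact: iI.
apply: le_trans (le_normr_Rintegral measurableT (integrableRB (iI j) iG)) _.
have iK : lam.-integrable setT (EFin \o (fun t : R => M * C * enorm z * chi t)).
  exact: integrableRZ chi_integrable.
rewrite -[leRHS]mulr1 -[X in _ <= _ * X](@Rintegral_chi R) -RintegralZl//; last exact: chi_integrable.
apply: le_Rintegral => //; first exact: integrable_norm (integrableRB (iI j) iG).
move=> t _; rewrite -mulrBl normrM (ger0_norm (chi_ge0 t)).
have [t01|t01] := boolP (t \in (`[0, 1]%classic : set R)); last first.
  by rewrite [chi t]indicE (negbTE t01) !mulr0.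
rewrite ler_wpM2r ?chi_ge0//.
have {t01} /andP[t0 t1] : 0 <= t <= 1 by move: t01; rewrite inE/= in_itv/=.
rewrite /I /G -RintegralB//; last first.
  exact: (integrable_bounded_mul (mgj j) (fun x => gM x j) ih).
  exact: (integrable_tens_shift _ cb (mgj j) (fun x => gM x j)).
under eq_Rintegral do rewrite -mulrBr.
have ihz : mu.-integrable setT (EFin \o (fun x => tens b (x + t *: z) - tens b x)).
  by apply: integrableRB => //; exact: (@integrable_translation R n (t *: z) _ ih).
apply: le_trans (Rintegral_bounded_mul (mgj j) (fun x => gM x j) ihz) _.
rewrite -mulrA ler_wpM2l//; apply: le_trans (HC _).2 _.
rewrite ler_wpM2l// /enorm (_ : dotr _ _ = t ^+ 2 * dotr z z); last first.
  by rewrite /dotr mulr_sumr; apply: eq_bigr => k _; rewrite !mxE; ring.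
by rewrite sqrtrM ?sqr_ge0// sqrtr_sqr (ger0_norm t0) ler_piMl// sqrtr_ge0.
Qed.

(** [(1 - a) * (2 / a + 2 / (1 - a))] equals [2 / a], so the factor [1 - a] supplied by
    [heat_cst_bounded] removes the singularity; [6] is a generous bound for [a > 1 / 2]. *)
Lemma frac_gradient_cst_bounded : exists2 B, 0 <= B &
  \forall a \near (1 : R)^'-, @frac_gradient_cst R n M a <= B.
Proof.
have [A A0 HA] := @heat_cst_bounded R n.
have i0 := @incr_cst_ge0 R n f M fM.
have q0 : 0 <= @gauss_cst R n by rewrite exprn_ge0// sqrtr_ge0.
exists (A * (2 * @incr_cst R n M * @gauss_cst R n * 6)); first by rewrite !mulr_ge0.
near=> a.
have /andP[ha ha1] : 2^-1 < a < 1 by near: a; exact: near_left1.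
have a0 : 0 < a by lra.
have HAa : heat_cst (n:=n) a <= A * (1 - a) by near: a.
rewrite /frac_gradient_cst.
have E : (1 - a) * (2 / a + 2 / (1 - a)) <= 6.
  have -> : (1 - a) * (2 / a + 2 / (1 - a)) = 2 / a.
    by field; rewrite !gt_eqF// subr_gt0.
  by rewrite ler_pdivrMr//; lra.
have k0 : 0 <= 2 * @incr_cst R n M * @gauss_cst R n by rewrite !mulr_ge0.
have s0 : 0 <= 2 / a + 2 / (1 - a) by rewrite addr_ge0// divr_ge0 ?subr_ge0 ?ltW.
apply: (@le_trans _ _ (A * (1 - a) * (2 * @incr_cst R n M * @gauss_cst R n * (2 / a + 2 / (1 - a))))).
  by rewrite ler_wpM2r// mulr_ge0.
rewrite [leLHS](_ : _ = A * (2 * @incr_cst R n M * @gauss_cst R n * ((1 - a) * (2 / a + 2 / (1 - a))))); last by ring.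
by rewrite ler_wpM2l// ler_wpM2l.
Unshelve. all: by end_near. Qed.

Lemma frac_gradient_cvg_coord i h : mu.-integrable setT (EFin \o h) ->
  \int[mu]_x (frac_gradient f M a x 0 i * h x) @[a --> (1 : R)^'-] -->
    \int[mu]_x (g x 0 i * h x).
Proof.
have near01 : \forall a \near (1 : R)^'-, 0 < a < 1.
  by apply: filterS (near_left1 (R := R)) => a /andP[a2 ->]; rewrite andbT; lra.
have mga a : measurable_fun setT (fun x => frac_gradient f M a x 0 i).
  exact: (measurable_rV_coord i (measurable_frac_gradient M mf a)).
have gaM a x : 0 < a < 1 -> `|frac_gradient f M a x 0 i| <= @frac_gradient_cst R n M a.
  by move=> /andP[a0 a1]; exact: (frac_gradient_bound mf fM).
move: h; apply: L1_density.
- move=> b cb; have hl : lip_csupp (tens b) by exact: lip_csupp_tens i cb.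
  have ih := lip_csupp_integrable hl.
  pose F z := \int[mu]_x (increment f M x z * tens b x).
  have mI z : measurable_fun setT (fun x => increment f M x z).
    exact: (measurableT_comp (measurable_increment M mf) (measurable_pair2 z)).
  have mF : measurable_fun setT F.
    apply: (@measurable_Rintegral1 _ _ _ _ _ mu
      (fun p : 'rV[R]_n * 'rV[R]_n => increment f M p.2 p.1 * tens b p.2)).
    apply: measurable_funM; last exact: measurableT_comp (cbump_measurable cb) _.
    have msw : measurable_fun setT (fun p : 'rV[R]_n * 'rV[R]_n => (p.2, p.1)).
      exact: measurable_fun_pair.
    exact: measurableT_comp (measurable_increment M mf) msw.
  have [C C0 HC] := increment_linear i cb.
  pose V := \int[mu]_x `|tens b x|.
  have V0 : 0 <= V by apply: Rintegral_ge0.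
  have i0 := @incr_cst_ge0 R n f M fM.
  (* A single constant for the size, the Lipschitz bound and the quadratic remainder of [F]. *)
  pose D := @incr_cst R n M * V + C.
  have D0 : 0 <= D by rewrite addr_ge0// mulr_ge0.
  have FE : \forall a \near (1 : R)^'-, \int[mu]_z (F z * frac_kernel a i z) =
      \int[mu]_x (frac_gradient f M a x 0 i * tens b x).
    by apply: filterS near01 => a /andP[a0 a1]; rewrite (frac_gradient_pairing mf fM).
  apply: cvg_trans (near_eq_cvg FE) _.
  apply: (@frac_kernel_cvg R n F D (fun j => \int[mu]_x (g x 0 j * tens b x)) i) => // z.
  + apply: le_trans (Rintegral_bounded_mul (mI z) (fun x => (increment_bound fM x z).1) ih) _.
    by rewrite lerDl.
  + apply: le_trans (Rintegral_bounded_mul (mI z) (fun x => (increment_bound fM x z).2) ih) _.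
    by rewrite mulrAC ler_wpM2r ?enorm_ge0// lerDl.
  + apply: le_trans (HC z) _; rewrite ler_wpM2r ?dotrr_ge0//.
    by rewrite lerDr mulr_ge0.
- move=> c u v iu iv Pu Pv.
  have lin (q : 'rV[R]_n -> R) (K : R) : measurable_fun setT q -> (forall x, `|q x| <= K) ->
      \int[mu]_x (q x * (c * u x + v x)) = c * \int[mu]_x (q x * u x) + \int[mu]_x (q x * v x).
    move=> mq qK; have iqu := integrable_bounded_mul mq qK iu.
    have iqv := integrable_bounded_mul mq qK iv.
    rewrite -RintegralZl// -RintegralD//; last exact: integrableRZ.
    by apply: eq_Rintegral => x _; ring.
  rewrite (lin _ M (mgj i))//.
  have E : \forall a \near (1 : R)^'-, c * \int[mu]_x (frac_gradient f M a x 0 i * u x) +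
      \int[mu]_x (frac_gradient f M a x 0 i * v x) =
      \int[mu]_x (frac_gradient f M a x 0 i * (c * u x + v x)).
    apply: filterS near01 => a a01.
    by rewrite (lin _ _ (mga a) (fun x => gaM a x a01)).
  apply: cvg_trans (near_eq_cvg E) _.
  by apply: cvgD => //; apply: cvgM => //; exact: cvg_cst.
- move=> h ih Ph.
  have [B B0 HB] := frac_gradient_cst_bounded.
  apply/cvgrPdist_le => e e0.
  (* The two replacements of [h] by [k] together cost at most [(B + M) * d <= e / 2]; the [+ 1]
     keeps the denominator positive. *)
  pose d := e / (B + M + 1) / 2.
  have BM : 0 < B + M + 1 by rewrite ltr_wpDl// addr_ge0.
  have d0 : 0 < d by rewrite !divr_gt0.
  have [k [ik Pk hk]] := Ph _ d0.
  have ihk : mu.-integrable setT (EFin \o (fun x => h x - k x)) by exact: integrableRB.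
  have Dd : \int[mu]_x `|h x - k x| <= d.
    rewrite -lee_fin /Rintegral fineK//.
    exact: integrable_fin_num (integrable_norm ihk).
  have step (q : 'rV[R]_n -> R) (K : R) : 0 <= K -> measurable_fun setT q -> (forall x, `|q x| <= K) ->
      `|\int[mu]_x (q x * h x) - \int[mu]_x (q x * k x)| <= K * d.
    move=> K0 mq qK; rewrite -RintegralB//; [|exact: (integrable_bounded_mul mq qK)..].
    under eq_Rintegral do rewrite -mulrBr.
    by apply: le_trans (Rintegral_bounded_mul mq qK ihk) _; rewrite ler_wpM2l.
  have e2 : 0 < e / 2 by rewrite divr_gt0.
  move/cvgrPdist_le : Pk => /(_ _ e2) Pk.
  near=> a.
  have a01 : 0 < a < 1 by near: a.
  have H1 := step _ _ M0 (mgj i) (fun x => gM x i).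
  have HBa : @frac_gradient_cst R n M a <= B by near: a.
  have H2 := step _ _ B0 (mga a) (fun x => le_trans (gaM a x a01) HBa).
  have H3 : `|\int[mu]_x (g x 0 i * k x) - \int[mu]_x (frac_gradient f M a x 0 i * k x)| <= e / 2.
    by near: a.
  have Hd : (B + M) * d <= e / 2.
    have -> : (B + M) * d = (e / 2) * ((B + M) / (B + M + 1)).
      by rewrite /d; field; rewrite gt_eqF.
    by apply: ler_piMr; [exact: ltW|rewrite ler_pdivrMr// mul1r lerDl].
  move: H1 H2 H3.
  set p := \int[mu]_x _; set q := \int[mu]_x _; set r := \int[mu]_x _; set s := \int[mu]_x _.
  by rewrite !ler_norml => /andP[? ?] /andP[? ?] /andP[? ?]; apply/andP; split; lra.
Unshelve. all: by end_near. Qed.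

End fractional_gradient_limit.

(** * Bounded representatives of Sobolev functions *)

Section bounded_representatives.
Context {R : realType} {n : nat}.
Local Notation mu := (lebesgue_rV R n).
Implicit Types (f : 'rV[R]_n -> R) (g phi : 'rV[R]_n -> 'rV[R]_n).

Lemma measurable_divergence phi : test_field phi -> measurable_fun setT (divergence phi).
Proof.
move=> [sphi _]; apply: measurable_sum => i; apply: continuous_measurable_rV => x.
have [cphi _] := sphi [:: i].
exact: (@continuous_comp _ _ _ (partial i phi) (fun y : 'rV[R]_n => y 0 i) x (cphi x)
  (@coord_continuous R 1 n 0 i _)).
Qed.

Lemma measurable_frac_divergence a phi : 0 < a -> a < 1 -> test_field phi ->
  measurable_fun setT (frac_divergence a phi).
Proof.
move=> a0 a1 tphi.
rewrite (_ : frac_divergence a phi = fun x : 'rV[R]_n =>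
    \sum_i \int[mu]_z ((phi (x + z) 0 i - phi x 0 i) * frac_kernel a i z)); last first.
  by apply/funext => x; exact: frac_divergenceE.
apply: measurable_sum => i; have [mphi _ _] := lip_csupp_test_field i tphi.
apply: (@measurable_Rintegral1 _ _ _ _ _ mu (fun p : 'rV[R]_n * 'rV[R]_n =>
  (phi (p.1 + p.2) 0 i - phi p.1 0 i) * frac_kernel a i p.2)).
apply: measurable_funM; last exact: measurableT_comp (measurable_frac_kernel a i) _.
apply: measurable_funB; last exact: measurableT_comp mphi _.
by apply: (measurableT_comp mphi); exact: measurable_rVD.
Qed.

Lemma ae_eq_is_weak_gradient f f0 g : measurable_fun setT f -> measurable_fun setT f0 ->
  {ae mu, forall x, f x = f0 x} -> is_weak_gradient f0 g -> is_weak_gradient f g.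
Proof.
move=> mf mf0 ff0 [gloc H]; split=> // phi tphi; rewrite -H//.
have md := measurable_divergence tphi.
apply: ae_eq_Rintegral; [exact: measurable_funM|exact: measurable_funM|].
by apply: filterS ff0 => x ->.
Qed.

Lemma ae_eq_is_weak_frac_gradient a f f0 g : 0 < a -> a < 1 ->
  measurable_fun setT f -> measurable_fun setT f0 ->
  {ae mu, forall x, f x = f0 x} -> is_weak_frac_gradient a f0 g ->
  is_weak_frac_gradient a f g.
Proof.
move=> a0 a1 mf mf0 ff0 [gloc H]; split=> // phi tphi; rewrite -H//.
have md := measurable_frac_divergence a0 a1 tphi.
apply: ae_eq_Rintegral; [exact: measurable_funM|exact: measurable_funM|].
by apply: filterS ff0 => x ->.
Qed.

Lemma measurable_clamp (c : R) : measurable_fun setT (clamp c).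
Proof. by apply: measurable_maxr => //; exact: measurable_minr. Qed.

(** Both [f] and the components of its gradient are truncated at their essential bounds [K] and [L].
    Changes on null sets preserve the weak identities, and [K + L] bounds both functions
    everywhere. *)
Lemma W1infty_bounded f : W1infty f -> exists f0 g0 (M : R),
  [/\ measurable_fun setT f, measurable_fun setT f0, measurable_fun setT g0 &
      {ae mu, forall x, f x = f0 x}] /\
  [/\ forall x, `|f0 x| <= M, forall x j, `|g0 x 0 j| <= M &
      is_weak_gradient f0 g0].
Proof.
move=> [/andP[mf ff] [g [wg gfun]]].
have {}mf : measurable_fun setT f by move: mf; rewrite inE.
have [K K0 HK] : exists2 K, 0 <= K & {ae mu, forall x, `|f x| <= K}.
  move: ff; rewrite inE /= /finite_norm => foo.
  have f0 : (0 <= Lnorm mu +oo (EFin \o f))%E by exact: Lnorm_ge0.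
  have ffin : Lnorm mu +oo (EFin \o f) \is a fin_num by rewrite ge0_fin_numE.
  exists (fine (Lnorm mu +oo (EFin \o f))); first exact: fine_ge0.
  by apply: (Lnorm_infty_leP mu f (fine_ge0 f0)).1; rewrite fineK.
have [L L0 HL] := vLfun_infty_ae gfun.
pose f0 x := clamp K (f x); pose g0 x := \row_i clamp L (g x 0 i).
have mf0 : measurable_fun setT f0 by exact: measurableT_comp (measurable_clamp K) mf.
have mg0 : measurable_fun setT g0.
  apply/measurable_fun_rVP => i; under eq_fun do rewrite mxE.
  exact: measurableT_comp (measurable_clamp L) (measurable_rV_coord i gfun.1).
have ff0 : {ae mu, forall x, f0 x = f x}.
  by apply: filterS HK => x Hx; rewrite /f0 clamp_id.
have gg0 : {ae mu, forall x, g x = g0 x}.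
  apply: filterS HL => x Hx; apply/rowP => i; rewrite /g0 mxE clamp_id//.
  exact: le_trans (coord_le_enorm _ _) Hx.
exists f0, g0, (K + L).
have bg0 x j : `|g0 x 0 j| <= L by rewrite /g0 mxE (clamp_bound _ L0).1.
split; first by split=> //; apply: filterS ff0 => x.
split=> [x|x j|].
- by apply: le_trans (clamp_bound (f x) K0).1 _; rewrite lerDl.
- by apply: le_trans (bg0 x j) _; rewrite lerDr.
- apply: (ae_eq_is_weak_gradient mf0 mf ff0); split; first exact: bounded_vL1loc mg0 bg0.
  move=> phi tphi; rewrite wg.2//; congr (- _).
  have mphi : measurable_fun setT phi.
    by apply/measurable_fun_rVP => i; have [] := lip_csupp_test_field i tphi.
  apply: ae_eq_Rintegral; [exact: measurable_dotr gfun.1 mphi|exact: measurable_dotr|].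
  by apply: filterS gg0 => x ->.
Qed.

End bounded_representatives.

(** * Duality between [L^1] and the [L^oo] norm *)

Section lower_semicontinuity.
Context {R : realType} {n : nat}.
Local Notation mu := (lebesgue_rV R n).
Implicit Types (g psi : 'rV[R]_n -> 'rV[R]_n).

Lemma dotr_vLnorm_le g psi (c : R) : 0 <= c -> measurable_fun setT g ->
  (vLnorm +oo g <= c%:E)%E -> vLfun 1 psi ->
  `|\int[mu]_x dotr (g x) (psi x)| <= c * \int[mu]_x enorm (psi x).
Proof.
move=> c0 mg gc psi1; have [mpsi psioo] := psi1.
have ie : mu.-integrable setT (EFin \o (fun x => enorm (psi x))).
  apply/integrableP; split; first by apply/measurable_EFinP; exact: measurable_enorm.
  by move: psioo; rewrite /vLnorm Lnorm1.
have mgpsi := measurable_dotr mg mpsi.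
(* The truncation agrees almost everywhere with the integrand and is dominated at every point by an
   integrable function. *)
pose q x := clamp (c * enorm (psi x)) (dotr (g x) (psi x)).
have mq : measurable_fun setT q.
  have mc : measurable_fun setT (fun x => c * enorm (psi x)).
    by apply: measurable_funM => //; exact: measurable_enorm.
  by apply: measurable_maxr; [exact: measurable_funN|exact: measurable_minr].
have qb x : `|q x| <= c * enorm (psi x).
  by apply: (clamp_bound _ _).1; rewrite mulr_ge0 ?enorm_ge0.
have iq : mu.-integrable setT (EFin \o q) by exact: integrable_le mq qb (integrableRZ c ie).
have -> : \int[mu]_x dotr (g x) (psi x) = \int[mu]_x q x.
  apply: ae_eq_Rintegral => //.
  have := (vLnorm_infty_leP g c0).1 gc; apply: filterS => x gx.
  rewrite /q clamp_id//; apply: le_trans (dotr_le_enorm _ _) _.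
  by rewrite ler_wpM2r ?enorm_ge0.
apply: le_trans (le_normr_Rintegral measurableT iq) _.
rewrite -RintegralZl//; apply: le_Rintegral => //; [exact: integrable_norm iq|exact: integrableRZ].
Qed.

(** The test field [psi] is [g] restricted to [A], left unnormalised to avoid dividing by the norm
    of [g]. The hypothesis then says that the integral over [A] of [enorm (g x) * (enorm (g x) - c)]
    is at most [0], while this integrand is positive on [A]. *)
Lemma vLnorm_infty_dual_le g (M c : R) : measurable_fun setT g -> 0 <= c ->
  (forall x i, `|g x 0 i| <= M) ->
  (forall psi, vLfun 1 psi ->
    \int[mu]_x dotr (g x) (psi x) <= c * \int[mu]_x enorm (psi x)) ->
  (vLnorm +oo g <= c%:E)%E.
Proof.
move=> mg c0 gM H; apply/vLnorm_infty_leP => //.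
have me := measurable_enorm mg.
suff Hk (k : nat) : {ae mu, forall x, cube k%:R x -> enorm (g x) <= c}.
  have := ae_foralln Hk; apply: filterS => x Hx.
  have : (\bigcup_k cube k%:R) x by rewrite bigcup_cube.
  by move=> [k _ /Hx].
pose A := [set x | c < enorm (g x)] `&` cube k%:R.
have mA : measurable A.
  apply: measurableI; last exact: measurable_cube.
  rewrite -[X in measurable X]setTI.
  have -> : [set x | c < enorm (g x)] = (fun x => enorm (g x)) @^-1` `]c, +oo[%classic.
    by apply/seteqP; split=> x /=; rewrite in_itv/= andbT.
  exact: me.
have A01 x : 0 <= \1_A x :> R by rewrite indicE.
have iA : mu.-integrable setT (EFin \o (\1_A : 'rV[R]_n -> R)).
  apply: integrable_indicT => //; apply: le_lt_trans (measure_cube_lty k%:R).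
  by apply: le_measure; [rewrite inE|rewrite inE; exact: measurable_cube|exact: subIsetr].
pose psi x := (\1_A x : R) *: g x.
have Ee x : enorm (psi x) = \1_A x * enorm (g x).
  rewrite /psi indicE; case: (x \in A); first by rewrite scale1r mul1r.
  by rewrite scale0r mul0r /enorm /dotr big1 ?sqrtr0// => i _; rewrite mxE mul0r.
have Ed x : dotr (g x) (psi x) = \1_A x * enorm (g x) ^+ 2.
  by rewrite enorm_sqr /dotr mulr_sumr; apply: eq_bigr => i _; rewrite mxE mulrCA.
have gB x : enorm (g x) <= n%:R * M by exact: enorm_le_bound.
have iAe : mu.-integrable setT (EFin \o (fun x => \1_A x * enorm (g x))).
  apply: integrable_le (integrableRZ (n%:R * M) iA).
    by apply: measurable_funM => //; exact: measurable_indic.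
  by move=> x; rewrite normrM (ger0_norm (A01 x)) (ger0_norm (enorm_ge0 _)) mulrC ler_wpM2r.
have iAe2 : mu.-integrable setT (EFin \o (fun x => \1_A x * enorm (g x) ^+ 2)).
  apply: integrable_le (integrableRZ ((n%:R * M) ^+ 2) iA).
    by apply: measurable_funM; [exact: measurable_indic|exact: measurable_funX].
  move=> x; rewrite normrM (ger0_norm (A01 x)) (ger0_norm (sqr_ge0 _)) mulrC ler_wpM2r//.
  by rewrite ler_pXn2r// ?nnegrE ?enorm_ge0// (le_trans (enorm_ge0 _) (gB x)).
have psi1 : vLfun 1 psi.
  split; first by apply: measurable_rVZ => //; exact: measurable_indic.
  rewrite /vLnorm Lnorm1; under eq_integral do rewrite Ee.
  by have /integrableP[_] := iAe.
have := H _ psi1.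
under eq_Rintegral do rewrite Ed.
under [in X in _ <= X -> _]eq_Rintegral do rewrite Ee.
rewrite -subr_le0 -RintegralZl// -RintegralB//; last exact: integrableRZ.
pose q x := \1_A x * (enorm (g x) * (enorm (g x) - c)) : R.
have qE x : \1_A x * enorm (g x) ^+ 2 - c * (\1_A x * enorm (g x)) = q x.
  by rewrite /q; ring.
under eq_Rintegral do rewrite qE.
have q0 x : 0 <= q x.
  rewrite /q indicE; have [/set_mem[/= cg _]|_] := boolP (x \in A); last by rewrite mul0r.
  by rewrite mul1r mulr_ge0 ?enorm_ge0// subr_ge0 ltW.
have iq : mu.-integrable setT (EFin \o q).
  have := integrableRB iAe2 (integrableRZ c iAe).
  by congr (_.-integrable _ _); apply/funext => x /=; rewrite qE.
move=> q_le0.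
have : (\int[mu]_x `|(EFin \o q) x| = 0)%E.
  under eq_integral => x _ do rewrite /= ger0_norm//.
  rewrite -(fineK (integrable_fin_num measurableT iq)); congr EFin.
  by apply/eqP; rewrite eq_le q_le0 Rintegral_ge0.
move=> /(ae_eq_integral_abs mu measurableT (measurable_int _ iq)).
apply: filterS => x /(_ I) /= [] qx xk; rewrite leNgt; apply/negP => cg.
move: qx; rewrite /q indicE mem_set// mul1r => /eqP; rewrite mulf_eq0 subr_eq0.
by rewrite !gt_eqF// (le_lt_trans c0).
Qed.

End lower_semicontinuity.

Lemma cvg_sumR (R : realType) (T I : Type) (F : set_system T) (FF : Filter F)
    (r : seq I) (u : I -> T -> R) (l : I -> R) :
  (forall i, u i a @[a --> F] --> l i) ->
  (\sum_(i <- r) u i a) @[a --> F] --> \sum_(i <- r) l i.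
Proof.
move=> ul; elim: r => [|i r IH].
  by under eq_fun do rewrite big_nil; rewrite big_nil; exact: cvg_cst.
by under eq_fun do rewrite big_cons; rewrite big_cons; exact: cvgD.
Qed.

(** * Comparison with the chosen weak gradients *)

Section representatives.
Context {R : realType} {n : nat}.
Local Notation mu := (lebesgue_rV R n).
Implicit Types (f : 'rV[R]_n -> R) (g : 'rV[R]_n -> 'rV[R]_n).

Lemma weak_gradient_ae f g : is_weak_gradient f g ->
  is_weak_gradient f (weak_gradient f) /\
  {ae mu, forall x, weak_gradient f x = g x}.
Proof.
move=> fg; have wG : is_weak_gradient f (weak_gradient f).
  by apply: (@xgetPex _ (fun=> 0) [set g | is_weak_gradient f g]); exists g.
split=> //; apply: vL1loc_unique wG.1 fg.1 _ => phi tphi.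
by apply: oppr_inj; rewrite -wG.2// -fg.2.
Qed.

Lemma weak_frac_gradient_ae a f g : is_weak_frac_gradient a f g ->
  is_weak_frac_gradient a f (weak_frac_gradient a f) /\
  {ae mu, forall x, weak_frac_gradient a f x = g x}.
Proof.
move=> fg; have wG : is_weak_frac_gradient a f (weak_frac_gradient a f).
  by apply: (@xgetPex _ (fun=> 0) [set g | is_weak_frac_gradient a f g]); exists g.
split=> //; apply: vL1loc_unique wG.1 fg.1 _ => phi tphi.
by apply: oppr_inj; rewrite -wG.2// -fg.2.
Qed.

Lemma ae_bounded_vLfun g h (B : R) : 0 <= B -> measurable_fun setT g ->
  {ae mu, forall x, g x = h x} -> (forall x i, `|h x 0 i| <= B) ->
  vLfun +oo g.
Proof.
move=> B0 mg gh hB; split=> //; apply: le_lt_trans (ltry (n%:R * B)).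
apply/vLnorm_infty_leP; first by rewrite mulr_ge0.
by apply: filterS gh => x ->; exact: enorm_le_bound.
Qed.

Lemma ae_eq_vLnorm_infty g h : {ae mu, forall x, g x = h x} ->
  (vLnorm +oo g = vLnorm +oo h)%E.
Proof.
move=> gh; rewrite /vLnorm unlock; case: ifP => // _; apply: eq_ess_sup.
by apply: filterS gh => x /= ->.
Qed.

Lemma ae_eq_Rintegral_dotr g h (psi : 'rV[R]_n -> 'rV[R]_n) : measurable_fun setT g ->
  measurable_fun setT h -> measurable_fun setT psi ->
  {ae mu, forall x, g x = h x} ->
  \int[mu]_x dotr (g x) (psi x) = \int[mu]_x dotr (h x) (psi x).
Proof.
move=> mg mh mpsi gh.
apply: ae_eq_Rintegral; [exact: measurable_dotr|exact: measurable_dotr|].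
by apply: filterS gh => x ->.
Qed.

End representatives.

(** * Lower semicontinuity of the norm under weak* convergence *)

Section weak_star_liminf.
Context {R : realType} {n : nat}.
Local Notation mu := (lebesgue_rV R n).

(** By contradiction: if the liminf is below [c], the norm less [e], then [g_ a] has norm below [c]
    frequently along [F]. A field violating the dual inequality for [g] at level [c] violates it for
    [g_ a] eventually. Both happen at a common [a], which is absurd, so the norm of [g] is at most
    [c]. *)
Lemma weak_star_cvg_liminf (F : set_system R) (FF : ProperFilter F)
    (g_ : R -> 'rV[R]_n -> 'rV[R]_n) (g g0 : 'rV[R]_n -> 'rV[R]_n) (M : R) :
  {ae mu, forall x, g x = g0 x} -> measurable_fun setT g0 ->
  (forall x i, `|g0 x 0 i| <= M) ->
  weak_star_cvg F g_ g ->
  (vLnorm +oo g <= limf_einf (fun a => vLnorm +oo (g_ a)) F)%E.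
Proof.
move=> gg0 mg0 g0M [Fg [mg goo] cvg_g].
have gf : vLnorm +oo g \is a fin_num by rewrite ge0_fin_numE// vLnorm_ge0.
apply/lee_subgt0Pr => e e0; rewrite leNgt; apply/negP.
set c := fine (vLnorm +oo g) - e.
have -> : (vLnorm +oo g - e%:E = c%:E)%E by rewrite /c EFinB fineK.
rewrite limf_einfE => cF.
(* The lower limit is a supremum of infima over the members of [F], so each of these infima is below
   [c]. *)
have freq V : F V -> exists2 a, V a & (vLnorm +oo (g_ a) < c%:E)%E.
  move=> FV; have : (ereal_inf [set vLnorm +oo (g_ a) | a in V] < c%:E)%E.
    by apply: le_lt_trans cF; apply: ereal_sup_ubound; exists V.
  by move=> /ereal_inf_lt[_ [a Va <-]]; exists a.
have [a0 _ a0c] := freq _ filterT.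
have c0 : 0 <= c by rewrite -lee_fin (le_trans (vLnorm_ge0 _ _) (ltW a0c)).
have : (vLnorm +oo g <= c%:E)%E.
  rewrite (ae_eq_vLnorm_infty gg0); apply: (vLnorm_infty_dual_le mg0 c0 g0M) => psi psi1.
  rewrite -(ae_eq_Rintegral_dotr mg mg0 psi1.1 gg0).
  rewrite leNgt; apply/negP => lt_c.
  have Fc : F [set a | c * \int[mu]_x enorm (psi x) < \int[mu]_x dotr (g_ a x) (psi x)].
    exact: (cvgr_gt _ (cvg_g _ psi1)).
  have [a [/= ca [mga _]] gac] := freq _ (filterI Fc Fg).
  have := dotr_vLnorm_le c0 mga (ltW gac) psi1.
  by move=> /(le_trans (ler_norm _)); rewrite leNgt ca.
by rewrite -(fineK gf) lee_fin /c lerBrDl gerDr leNgt e0.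
Qed.

End weak_star_liminf.

Unset Implicit Arguments.
Set Strict Implicit.

Theorem theorem4p12 (R : realType) (n : nat) (hn : (1 <= n)%N)
    (f : 'rV[R]_n -> R) (hf : W1infty f) :
  weak_star_cvg (1 : R)^'- (fun a : R => weak_frac_gradient a f)
    (weak_gradient f) /\
  (vLnorm +oo (weak_gradient f) <=
     limf_einf (fun a : R => vLnorm +oo (weak_frac_gradient a f)) (1 : R)^'-)%E.
Proof.
(* The estimates are applied to the bounded representatives [f0] and [g0]; the gradients of [f]
   chosen by [xget] agree with theirs almost everywhere. *)
have [f0 [g0 [M [[mf mf0 mg0 ff0] [f0M g0M wg0]]]]] := W1infty_bounded hf.
have M0 : 0 <= M by exact: le_trans (normr_ge0 _) (f0M 0).
have [wG GE] := weak_gradient_ae (ae_eq_is_weak_gradient mf mf0 ff0 wg0).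
have wGa a : 0 < a < 1 ->
    is_weak_frac_gradient a f (weak_frac_gradient a f) /\
    {ae lebesgue_rV R n, forall x, weak_frac_gradient a f x = frac_gradient f0 M a x}.
  move=> /andP[a0 a1]; apply: weak_frac_gradient_ae.
  apply: (ae_eq_is_weak_frac_gradient a0 a1 mf mf0 ff0).
  exact: (is_weak_frac_gradient_bounded mf0 mg0 f0M g0M wg0).
have near01 : \forall a \near (1 : R)^'-, 0 < a < 1.
  by apply: filterS (near_left1 (R := R)) => a /andP[a2 ->]; rewrite andbT; lra.
have gaB a : 0 < a < 1 ->
    forall x i, `|frac_gradient f0 M a x 0 i| <= @frac_gradient_cst R n M a.
  by move=> /andP[a0 a1] x i; exact: (frac_gradient_bound mf0 f0M).
have mga := @measurable_frac_gradient R n f0 M mf0.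
have wstar : weak_star_cvg (1 : R)^'- (fun a : R => weak_frac_gradient a f)
    (weak_gradient f).
  split.
  - apply: filterS near01 => a a01; have [[[mwa _] _] aE] := wGa a a01.
    apply: (ae_bounded_vLfun _ mwa aE (gaB a a01)).
    (* A coordinate exists since [1 <= n]; the constant bounds an absolute value at that coordinate
       and is therefore nonnegative. *)
    have i : 'I_n by exact: Ordinal hn.
    exact: le_trans (normr_ge0 _) (gaB a a01 0 i).
  - exact: (ae_bounded_vLfun M0 wG.1.1 GE g0M).
  - move=> psi psi1; have ipsi i := vLfun1_coord i psi1.
    rewrite (ae_eq_Rintegral_dotr wG.1.1 mg0 psi1.1 GE) (Rintegral_dotr mg0 g0M ipsi).
    have E : \forall a \near (1 : R)^'-,
        \sum_i \int[lebesgue_rV R n]_x (frac_gradient f0 M a x 0 i * psi x 0 i) =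
        \int[lebesgue_rV R n]_x dotr (weak_frac_gradient a f x) (psi x).
      apply: filterS near01 => a a01; have [wa aE] := wGa a a01.
      rewrite (ae_eq_Rintegral_dotr wa.1.1 (mga a) psi1.1 aE).
      by rewrite (Rintegral_dotr (mga a) (gaB a a01) ipsi).
    apply: cvg_trans (near_eq_cvg E) _; apply: cvg_sumR => i.
    exact: (frac_gradient_cvg_coord mf0 mg0 f0M g0M wg0).
by split=> //; exact: (weak_star_cvg_liminf _ GE mg0 g0M wstar).
Qed.
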